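(* Let ${\tt Z}=\{{\tt z}_k\}\subset\mathbb C$ be a sequence of finite upper density satisfying the Blaschke condition near $\infty$ for the upper and lower half-planes simultaneously: $\sum_{{\tt z}_k\ne0}\bigl|\operatorname{Im}\frac1{{\tt z}_k}\bigr|<+\infty$. Then for every $\varepsilon>0$ the exponential system $$\operatorname{Exp}^{\tt Z}:=\bigl\{z^m\exp({\tt z}_kz):0\le m\le n_{\tt Z}(\{{\tt z}_k\})-1\bigr\}$$ is not complete in the space $\operatorname{Hol}(S_\varepsilon)$ with the topology of uniform convergence on compact sets, whenever $S_\varepsilon$ is a vertical strip or a vertical half-strip of width $\varepsilon$.
   Context: $n_{\tt Z}(B)$ is the number of indices $k$ with ${\tt z}_k\in B$ (so $n_{\tt Z}(\{{\tt z}_k\})$ is the multiplicity of the point ${\tt z}_k$ in the sequence). Finite upper density: $\limsup_{r\to+\infty}\frac{n_{\tt Z}(\{|z|\le r\})}{r}<+\infty$. $\operatorname{Hol}(\Omega)$ is the space of holomorphic functions on the open set $\Omega$. A vertical strip of width $\varepsilon$ is $\{z:c<\operatorname{Re}z<c+\varepsilon\}$, $c\in\mathbb R$; a vertical half-strip of width $\varepsilon$ is the part of such a strip where $\operatorname{Im}z>d$, or the part where $\operatorname{Im}z<d$, for some $d\in\mathbb R$. A system is complete in a topological vector space if its linear span is dense. *)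

(* Defs.v *)
From Stdlib Require Import Reals ClassicalEpsilon.
From Coquelicot Require Import Coquelicot.
From Stdlib Require Import List.

Local Open Scope R_scope.

(* A point sequence is a map [z : nat -> option C], where [None] means that no
   point carries this index.  This covers infinite and finite sequences alike;
   points may be repeated. *)

(* [n_Z z B] is the number of indices [k] with [z_k] in [B], possibly [+oo]. *)
Definition indicator (z : nat -> option C) (B : C -> Prop) (k : nat) : R :=
  match z k with
  | Some w => if excluded_middle_informative (B w) then 1 else 0
  | None => 0
  end.

Definition n_Z (z : nat -> option C) (B : C -> Prop) : Rbar :=
  Sup_seq (fun N => Finite (sum_n (indicator z B) N)).

(* [limsup_{r -> +oo} f r] for a function of a real variable, as
   [inf_a sup_{r > a} f r]. *)
Definition LimSup_p_infty (f : R -> Rbar) : Rbar :=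
  Rbar_glb (fun s => exists a : R,
    s = Rbar_lub (fun y => exists r : R, a < r /\ y = f r)).

Definition finite_upper_density (z : nat -> option C) : Prop :=
  Rbar_lt
    (LimSup_p_infty
       (fun r => Rbar_div (n_Z z (fun w => Cmod w <= r)) (Finite r)))
    p_infty.

Definition Blaschke_near_infty (z : nat -> option C) : Prop :=
  ex_series (fun k =>
    match z k with
    | Some w => if Ceq_dec w 0 then 0 else Rabs (Im (/ w)%C)
    | None => 0
    end).

Definition Cexp (w : C) : C :=
  (exp (Re w) * cos (Im w), exp (Re w) * sin (Im w)).

Definition Exp_system (z : nat -> option C) (e : C -> C) : Prop :=
  exists (k : nat) (zk : C) (m : nat),
    z k = Some zk /\
    Rbar_le (Finite (INR m)) (Rbar_minus (n_Z z (fun w => w = zk)) (Finite 1)) /\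
    e = (fun w : C => (Cpow w m * Cexp (zk * w))%C).

(* Elements of [Hol(D)] are represented by total functions on [C]; only their
   values on [D] matter below. *)
Definition Hol (D : C -> Prop) (f : C -> C) : Prop :=
  forall w : C, D w -> ex_derive (K := C_AbsRing) (V := C_NormedModule) f w.

Definition span (E : (C -> C) -> Prop) (g : C -> C) : Prop :=
  exists l : list (C * (C -> C)),
    Forall (fun p => E (snd p)) l /\
    g = (fun w : C =>
           fold_right (fun p s => (fst p * snd p w + s)%C) (RtoC 0) l).

Definition compact_set {T : UniformSpace} (K : T -> Prop) : Prop :=
  forall U : (T -> Prop) -> Prop,
    (forall V, U V -> open V) ->
    (forall x, K x -> exists V, U V /\ V x) ->
    exists l : list (T -> Prop),
      Forall U l /\ forall x, K x -> exists V, In V l /\ V x.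

(* Density of the span, spelled out on the basic neighbourhoods
   [{g | |f - g| < delta on K}] of the topology of uniform convergence on
   compact subsets of [D]. *)
Definition complete_in_Hol (D : C -> Prop) (E : (C -> C) -> Prop) : Prop :=
  forall f : C -> C, Hol D f ->
  forall K : C -> Prop,
    compact_set (T := C_UniformSpace) K -> (forall w, K w -> D w) ->
  forall delta : R, 0 < delta ->
  exists g : C -> C, span E g /\
    forall w, K w -> Cmod (f w - g w)%C < delta.

Definition vertical_strip (eps : R) (S : C -> Prop) : Prop :=
  exists c : R, forall w : C, S w <-> c < Re w < c + eps.

Definition vertical_half_strip (eps : R) (S : C -> Prop) : Prop :=
  exists c d : R,
    (forall w : C, S w <-> c < Re w < c + eps /\ Im w > d) \/
    (forall w : C, S w <-> c < Re w < c + eps /\ Im w < d).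

(* Main.v *)
Require Import Defs.
From Stdlib Require Import Reals Lra Lia List Permutation Arith Bool ClassicalEpsilon.
From Coquelicot Require Import Coquelicot.
Import ListNotations.
Local Open Scope R_scope.

(** Take nodes [s = tau (n + 1/2)] and [T = pi / tau], so that [exp (2 i T s) = -1]
    at every node [s] and at [-s].  For a finite part of Z let [R = P / Q], where [P]
    vanishes on this part with multiplicity and [Q] has simple zeros at finitely many
    [+s], [-s], and put
      [L f = sum_s Res_s R * exp (i T s) * int_(-iT)^(iT) exp (-s z) f(z) dz].
    Integrating by parts, the boundary terms carry a factor independent of [s], so the
    Lagrange identity [sum_s p(s) / Q'(s) = 0] for [deg p <= deg Q - 2] shows that [L]
    kills [z^m exp (l z)] when [P] vanishes at [l] to order more than [m], whereas
    [L (z^mu) <> 0], [mu] being the multiplicity of the point 0.  Moving the contour to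
    [Re z = +h] and [-h], one bounds [L f] by a multiple of the supremum of [|f|] on a
    rectangle: the vertical sides need [|Res_s R| <= K exp (h |s| / 2)], the horizontal
    ones [|R (i y)| <= K / (1 + y^2)] and Parseval's identity.  If all constants are
    independent of the finite part, [z^mu] is not approximable on the rectangle.

    The second bound holds because each node replaces a zero of larger modulus.  For
    the first, zeros away from the real axis cost little since [sum 1/|z|] over them
    is small by the Blaschke condition.  Zeros clustered near a real point [lam] are
    matched with nodes shared equally among [J] dyadic distances from [lam]: at any
    point only boundedly many scales contribute a factor exceeding 1, so the
    logarithm of the total cost at [x] is [O (x / J)] by the density hypothesis. *)

(** * Finite sums, products and divided differences *)

(** The obstacle is that the width is arbitrarily small while the density is arbitrarily large: a
    naive matching multiplies the residues by exp (C x) with C proportional to the density, and only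
    exp (h x / 2) is affordable. Sharing a cluster among J scales divides C by J. Any J is allowed
    because nodes may be as dense as needed: shrinking tau only lengthens the rectangle, and neither
    a strip nor a half-strip limits its height. The price is a factor polynomial in x per cluster;
    clusters are geometric blocks, so only logarithmically many lie below x. Every paired zero comes
    with its negative, so that a far zero costs only O (x^2 / |z|^2), summable under finite density.
    Finitely many initial points, below the radius where the density bound starts or in the head of
    the Blaschke series, are never paired: they stay as zeros, compensated by a few additional
    nodes, and affect only constants. No limit of functionals is taken: the functional depends on
    the approximant, but its bound and its value at z^mu do not. *)

Definition Rsum {A : Type} (f : A -> R) (l : list A) : R :=
  fold_right (fun a s => f a + s) 0 l.
Definition Rprod {A : Type} (f : A -> R) (l : list A) : R :=
  fold_right (fun a s => f a * s) 1 l.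
Definition Csum {A : Type} (f : A -> C) (l : list A) : C :=
  fold_right (fun a s => (f a + s)%C) (RtoC 0) l.
Definition Cprod {A : Type} (f : A -> C) (l : list A) : C :=
  fold_right (fun a s => (f a * s)%C) (RtoC 1) l.

Section ListSums.
Context {A B : Type}.
Implicit Types (f g : A -> R) (l : list A).

Lemma Rsum_app f l1 l2 : Rsum f (l1 ++ l2) = Rsum f l1 + Rsum f l2.
Proof. induction l1 as [|a l1 IH]; simpl; [|rewrite IH]; lra. Qed.

Lemma Rprod_app f l1 l2 : Rprod f (l1 ++ l2) = Rprod f l1 * Rprod f l2.
Proof. induction l1 as [|a l1 IH]; simpl; [|rewrite IH]; ring. Qed.

Lemma Rprod_cons f a l : Rprod f (a :: l) = f a * Rprod f l.
Proof. reflexivity. Qed.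

Lemma Rsum_map (h : B -> A) f (l : list B) : Rsum f (map h l) = Rsum (fun b => f (h b)) l.
Proof. induction l as [|a l1 IH]; simpl; [|rewrite IH]; reflexivity. Qed.

Lemma Rprod_map (h : B -> A) f (l : list B) : Rprod f (map h l) = Rprod (fun b => f (h b)) l.
Proof. induction l as [|a l1 IH]; simpl; [|rewrite IH]; reflexivity. Qed.

Lemma Rprod_flat_map (h : B -> list A) f (l : list B) :
  Rprod f (flat_map h l) = Rprod (fun b => Rprod f (h b)) l.
Proof. induction l as [|a l1 IH]; simpl; [|rewrite Rprod_app, IH]; reflexivity. Qed.

Lemma Rsum_ext f g l : (forall a, In a l -> f a = g a) -> Rsum f l = Rsum g l.
Proof.
  induction l as [|a l IH]; simpl; intros H; [reflexivity|].
  rewrite (H a), IH; auto.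
Qed.

Lemma Rprod_ext f g l : (forall a, In a l -> f a = g a) -> Rprod f l = Rprod g l.
Proof.
  induction l as [|a l IH]; simpl; intros H; [reflexivity|].
  rewrite (H a), IH; auto.
Qed.

Lemma Rsum_le f g l : (forall a, In a l -> f a <= g a) -> Rsum f l <= Rsum g l.
Proof.
  induction l as [|a l IH]; simpl; intros H; [lra|].
  apply Rplus_le_compat; auto.
Qed.

Lemma Rsum_ge0 f l : (forall a, In a l -> 0 <= f a) -> 0 <= Rsum f l.
Proof.
  induction l as [|a l IH]; simpl; intros H; [lra|].
  apply Rplus_le_le_0_compat; auto.
Qed.

Lemma Rprod_ge0 f l : (forall a, In a l -> 0 <= f a) -> 0 <= Rprod f l.
Proof.
  induction l as [|a l IH]; simpl; intros H; [lra|].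
  apply Rmult_le_pos; auto.
Qed.

Lemma Rprod_gt0 f l : (forall a, In a l -> 0 < f a) -> 0 < Rprod f l.
Proof.
  induction l as [|a l IH]; simpl; intros H; [lra|].
  apply Rmult_lt_0_compat; auto.
Qed.

Lemma Rprod_le f g l :
  (forall a, In a l -> 0 <= f a <= g a) -> Rprod f l <= Rprod g l.
Proof.
  induction l as [|a l IH]; simpl; intros H; [lra|].
  apply Rmult_le_compat; try apply H; auto.
  apply Rprod_ge0. intros b Hb. apply H. auto.
Qed.

Lemma Rsum_plus f g l : Rsum (fun a => f a + g a) l = Rsum f l + Rsum g l.
Proof. induction l as [|a l IH]; simpl; [|rewrite IH]; lra. Qed.

Lemma Rsum_scal c f l : Rsum (fun a => c * f a) l = c * Rsum f l.
Proof. induction l as [|a l IH]; simpl; [|rewrite IH]; ring. Qed.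

Lemma Rprod_mult f g l : Rprod (fun a => f a * g a) l = Rprod f l * Rprod g l.
Proof. induction l as [|a l IH]; simpl; [|rewrite IH]; ring. Qed.

Lemma Rprod_exp f l : Rprod (fun a => exp (f a)) l = exp (Rsum f l).
Proof.
  induction l as [|a l IH]; simpl; [now rewrite exp_0|].
  now rewrite IH, exp_plus.
Qed.

Lemma Rsum_const c l : Rsum (fun _ => c) l = INR (length l) * c.
Proof.
  induction l as [|a l IH]; [simpl; lra|].
  change (c + Rsum (fun _ => c) l = INR (S (length l)) * c).
  rewrite IH, S_INR. ring.
Qed.

Lemma Rprod_const c l : Rprod (fun _ => c) l = c ^ length l.
Proof. induction l as [|a l IH]; simpl; [|rewrite IH]; reflexivity. Qed.

Lemma Rsum_exchange (F : A -> B -> R) (l : list A) (l' : list B) :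
  Rsum (fun a => Rsum (fun b => F a b) l') l = Rsum (fun b => Rsum (fun a => F a b) l) l'.
Proof.
  induction l as [|a l IH]; simpl.
  - induction l' as [|b l' IH']; simpl; lra.
  - rewrite IH. clear IH. induction l' as [|b l' IH']; simpl; [lra|].
    rewrite <- IH'. lra.
Qed.

Lemma Rsum_filter_le f (p : A -> bool) l :
  (forall a, In a l -> 0 <= f a) -> Rsum f (filter p l) <= Rsum f l.
Proof.
  induction l as [|a l IH]; simpl; intros H; [lra|].
  assert (H1 := H a (or_introl eq_refl)).
  assert (H2 : Rsum f (filter p l) <= Rsum f l) by auto.
  destruct (p a); simpl; lra.
Qed.

End ListSums.

Section ListSumsC.
Context {A B : Type}.
Implicit Types (f g : A -> C) (l : list A).

Lemma Csum_app f l1 l2 : Csum f (l1 ++ l2) = (Csum f l1 + Csum f l2)%C.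
Proof. induction l1 as [|a l1 IH]; simpl; [|rewrite IH]; ring. Qed.

Lemma Cprod_app f l1 l2 : Cprod f (l1 ++ l2) = (Cprod f l1 * Cprod f l2)%C.
Proof. induction l1 as [|a l1 IH]; simpl; [|rewrite IH]; ring. Qed.

Lemma Csum_map (h : B -> A) f (l : list B) : Csum f (map h l) = Csum (fun b => f (h b)) l.
Proof. induction l as [|a l1 IH]; simpl; [|rewrite IH]; reflexivity. Qed.

Lemma Cprod_cons f a l : Cprod f (a :: l) = (f a * Cprod f l)%C.
Proof. reflexivity. Qed.

Lemma Cprod_flat_map (h : B -> list A) f (l : list B) :
  Cprod f (flat_map h l) = Cprod (fun b => Cprod f (h b)) l.
Proof. induction l as [|a l1 IH]; simpl; [|rewrite Cprod_app, IH]; reflexivity. Qed.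

Lemma Csum_ext f g l : (forall a, In a l -> f a = g a) -> Csum f l = Csum g l.
Proof.
  induction l as [|a l IH]; simpl; intros H; [reflexivity|].
  rewrite (H a), IH; auto.
Qed.

Lemma Cprod_ext f g l : (forall a, In a l -> f a = g a) -> Cprod f l = Cprod g l.
Proof.
  induction l as [|a l IH]; simpl; intros H; [reflexivity|].
  rewrite (H a), IH; auto.
Qed.

Lemma Csum_plus f g l : Csum (fun a => f a + g a)%C l = (Csum f l + Csum g l)%C.
Proof. induction l as [|a l IH]; simpl; [|rewrite IH]; ring. Qed.

Lemma Csum_scal c f l : Csum (fun a => c * f a)%C l = (c * Csum f l)%C.
Proof. induction l as [|a l IH]; simpl; [|rewrite IH]; ring. Qed.

Lemma Cprod_neq0 f l : (forall a, In a l -> f a <> RtoC 0) -> Cprod f l <> RtoC 0.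
Proof.
  induction l as [|a l IH]; simpl; intros H.
  - intros E. apply RtoC_inj in E. lra.
  - apply Cmult_neq_0; auto.
Qed.

Lemma Cmod_Cprod f l : Cmod (Cprod f l) = Rprod (fun a => Cmod (f a)) l.
Proof.
  induction l as [|a l IH]; simpl; [apply Cmod_1|].
  now rewrite Cmod_mult, IH.
Qed.

Lemma Cmod_Csum f l : Cmod (Csum f l) <= Rsum (fun a => Cmod (f a)) l.
Proof.
  induction l as [|a l IH]; simpl; [rewrite Cmod_0; lra|].
  eapply Rle_trans; [apply Cmod_triangle|]. lra.
Qed.

Lemma Cprod_Permutation f l l' : Permutation l l' -> Cprod f l = Cprod f l'.
Proof. induction 1; simpl; [reflexivity|now f_equal|ring|congruence]. Qed.

End ListSumsC.

(* The value at [s] of the derivative of [prod (X - t)] when [s] is a simple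
   root, and the value of the product itself when [s] is not a root. *)
Definition dprod (sig : list C) (s : C) : C :=
  Cprod (fun t => if Ceq_dec t s then RtoC 1 else (s - t)%C) sig.

Arguments dprod : simpl never.

(** For distinct points of [sig] this is the divided difference of [f], in Lagrange form. *)
Definition divdiff (sig : list C) (f : C -> C) : C :=
  Csum (fun s => (f s / dprod sig s)%C) sig.

Lemma Cminus_neq0 (a b : C) : a <> b -> (a - b)%C <> RtoC 0.
Proof.
  intros H E. apply H. replace a with (a - b + b)%C by ring. rewrite E. ring.
Qed.

Lemma dprod_neq0 sig s : dprod sig s <> RtoC 0.
Proof.
  apply Cprod_neq0. intros t _. destruct (Ceq_dec t s) as [E|E].
  - intros H. apply RtoC_inj in H. lra.
  - apply Cminus_neq0. congruence.
Qed.

Lemma divdiff_ext sig f g :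
  (forall s, In s sig -> f s = g s) -> divdiff sig f = divdiff sig g.
Proof. intros H. apply Csum_ext. intros s Hs. now rewrite H. Qed.

Lemma divdiff_plus sig f g :
  divdiff sig (fun s => f s + g s)%C = (divdiff sig f + divdiff sig g)%C.
Proof.
  unfold divdiff. rewrite <- Csum_plus. apply Csum_ext. intros s _.
  unfold Cdiv. ring.
Qed.

Lemma divdiff_scal sig c f :
  divdiff sig (fun s => c * f s)%C = (c * divdiff sig f)%C.
Proof.
  unfold divdiff. rewrite <- Csum_scal. apply Csum_ext. intros s _.
  unfold Cdiv. ring.
Qed.

Lemma divdiff_swap a b sig f : divdiff (a :: b :: sig) f = divdiff (b :: a :: sig) f.
Proof.
  assert (E : forall s, dprod (a :: b :: sig) s = dprod (b :: a :: sig) s)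
    by (intros s; unfold dprod; simpl; ring).
  unfold divdiff. simpl. rewrite !E.
  rewrite (Csum_ext (fun s => (f s / dprod (a :: b :: sig) s)%C)
             (fun s => (f s / dprod (b :: a :: sig) s)%C) sig).
  - ring.
  - intros s _. now rewrite E.
Qed.

(** The factor s - a kills the term at a and cancels a from the other denominators, so multiplying
    by it removes a node. *)
Lemma divdiff_head a sig f : ~ In a sig ->
  divdiff (a :: sig) (fun s => (s - a) * f s)%C = divdiff sig f.
Proof.
  intros Ha. unfold divdiff. simpl.
  replace ((a - a) * f a / dprod (a :: sig) a)%C with (RtoC 0)
    by (unfold Cdiv; ring).
  rewrite Cplus_0_l. apply Csum_ext. intros s Hs.
  unfold dprod. simpl. destruct (Ceq_dec a s) as [E|E]; [congruence|].
  fold (dprod sig s). field. split; [apply dprod_neq0|].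
  apply Cminus_neq0. congruence.
Qed.

Lemma divdiff_1 sig : NoDup sig -> (2 <= length sig)%nat ->
  divdiff sig (fun _ => RtoC 1) = RtoC 0.
Proof.
  remember (length sig) as n eqn:En. revert sig En.
  induction n as [|n IH]; intros sig En ND Hn; [lia|].
  destruct sig as [|a [|b sig]]; simpl in En; try lia.
  inversion ND as [|? ? Ha ND1]; subst. inversion ND1 as [|? ? Hb ND2]; subst.
  assert (Hab : a <> b) by (intros E; apply Ha; now left).
  assert (Ha' : ~ In a sig) by (intros E; apply Ha; now right).
  assert (NDa : NoDup (a :: sig)) by now constructor.
  assert (E1 : divdiff (a :: b :: sig) (fun s => (s - a) * RtoC 1)%C
               = divdiff (b :: sig) (fun _ => RtoC 1)) by now apply divdiff_head.
  assert (E2 : divdiff (a :: b :: sig) (fun s => (s - b) * RtoC 1)%C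
               = divdiff (a :: sig) (fun _ => RtoC 1)).
  { rewrite divdiff_swap. apply divdiff_head. intros [E|E]; congruence. }
  (* The factors s - a and s - b differ by the constant b - a, so the two shortened divided
     differences differ by (b - a) times the full one. *)
  assert (E3 : divdiff (a :: b :: sig) (fun s => (s - a) * RtoC 1)%C
             = divdiff (a :: b :: sig) (fun s => (s - b) * 1 + (b - a) * 1)%C)
    by (apply divdiff_ext; intros; ring).
  rewrite divdiff_plus, E1, E2, divdiff_scal in E3.
  (* With two nodes both shortened sums are 1; with more, both vanish by induction. *)
  assert (E4 : divdiff (b :: sig) (fun _ => RtoC 1) = divdiff (a :: sig) (fun _ => RtoC 1)).
  { destruct sig as [|c sig].
    - unfold divdiff, dprod. simpl.
      destruct (Ceq_dec b b); [|congruence]. destruct (Ceq_dec a a); [|congruence].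
      reflexivity.
    - rewrite !IH; auto; simpl in *; lia. }
  rewrite E4 in E3.
  assert (E5 : ((b - a) * divdiff (a :: b :: sig) (fun _ => RtoC 1))%C = RtoC 0).
  { replace (RtoC 0) with (divdiff (a :: sig) (fun _ => RtoC 1) - divdiff (a :: sig) (fun _ => RtoC 1))%C by ring.
    rewrite E3 at 1. ring. }
  destruct (Ceq_dec (divdiff (a :: b :: sig) (fun _ => RtoC 1)) 0) as [E|E]; [exact E|].
  exfalso. revert E5. apply Cmult_neq_0; [|exact E].
  apply Cminus_neq0. congruence.
Qed.

(** Writing s - a = (s - t) + (t - a), with t the first node, trades a factor for a removed node or
    for a constant. *)
Lemma divdiff_low_degree al sig : NoDup sig -> (length al + 2 <= length sig)%nat ->
  divdiff sig (fun s => Cprod (fun a => s - a)%C al) = RtoC 0.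
Proof.
  revert sig. induction al as [|a al IH]; intros sig ND Hl.
  - simpl. apply divdiff_1; auto.
  - destruct sig as [|t sig]; [simpl in Hl; lia|].
    inversion ND as [|? ? Ht ND1]; subst.
    transitivity (divdiff (t :: sig) (fun s => (s - t) * Cprod (fun a => s - a) al
                    + (t - a) * Cprod (fun a => s - a) al)%C).
    { apply divdiff_ext. intros s _. simpl. ring. }
    rewrite divdiff_plus, divdiff_scal, divdiff_head by assumption.
    rewrite !IH; auto; simpl in *; try lia. ring.
Qed.

(** This is the Lagrange identity for the nodes together with w: the term at w is the right-hand
    side, the others are the negatives of the summands on the left. *)
Lemma partial_fractions al sig (w : C) : NoDup sig -> ~ In w sig ->
  (length al + 1 <= length sig)%nat ->
  Csum (fun s => Cprod (fun a => s - a) al / dprod sig s / (w - s))%C sig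
  = (Cprod (fun a => w - a) al / Cprod (fun s => w - s) sig)%C.
Proof.
  intros ND Hw Hl.
  assert (H := divdiff_low_degree al (w :: sig) (NoDup_cons _ Hw ND)).
  unfold divdiff in H. simpl in H. specialize (H ltac:(lia)).
  assert (E1 : dprod (w :: sig) w = Cprod (fun s => w - s)%C sig).
  { unfold dprod. simpl. destruct (Ceq_dec w w) as [_|]; [|congruence].
    rewrite Cmult_1_l. apply Cprod_ext. intros s Hs.
    destruct (Ceq_dec s w); congruence. }
  rewrite E1 in H.
  match goal with |- ?L = ?R =>
    enough (E2 : (R - L)%C = RtoC 0) by
      (replace L with (R - (R - L))%C by ring; rewrite E2; ring) end.
  rewrite <- H. unfold Cminus. f_equal.
  transitivity ((- 1) * Csum (fun s => Cprod (fun a => s + - a) al / dprod sig s / (w + - s)) sig)%C; [ring|].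
  rewrite <- Csum_scal. apply Csum_ext. intros s Hs.
  assert (E3 : dprod (w :: sig) s = ((s - w) * dprod sig s)%C).
  { unfold dprod. simpl. destruct (Ceq_dec w s); [congruence|reflexivity]. }
  assert (Hsw : w <> s) by congruence.
  change (s + - w)%C with (s - w)%C in *. rewrite E3. unfold Cminus. field.
  assert (H1 := Cminus_neq0 _ _ Hsw).
  assert (H2 : (s - w)%C <> RtoC 0) by (apply Cminus_neq0; congruence).
  repeat split; auto. apply dprod_neq0.
Qed.

(** * A Parseval bound for exponential sums *)

Lemma derive_ge0_incr (f df : R -> R) (a b : R) : a <= b ->
  (forall x, a <= x <= b -> is_derive f x (df x)) ->
  (forall x, a <= x <= b -> 0 <= df x) -> f a <= f b.
Proof.
  intros Hab Hd Hp.
  destruct (MVT_gen f a b df) as [c [Hc E]].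
  - intros x Hx. rewrite Rmin_left, Rmax_right in Hx by lra. apply Hd. lra.
  - intros x Hx. rewrite Rmin_left, Rmax_right in Hx by lra.
    apply continuity_pt_filterlim.
    apply (ex_derive_continuous f x). eexists. apply Hd. lra.
  - rewrite Rmin_left, Rmax_right in Hc by lra.
    assert (0 <= df c) by (apply Hp; lra). nra.
Qed.

Lemma is_derive_Rsum {A : Type} (F F' : A -> R -> R) (l : list A) (y : R) :
  (forall a, In a l -> is_derive (F a) y (F' a y)) ->
  is_derive (fun t => Rsum (fun a => F a t) l) y (Rsum (fun a => F' a y) l).
Proof.
  induction l as [|a l IH]; simpl; intros H.
  - apply (is_derive_const (K := R_AbsRing) (V := R_NormedModule)).
  - apply (is_derive_plus (K := R_AbsRing) (V := R_NormedModule)); auto.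
Qed.

Lemma is_lim_seq_Rsum {A : Type} (F : A -> nat -> R) (L : A -> R) (l : list A) :
  (forall a, In a l -> is_lim_seq (F a) (L a)) ->
  is_lim_seq (fun n => Rsum (fun a => F a n) l) (Rsum L l).
Proof.
  induction l as [|a l IH]; simpl; intros H.
  - apply is_lim_seq_const.
  - apply is_lim_seq_plus'; auto.
Qed.

(** A pair holds a coefficient and an exponent. Integrals of squared exponential sums are of this
    form, so they can be handled by differentiating the kernel or taking its limit entrywise. *)
Definition quadform (k : R -> R -> R) (l : list (R * R)) : R :=
  Rsum (fun p => Rsum (fun q => fst p * fst q * k (snd p) (snd q)) l) l.

Lemma is_derive_quadform (k k' : R -> R -> R -> R) (l : list (R * R)) (y : R) :
  (forall p q, In p l -> In q l ->
     is_derive (fun t => k t (snd p) (snd q)) y (k' y (snd p) (snd q))) ->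
  is_derive (fun t => quadform (k t) l) y (quadform (k' y) l).
Proof.
  intros H. unfold quadform.
  apply (is_derive_Rsum (fun p t => Rsum (fun q => fst p * fst q * k t (snd p) (snd q)) l)
          (fun p t => Rsum (fun q => fst p * fst q * k' t (snd p) (snd q)) l)).
  intros p Hp.
  apply (is_derive_Rsum (fun q t => fst p * fst q * k t (snd p) (snd q))
          (fun q t => fst p * fst q * k' t (snd p) (snd q))).
  intros q Hq. apply (is_derive_scal (fun t => k t (snd p) (snd q))). auto.
Qed.

Lemma is_lim_seq_quadform (k : nat -> R -> R -> R) (k' : R -> R -> R) (l : list (R * R)) :
  (forall p q, In p l -> In q l ->
     is_lim_seq (fun n => k n (snd p) (snd q)) (k' (snd p) (snd q))) ->
  is_lim_seq (fun n => quadform (k n) l) (quadform k' l).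
Proof.
  intros H. unfold quadform.
  apply (is_lim_seq_Rsum (fun p n => Rsum (fun q => fst p * fst q * k n (snd p) (snd q)) l)).
  intros p Hp.
  apply (is_lim_seq_Rsum (fun q n => fst p * fst q * k n (snd p) (snd q))).
  intros q Hq.
  apply (is_lim_seq_scal_l (fun n => k n (snd p) (snd q)) _ (k' (snd p) (snd q))). auto.
Qed.

Lemma quadform_ext (k k' : R -> R -> R) (l : list (R * R)) :
  (forall p q, In p l -> In q l -> k (snd p) (snd q) = k' (snd p) (snd q)) ->
  quadform k l = quadform k' l.
Proof.
  intros H. apply Rsum_ext. intros p Hp. apply Rsum_ext. intros q Hq.
  now rewrite H.
Qed.

Lemma quadform_plus (k k' : R -> R -> R) (l : list (R * R)) :
  quadform (fun s t => k s t + k' s t) l = quadform k l + quadform k' l.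
Proof.
  unfold quadform. rewrite <- Rsum_plus. apply Rsum_ext. intros p _.
  rewrite <- Rsum_plus. apply Rsum_ext. intros q _. ring.
Qed.

Lemma quadform_scal c (k : R -> R -> R) (l : list (R * R)) :
  quadform (fun s t => c * k s t) l = c * quadform k l.
Proof.
  unfold quadform. rewrite <- Rsum_scal. apply Rsum_ext. intros p _.
  rewrite <- Rsum_scal. apply Rsum_ext. intros q _. ring.
Qed.

Lemma quadform_square (u : R -> R) (l : list (R * R)) :
  quadform (fun s t => u s * u t) l = (Rsum (fun p => fst p * u (snd p)) l) ^ 2.
Proof.
  unfold quadform.
  transitivity (Rsum (fun p => Rsum (fun p => fst p * u (snd p)) l * (fst p * u (snd p))) l).
  - apply Rsum_ext. intros p _. rewrite (Rmult_comm (Rsum _ _)), <- Rsum_scal.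
    apply Rsum_ext. intros q _. ring.
  - rewrite Rsum_scal. ring.
Qed.

(** [rpart] and [ipart] are the real and imaginary parts of the sum of c / (s - i y) over the pairs
    (c, s). *)
Definition rpart (l : list (R * R)) (y : R) : R :=
  Rsum (fun p => fst p * (snd p / (snd p ^ 2 + y ^ 2))) l.
Definition ipart (l : list (R * R)) (y : R) : R :=
  Rsum (fun p => fst p * (y / (snd p ^ 2 + y ^ 2))) l.

(** Antiderivative in y, zero at y = 0, of the real part of 1 / ((s - i y) (t + i y)). Partial
    fractions yield the arctangents; the case s + t = 0 is their limit. *)
Definition poisson_primitive (y s t : R) : R :=
  if Req_EM_T (s + t) 0 then - y / (s ^ 2 + y ^ 2)
  else (atan (y / s) + atan (y / t)) / (s + t).

Lemma sq_plus_pos (s y : R) : s <> 0 -> 0 < s ^ 2 + y ^ 2.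
Proof. intros H. assert (0 < s ^ 2) by nra. nra. Qed.

Lemma is_derive_poisson_primitive (s t y : R) : s <> 0 -> t <> 0 ->
  is_derive (fun y => poisson_primitive y s t) y
    (s / (s ^ 2 + y ^ 2) * (t / (t ^ 2 + y ^ 2))
     + y / (s ^ 2 + y ^ 2) * (y / (t ^ 2 + y ^ 2))).
Proof.
  intros Hs Ht. unfold poisson_primitive.
  assert (H1 := sq_plus_pos s y Hs). assert (H2 := sq_plus_pos t y Ht).
  destruct (Req_EM_T (s + t) 0) as [E|E].
  - assert (E' : t = - s) by lra. subst t.
    auto_derive; [lra|]. field; repeat split; nra.
  - assert (D : forall u, u <> 0 -> is_derive (fun y => atan (y / u)) y (u / (u ^ 2 + y ^ 2))).
    { intros u Hu. assert (H3 := sq_plus_pos u y Hu).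
      apply (is_derive_ext (fun y => atan (y * / u))); [reflexivity|].
      replace (u / (u ^ 2 + y ^ 2)) with (scal (/ u) (/ (1 + (y * / u)²))).
      - apply (is_derive_comp atan (fun y => y * / u)).
        + apply is_derive_atan.
        + auto_derive; [trivial|ring].
      - unfold scal; simpl. unfold mult; simpl. unfold Rsqr. field.
        split; [nra|exact Hu]. }
    apply (is_derive_ext (fun y => / (s + t) * (atan (y / s) + atan (y / t)))).
    { intros z. apply (Rmult_comm (/ (s + t))). }
    replace (s / (s ^ 2 + y ^ 2) * (t / (t ^ 2 + y ^ 2))
     + y / (s ^ 2 + y ^ 2) * (y / (t ^ 2 + y ^ 2))) with
      (/ (s + t) * (s / (s ^ 2 + y ^ 2) + t / (t ^ 2 + y ^ 2))) by (field; lra).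
    apply (is_derive_scal (fun y => atan (y / s) + atan (y / t))).
    apply (is_derive_plus (K := R_AbsRing) (V := R_NormedModule)); auto.
Qed.

(** The integral of exp (- s x) exp (- t x) over x > 0, with exponents that are not positive
    discarded. *)
Definition poskernel (s t : R) : R :=
  if Rlt_dec 0 s then if Rlt_dec 0 t then / (s + t) else 0 else 0.

Lemma is_lim_seq_inv_INR (c : R) : is_lim_seq (fun n => c / INR n) 0.
Proof.
  replace (Finite 0) with (Rbar_mult c 0) by (simpl; f_equal; ring).
  apply is_lim_seq_scal_l.
  replace (Finite 0) with (Rbar_inv p_infty) by reflexivity.
  apply is_lim_seq_inv; [apply is_lim_seq_INR|discriminate].
Qed.

Lemma is_lim_seq_atan_pos (s : R) : 0 < s ->
  is_lim_seq (fun n => atan (INR n / s)) (PI / 2).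
Proof.
  intros Hs.
  apply is_lim_seq_ext_loc with (fun n => PI / 2 - atan (s / INR n)).
  - exists 1%nat. intros n Hn. assert (0 < INR n) by (apply lt_0_INR; lia).
    rewrite <- atan_inv by (apply Rdiv_lt_0_compat; lra).
    f_equal. field. lra.
  - replace (Finite (PI / 2)) with (Finite (PI / 2 - atan 0)) by (rewrite atan_0; f_equal; lra).
    apply (is_lim_seq_minus' (fun _ => PI / 2)); [apply is_lim_seq_const|].
    apply (is_lim_seq_continuous atan _ 0); [|apply is_lim_seq_inv_INR].
    apply derivable_continuous_pt. exists (/ (1 + 0 ^ 2)).
    apply derivable_pt_lim_atan.
Qed.

Lemma is_lim_seq_atan_neg (s : R) : s < 0 ->
  is_lim_seq (fun n => atan (INR n / s)) (- (PI / 2)).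
Proof.
  intros Hs.
  apply is_lim_seq_ext with (fun n => - atan (INR n / - s)).
  - intros n. rewrite <- atan_opp. f_equal. field. lra.
  - apply (proj1 (is_lim_seq_opp _ (Finite (PI / 2)))), is_lim_seq_atan_pos. lra.
Qed.

(** As y grows, atan (y / s) tends to PI / 2 with the sign of s, so exponents of opposite signs
    cancel in the limit. This is the orthogonality of the two half-lines in Parseval's identity. *)
Lemma is_lim_seq_poisson_primitive (s t : R) : s <> 0 -> t <> 0 ->
  is_lim_seq (fun n => poisson_primitive (INR n) s t)
    (PI * (poskernel s t + poskernel (- s) (- t))).
Proof.
  intros Hs Ht. unfold poisson_primitive, poskernel.
  destruct (Req_EM_T (s + t) 0) as [E|E].
  - replace (PI * _) with 0.
    + assert (E0 : forall n, (1 <= n)%nat ->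
        - INR n / (s ^ 2 + INR n ^ 2) = - (1 / INR n * / (s ^ 2 / INR n / INR n + 1))).
      { intros n Hn. assert (0 < INR n) by (apply lt_0_INR; lia).
        assert (0 < s ^ 2) by nra. field. split; nra. }
      apply (is_lim_seq_le_le_loc (fun n => - 1 / INR n) _ (fun _ => 0)).
      * exists 1%nat. intros n Hn. assert (0 < INR n) by (apply lt_0_INR; lia).
        assert (0 < s ^ 2) by nra. split.
        -- apply Rmult_le_reg_r with (INR n * (s ^ 2 + INR n ^ 2)); [apply Rmult_lt_0_compat; nra|].
           field_simplify; nra.
        -- apply Rmult_le_reg_r with (s ^ 2 + INR n ^ 2); [nra|].
           field_simplify; nra.
      * apply is_lim_seq_inv_INR.
      * apply is_lim_seq_const.
    + destruct (Rlt_dec 0 s), (Rlt_dec 0 t), (Rlt_dec 0 (- s)), (Rlt_dec 0 (- t));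
        first [lra | exfalso; apply Hs; lra | exfalso; apply Ht; lra].
  - assert (G : forall a b : R, is_lim_seq (fun n => atan (INR n / s)) a ->
        is_lim_seq (fun n => atan (INR n / t)) b ->
        is_lim_seq (fun n => (atan (INR n / s) + atan (INR n / t)) / (s + t)) ((a + b) * / (s + t))).
    { intros a b Ha Hb. unfold Rdiv at 1.
      apply (is_lim_seq_scal_r (fun n => atan (INR n / s) + atan (INR n / t)) (/ (s + t)) (a + b)).
      now apply is_lim_seq_plus'. }
    destruct (Rlt_dec 0 s) as [s1|s1], (Rlt_dec 0 t) as [t1|t1],
      (Rlt_dec 0 (- s)), (Rlt_dec 0 (- t));
      first [lra | exfalso; apply Hs; lra | exfalso; apply Ht; lra | idtac].
    + replace (PI * _) with ((PI / 2 + PI / 2) * / (s + t)) by (field; lra).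
      apply G; now apply is_lim_seq_atan_pos.
    + replace (PI * _) with ((PI / 2 + - (PI / 2)) * / (s + t)) by (field; lra).
      apply G; [apply is_lim_seq_atan_pos|apply is_lim_seq_atan_neg]; lra.
    + replace (PI * _) with ((- (PI / 2) + (PI / 2)) * / (s + t)) by (field; lra).
      apply G; [apply is_lim_seq_atan_neg|apply is_lim_seq_atan_pos]; lra.
    + replace (PI * _) with ((- (PI / 2) + - (PI / 2)) * / (s + t)) by (field; lra).
      apply G; apply is_lim_seq_atan_neg; lra.
Qed.

Definition posexp (l : list (R * R)) (x : R) : R :=
  Rsum (fun p => fst p * (if Rlt_dec 0 (snd p) then exp (- snd p * x) else 0)) l.

(** The integral of the square of [posexp l] from 0 to x, in closed form. *)
Definition posexp_energy (l : list (R * R)) (x : R) : R :=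
  quadform (fun s t => poskernel s t * (1 - exp (- (s + t) * x))) l.

Lemma is_derive_posexp_energy (l : list (R * R)) (x : R) :
  is_derive (posexp_energy l) x (posexp l x ^ 2).
Proof.
  unfold posexp_energy, posexp.
  rewrite <- (quadform_square (fun s => if Rlt_dec 0 s then exp (- s * x) else 0)).
  apply (is_derive_quadform (fun x s t => poskernel s t * (1 - exp (- (s + t) * x)))
    (fun x s t => (if Rlt_dec 0 s then exp (- s * x) else 0)
       * (if Rlt_dec 0 t then exp (- t * x) else 0))).
  intros p q _ _. unfold poskernel.
  destruct (Rlt_dec 0 (snd p)), (Rlt_dec 0 (snd q)).
  - rewrite <- exp_plus. auto_derive; [trivial|].
    replace (- snd p * x + - snd q * x) with (- (snd p + snd q) * x) by ring.
    field. lra.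
  - auto_derive; [trivial|ring].
  - auto_derive; [trivial|ring].
  - auto_derive; [trivial|ring].
Qed.

Lemma posexp_energy_0 (l : list (R * R)) : posexp_energy l 0 = 0.
Proof.
  unfold posexp_energy.
  rewrite (quadform_ext _ (fun s t => 0 * 0)).
  - rewrite quadform_scal. ring.
  - intros p q _ _. rewrite Rmult_0_r, exp_0. ring.
Qed.

Lemma posexp_energy_incr (l : list (R * R)) (x y : R) : x <= y ->
  posexp_energy l x <= posexp_energy l y.
Proof.
  intros H. apply derive_ge0_incr with (fun x => posexp l x ^ 2); auto.
  - intros; apply is_derive_posexp_energy.
  - intros; nra.
Qed.

Lemma posexp_energy_le (l : list (R * R)) (x : R) :
  posexp_energy l x <= quadform poskernel l.
Proof.
  assert (H : is_lim_seq (fun n => posexp_energy l (INR n)) (quadform poskernel l)).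
  { apply (is_lim_seq_quadform (fun n s t => poskernel s t * (1 - exp (- (s + t) * INR n)))).
    intros p q _ _. unfold poskernel.
    destruct (Rlt_dec 0 (snd p)), (Rlt_dec 0 (snd q));
      try (apply is_lim_seq_ext with (fun _ => 0);
             [intros; ring|apply is_lim_seq_const]).
    replace (Finite (/ (snd p + snd q))) with
      (Rbar_mult (/ (snd p + snd q)) (Finite (1 - 0))) by (simpl; f_equal; ring).
    apply (is_lim_seq_scal_l (fun n => 1 - exp (- (snd p + snd q) * INR n)) _ (1 - 0)).
    apply (is_lim_seq_minus' (fun _ => 1)); [apply is_lim_seq_const|].
    apply is_lim_seq_ext with (fun n => exp (- (snd p + snd q)) ^ n).
    - intros n. rewrite Rmult_comm. induction n as [|n IH].
      + simpl. now rewrite Rmult_0_l, exp_0.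
      + rewrite S_INR, Rmult_plus_distr_r, Rmult_1_l, exp_plus. simpl.
        rewrite IH. ring.
    - apply is_lim_seq_geom. rewrite Rabs_pos_eq by (left; apply exp_pos).
      rewrite <- exp_0. apply exp_increasing. lra. }
  destruct (nfloor_ex (Rmax 0 x)) as [N HN]; [apply Rmax_l|].
  apply Rle_trans with (posexp_energy l (INR N + 1)).
  { apply posexp_energy_incr. assert (H1 := Rmax_r 0 x). lra. }
  rewrite <- S_INR.
  apply (is_lim_seq_le_loc (fun _ => posexp_energy l (INR (S N)))
           (fun n => posexp_energy l (INR n)) (posexp_energy l (INR (S N)))
           (quadform poskernel l)).
  - exists (S N). intros n Hn. apply posexp_energy_incr. now apply le_INR.
  - apply is_lim_seq_const.
  - exact H.
Qed.

(* Parseval for the exponential sum whose Laplace transform is, up to sign,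
   the rational function with poles [snd p] and residues [fst p], restricted to
   the imaginary axis. *)
Lemma posexp_energy_bound (l : list (R * R)) (K : R) :
  (forall p, In p l -> snd p <> 0) ->
  (forall y, rpart l y ^ 2 + ipart l y ^ 2 <= K / (1 + y ^ 2)) ->
  forall x, posexp_energy l x <= K / 2.
Proof.
  intros Hl HK x.
  set (l' := map (fun p => (fst p, - snd p)) l).
  assert (E : quadform poskernel l' = quadform (fun s t => poskernel (- s) (- t)) l).
  { unfold quadform, l'. rewrite Rsum_map. apply Rsum_ext. intros p _.
    rewrite Rsum_map. reflexivity. }
  assert (H0 : 0 <= quadform poskernel l').
  { eapply Rle_trans; [|apply (posexp_energy_le _ 0)]. rewrite posexp_energy_0. lra. }
  assert (Hx := posexp_energy_le l x).
  (* The left side is the integral from 0 to y of the squared modulus on the axis, at most K atan y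
     by hypothesis. *)
  assert (HB : forall y, 0 <= y -> quadform (poisson_primitive y) l <= K * (PI / 2)).
  { intros y Hy.
    assert (HK0 : 0 <= K).
    { specialize (HK 0). assert (0 <= K / (1 + 0 ^ 2)) by nra.
      replace (K / (1 + 0 ^ 2)) with K in * by field. lra. }
    assert (D : forall y, is_derive (fun y => quadform (poisson_primitive y) l) y
               (rpart l y ^ 2 + ipart l y ^ 2)).
    { intros t. unfold rpart, ipart.
      rewrite <- (quadform_square (fun s => s / (s ^ 2 + t ^ 2))).
      rewrite <- (quadform_square (fun s => t / (s ^ 2 + t ^ 2))).
      rewrite <- quadform_plus.
      apply (is_derive_quadform poisson_primitive
        (fun y s t => s / (s ^ 2 + y ^ 2) * (t / (t ^ 2 + y ^ 2))
         + y / (s ^ 2 + y ^ 2) * (y / (t ^ 2 + y ^ 2)))).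
      intros p q Hp Hq. apply is_derive_poisson_primitive; auto. }
    assert (I : K * atan 0 - quadform (poisson_primitive 0) l
                <= K * atan y - quadform (poisson_primitive y) l).
    { apply (derive_ge0_incr (fun y => K * atan y - quadform (poisson_primitive y) l)
         (fun y => K * / (1 + y²) - (rpart l y ^ 2 + ipart l y ^ 2))); auto.
      - intros t _.
        apply (is_derive_minus (K := R_AbsRing) (V := R_NormedModule)).
        + apply (is_derive_scal atan). apply is_derive_atan.
        + apply D.
      - intros t _. specialize (HK t). unfold Rdiv, Rsqr in *.
        replace (t * t) with (t ^ 2) by ring. lra. }
    assert (Z : quadform (poisson_primitive 0) l = 0).
    { rewrite (quadform_ext _ (fun s t => 0 * 0)); [rewrite quadform_scal; ring|].
      intros p q _ _. unfold poisson_primitive.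
      destruct (Req_EM_T (snd p + snd q) 0); unfold Rdiv;
        rewrite ?Ropp_0, ?Rmult_0_l, ?atan_0; ring. }
    rewrite Z, atan_0 in I. assert (A := atan_bound y). nra. }
  assert (HL : Rbar_le (Finite (quadform (fun s t => PI * (poskernel s t + poskernel (- s) (- t))) l))
                 (Finite (K * (PI / 2)))).
  { apply (is_lim_seq_le_loc (fun n => quadform (poisson_primitive (INR n)) l)
             (fun _ => K * (PI / 2))).
    - exists 0%nat. intros n _. apply HB, pos_INR.
    - apply (is_lim_seq_quadform (fun n s t => poisson_primitive (INR n) s t)
        (fun s t => PI * (poskernel s t + poskernel (- s) (- t)))).
      intros p q Hp Hq. apply is_lim_seq_poisson_primitive; auto.
    - apply is_lim_seq_const. }
  simpl in HL. rewrite quadform_scal, quadform_plus, <- E in HL.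
  assert (P := PI_RGT_0). nra.
Qed.

(** * Primitives along segments *)

Lemma Cexp_plus (a b : C) : Cexp (a + b) = (Cexp a * Cexp b)%C.
Proof.
  unfold Cexp. destruct a as [a1 a2], b as [b1 b2].
  unfold Cmult, Cplus, Re, Im; simpl.
  rewrite exp_plus, cos_plus, sin_plus. f_equal; ring.
Qed.

Lemma Cexp_0 : Cexp 0 = RtoC 1.
Proof.
  unfold Cexp, RtoC, Re, Im; simpl. rewrite exp_0, cos_0, sin_0. f_equal; ring.
Qed.

Lemma Cmod_Cexp (a : C) : Cmod (Cexp a) = exp (Re a).
Proof.
  unfold Cexp, Cmod; simpl.
  replace (_ + _) with (exp (Re a) ^ 2 * (Rsqr (sin (Im a)) + Rsqr (cos (Im a))))
    by (unfold Rsqr; ring).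
  rewrite sin2_cos2, Rmult_1_r. apply sqrt_pow2. left. apply exp_pos.
Qed.

Definition path_derive (F : R -> C) (t : R) (l : C) : Prop :=
  is_derive (fun t => Re (F t)) t (Re l) /\ is_derive (fun t => Im (F t)) t (Im l).

(** The scalar product of F with the fixed vector D = F b - F a is a real function with derivative
    at most |D| m'. Its total increase is |D|^2, and one factor |D| cancels. *)
Lemma path_mean_value (F F' : R -> C) (m m' : R -> R) (a b : R) : a <= b ->
  (forall x, a <= x <= b -> path_derive F x (F' x)) ->
  (forall x, a <= x <= b -> is_derive m x (m' x)) ->
  (forall x, a <= x <= b -> Cmod (F' x) <= m' x) ->
  Cmod (F b - F a) <= m b - m a.
Proof.
  intros Hab HF Hm Hle.
  assert (I1 : m a <= m b).
  { apply derive_ge0_incr with m'; auto. intros x Hx.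
    eapply Rle_trans; [apply Cmod_ge_0|]. apply Hle, Hx. }
  set (D := (F b - F a)%C).
  destruct (Rle_lt_or_eq_dec 0 (Cmod D) (Cmod_ge_0 D)) as [Hp|Hp]; [|lra].
  set (G := fun x => Re D * Re (F x) + Im D * Im (F x)).
  assert (HG : Cmod D * m a - G a <= Cmod D * m b - G b).
  { apply (derive_ge0_incr (fun x => Cmod D * m x - G x)
      (fun x => Cmod D * m' x - (Re D * Re (F' x) + Im D * Im (F' x)))); auto.
    - intros x Hx. destruct (HF x Hx) as [H1 H2].
      apply (is_derive_minus (K := R_AbsRing) (V := R_NormedModule)).
      + apply (is_derive_scal m). auto.
      + apply (is_derive_plus (K := R_AbsRing) (V := R_NormedModule)).
        * apply (is_derive_scal (fun x => Re (F x))). exact H1.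
        * apply (is_derive_scal (fun x => Im (F x))). exact H2.
    - intros x Hx. specialize (Hle x Hx).
      assert (H : Re D * Re (F' x) + Im D * Im (F' x) <= Cmod D * Cmod (F' x)).
      { replace (Re D * Re (F' x) + Im D * Im (F' x)) with (Re (Cconj D * F' x)%C)
          by (unfold Cconj, Cmult, Re, Im; simpl; ring).
        eapply Rle_trans; [apply Rle_abs|]. eapply Rle_trans; [apply Rmax_l|].
        eapply Rle_trans; [apply Rmax_Cmod|]. rewrite Cmod_mult, Cmod_conj. lra. }
      assert (Cmod D * Cmod (F' x) <= Cmod D * m' x)
        by (apply Rmult_le_compat_l; lra).
      lra. }
  assert (E : G b - G a = Cmod D * Cmod D).
  { replace (Cmod D * Cmod D) with (Cmod D ^ 2) by ring.
    unfold G.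
    assert (E1 : Re D = Re (F b) - Re (F a)) by reflexivity.
    assert (E2 : Im D = Im (F b) - Im (F a)) by reflexivity.
    assert (E3 : Cmod D ^ 2 = Re D ^ 2 + Im D ^ 2).
    { unfold Cmod. rewrite pow2_sqrt; [reflexivity|]. nra. }
    rewrite E3. rewrite E1, E2. ring. }
  nra.
Qed.

(** Derivatives along real lines are all that integrals over segments require: an integral becomes a
    difference of values of [Phi], and moving a contour becomes telescoping, without Cauchy's
    theorem. *)
Definition line_primitive (Phi f : C -> C) : Prop :=
  forall (z v : C) (t : R),
    path_derive (fun t => Phi (z + t * v)%C) t (v * f (z + t * v))%C.

Lemma line_primitive_ext (Phi Psi f g : C -> C) :
  (forall z, Phi z = Psi z) -> (forall z, f z = g z) ->
  line_primitive Phi f -> line_primitive Psi g.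
Proof.
  intros H1 H2 H z v t. destruct (H z v t) as [Ha Hb]. rewrite <- H2. split.
  - eapply is_derive_ext; [|exact Ha]. intros s. simpl. now rewrite H1.
  - eapply is_derive_ext; [|exact Hb]. intros s. simpl. now rewrite H1.
Qed.

Lemma line_primitive_plus (Phi Psi f g : C -> C) :
  line_primitive Phi f -> line_primitive Psi g ->
  line_primitive (fun z => Phi z + Psi z)%C (fun z => f z + g z)%C.
Proof.
  intros H1 H2 z v t. destruct (H1 z v t) as [A1 B1], (H2 z v t) as [A2 B2].
  split.
  - replace (Re (v * _)%C) with
      (Re (v * f (z + t * v))%C + Re (v * g (z + t * v))%C)
      by (unfold Re, Cmult, Cplus; simpl; ring).
    apply (is_derive_plus (K := R_AbsRing) (V := R_NormedModule) _ _ _ _ _ A1 A2).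
  - replace (Im (v * _)%C) with
      (Im (v * f (z + t * v))%C + Im (v * g (z + t * v))%C)
      by (unfold Im, Cmult, Cplus; simpl; ring).
    apply (is_derive_plus (K := R_AbsRing) (V := R_NormedModule) _ _ _ _ _ B1 B2).
Qed.

Lemma is_derive_Rmult (f g : R -> R) (x df dg : R) :
  is_derive f x df -> is_derive g x dg ->
  is_derive (fun x => f x * g x) x (df * g x + f x * dg).
Proof.
  intros H1 H2. apply (is_derive_mult f g x df dg H1 H2). intros; apply Rmult_comm.
Qed.

Lemma line_primitive_mult (Phi Psi f g : C -> C) :
  line_primitive Phi f -> line_primitive Psi g ->
  line_primitive (fun z => Phi z * Psi z)%C (fun z => f z * Psi z + Phi z * g z)%C.
Proof.
  intros H1 H2 z v t. destruct (H1 z v t) as [A1 B1], (H2 z v t) as [A2 B2].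
  assert (A12 := is_derive_Rmult _ _ _ _ _ A1 A2).
  assert (B12 := is_derive_Rmult _ _ _ _ _ B1 B2).
  assert (AB12 := is_derive_Rmult _ _ _ _ _ A1 B2).
  assert (BA12 := is_derive_Rmult _ _ _ _ _ B1 A2).
  split.
  - eapply (eq_rect _ (fun l => is_derive _ t l)).
    + exact (is_derive_minus (K := R_AbsRing) (V := R_NormedModule) _ _ _ _ _ A12 B12).
    + unfold Re, Im, Cmult, Cplus, minus, plus, opp; simpl. ring.
  - eapply (eq_rect _ (fun l => is_derive _ t l)).
    + exact (is_derive_plus (K := R_AbsRing) (V := R_NormedModule) _ _ _ _ _ AB12 BA12).
    + unfold Re, Im, Cmult, Cplus, minus, plus, opp; simpl. ring.
Qed.

Lemma line_primitive_const (c : C) : line_primitive (fun _ => c) (fun _ => RtoC 0).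
Proof.
  intros z v t. split.
  - replace (Re (v * RtoC 0)%C) with 0 by (unfold Re, Cmult; simpl; ring).
    apply (is_derive_const (K := R_AbsRing) (V := R_NormedModule)).
  - replace (Im (v * RtoC 0)%C) with 0 by (unfold Im, Cmult; simpl; ring).
    apply (is_derive_const (K := R_AbsRing) (V := R_NormedModule)).
Qed.

Lemma line_primitive_scal (c : C) (Phi f : C -> C) : line_primitive Phi f ->
  line_primitive (fun z => c * Phi z)%C (fun z => c * f z)%C.
Proof.
  intros H. eapply line_primitive_ext;
    [| |apply (line_primitive_mult _ _ _ _ (line_primitive_const c) H)].
  - reflexivity.
  - intros z. simpl. ring.
Qed.

Lemma line_primitive_shift (p : C) : line_primitive (fun z => z + p)%C (fun _ => RtoC 1).
Proof.
  intros z v t. unfold path_derive, Re, Im, Cmult, Cplus; simpl. split.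
  - auto_derive; [trivial|ring].
  - auto_derive; [trivial|ring].
Qed.

Lemma line_primitive_pow (p : C) (n : nat) :
  line_primitive (fun z => (z + p) ^ n)%C (fun z => INR n * (z + p) ^ (pred n))%C.
Proof.
  induction n as [|n IH].
  - eapply line_primitive_ext; [| |apply (line_primitive_const 1)].
    + reflexivity.
    + intros z. simpl. ring.
  - eapply line_primitive_ext;
      [| |apply (line_primitive_mult _ _ _ _ (line_primitive_shift p) IH)].
    + reflexivity.
    + intros z. simpl pred. rewrite S_INR, RtoC_plus. destruct n as [|n].
      * simpl. ring.
      * simpl pred. change (Cpow (z + p) (S n)) with ((z + p) * Cpow (z + p) n)%C. ring.
Qed.

Lemma line_primitive_Cexp (l c : C) :
  line_primitive (fun z => Cexp (l * z + c))%C (fun z => l * Cexp (l * z + c))%C.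
Proof.
  intros z v t. unfold path_derive, Cexp, Re, Im, Cmult, Cplus; simpl. split.
  - auto_derive; [trivial|unfold Rminus; ring].
  - auto_derive; [trivial|unfold Rminus; ring].
Qed.

(** The shift by p moves the centre of the rectangle to the origin. *)
Definition exp_monomial (l p : C) (m : nat) (z : C) : C :=
  ((z + p) ^ m * Cexp (l * (z + p)))%C.

(** Repeated integration by parts; at s = l the exponentials cancel up to the constant exp (l p) and
    a pure power remains. *)
Fixpoint monomial_primitive (l p s : C) (m : nat) (z : C) : C :=
  if Ceq_dec s l then (Cexp (l * p) * ((z + p) ^ S m / INR (S m)))%C
  else match m with
       | O => (- Cexp (- s * z) * exp_monomial l p 0 z / (s - l))%C
       | S m' => ((INR m * monomial_primitive l p s m' z
                   - Cexp (- s * z) * exp_monomial l p m z) / (s - l))%C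
       end.

Lemma line_primitive_damped (l p s : C) (m : nat) :
  line_primitive (fun z => Cexp (- s * z) * exp_monomial l p m z)%C
    (fun z => Cexp (- s * z) *
       (INR m * exp_monomial l p (pred m) z + (l - s) * exp_monomial l p m z))%C.
Proof.
  eapply line_primitive_ext;
    [| |apply (line_primitive_mult _ _ _ _ (line_primitive_pow p m)
          (line_primitive_Cexp (l - s) (l * p)))].
  - intros z. unfold exp_monomial. simpl.
    replace ((l - s) * z + l * p)%C with (- s * z + l * (z + p))%C by ring.
    rewrite Cexp_plus. ring.
  - intros z. unfold exp_monomial. simpl.
    replace ((l - s) * z + l * p)%C with (- s * z + l * (z + p))%C by ring.
    rewrite Cexp_plus. ring.
Qed.

Lemma INR_S_neq0 (m : nat) : RtoC (INR (S m)) <> RtoC 0.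
Proof. intros H. apply RtoC_inj in H. revert H. apply not_0_INR. lia. Qed.

Lemma monomial_primitive_correct (l p s : C) (m : nat) :
  line_primitive (monomial_primitive l p s m)
    (fun z => Cexp (- s * z) * exp_monomial l p m z)%C.
Proof.
  destruct (Ceq_dec s l) as [E|E].
  - subst s. apply line_primitive_ext with
      (fun z => (Cexp (l * p) / INR (S m)) * (z + p) ^ S m)%C
      (fun z => (Cexp (l * p) / INR (S m)) * (INR (S m) * (z + p) ^ pred (S m)))%C.
    + intros z. destruct m; simpl; (destruct (Ceq_dec l l); [|congruence]);
        unfold Cdiv; ring.
    + intros z. unfold exp_monomial.
      replace (Cexp (l * (z + p))) with (Cexp (l * z) * Cexp (l * p))%C
        by (rewrite <- Cexp_plus; f_equal; ring).
      assert (E : (Cexp (- l * z) * Cexp (l * z))%C = RtoC 1)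
        by (rewrite <- Cexp_plus, <- Cexp_0; f_equal; ring).
      transitivity (Cexp (l * p) * (z + p) ^ m * (Cexp (- l * z) * Cexp (l * z)))%C.
      * rewrite E. simpl pred. field. apply INR_S_neq0.
      * ring.
    + apply line_primitive_scal, line_primitive_pow.
  - assert (E' := Cminus_neq0 _ _ E).
    induction m as [|m IH].
    + eapply line_primitive_ext;
        [| |apply (line_primitive_scal (- / (s - l)) _ _ (line_primitive_damped l p s 0))].
      * intros z. simpl. destruct (Ceq_dec s l); [congruence|]. unfold Cdiv. ring.
      * intros z. simpl. unfold exp_monomial. simpl. field. exact E'.
    + eapply line_primitive_ext;
        [| |apply (line_primitive_plus _ _ _ _
               (line_primitive_scal (INR (S m) / (s - l)) _ _ IH)
               (line_primitive_scal (- / (s - l)) _ _ (line_primitive_damped l p s (S m))))].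
      * intros z. cbn [monomial_primitive]. destruct (Ceq_dec s l); [congruence|].
        unfold Cdiv. ring.
      * intros z. change (Nat.pred (S m)) with m. cbv beta. field. exact E'.
Qed.

(** Integration by parts multiplied through by s - l, which makes it valid at s = l too. For m = 0
    the term with [pred m] carries the factor [INR 0]. *)
Lemma monomial_primitive_parts (l p s : C) (m : nat) (a b : C) :
  ((s - l) * (monomial_primitive l p s m b - monomial_primitive l p s m a)
   = INR m * (monomial_primitive l p s (pred m) b - monomial_primitive l p s (pred m) a)
     - (Cexp (- s * b) * exp_monomial l p m b - Cexp (- s * a) * exp_monomial l p m a))%C.
Proof.
  destruct (Ceq_dec s l) as [E|E].
  - subst s.
    assert (X : forall z, (Cexp (- l * z) * exp_monomial l p m z
                           = Cexp (l * p) * (z + p) ^ m)%C).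
    { intros z. unfold exp_monomial.
      replace (Cexp (l * (z + p))) with (Cexp (l * z) * Cexp (l * p))%C
        by (rewrite <- Cexp_plus; f_equal; ring).
      assert (E : (Cexp (- l * z) * Cexp (l * z))%C = RtoC 1)
        by (rewrite <- Cexp_plus, <- Cexp_0; f_equal; ring).
      transitivity (Cexp (l * p) * (z + p) ^ m * (Cexp (- l * z) * Cexp (l * z)))%C;
        [ring|]. rewrite E. ring. }
    rewrite !X. destruct m as [|m]; [simpl; ring|].
    simpl pred.
    assert (Y : forall z, monomial_primitive l p l m z
                = (Cexp (l * p) * ((z + p) ^ S m / INR (S m)))%C).
    { intros z. destruct m; simpl; (destruct (Ceq_dec l l); [|congruence]); reflexivity. }
    rewrite !Y. field. apply INR_S_neq0.
  - assert (E' := Cminus_neq0 _ _ E).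
    destruct m as [|m]; cbn [monomial_primitive]; (destruct (Ceq_dec s l); [congruence|]).
    + simpl INR. field. exact E'.
    + simpl pred. field. exact E'.
Qed.

(** * The functional attached to simple poles *)

Definition iheight (T : R) : C := (RtoC T * Ci)%C.

(* [functional T w Phi sig] is [sum_s w_s exp (i T s) int_(-iT)^(iT) exp (-s z) f(z) dz],
   where [Phi s] is a primitive of [exp (-s z) f(z)]: no integral is ever formed. *)
Definition functional (T : R) (w : C -> C) (Phi : C -> C -> C) (sig : list C) : C :=
  Csum (fun s => w s * Cexp (s * iheight T)
                 * (Phi s (iheight T) - Phi s (iheight (- T))))%C sig.

(* The zeros of [cos (T s)]. *)
Definition cos_node (T : R) (s : C) : Prop :=
  Cexp (s * iheight T) = (- Cexp (- s * iheight T))%C.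

Lemma Cexp_opp_l (a b : C) : (Cexp (a * b) * Cexp (- a * b))%C = RtoC 1.
Proof. rewrite <- Cexp_plus, <- Cexp_0. f_equal. ring. Qed.

(** Each integration by parts spends one factor s - l of the numerator, so m and the multiplicity of
    l fall together. At a node the end-point exponentials become 1 at iT and -1 at -iT, which is why
    [c] is the sum of the two end-point values. *)
Lemma functional_parts (T : R) (l p : C) (m k : nat) (al sig : list C) :
  NoDup sig -> (forall s, In s sig -> cos_node T s) ->
  (length al + k + 2 <= length sig)%nat ->
  functional T (fun s => Cprod (fun a => s - a) (repeat l (S k) ++ al) / dprod sig s)%C
     (fun s => monomial_primitive l p s m) sig
  = (INR m * functional T (fun s => Cprod (fun a => s - a) (repeat l k ++ al) / dprod sig s)%C
     (fun s => monomial_primitive l p s (pred m)) sig)%C.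
Proof.
  intros ND Hn Hl. set (b := iheight T). set (b' := iheight (- T)).
  assert (Eb : forall s : C, (s * b' = - s * b)%C)
    by (intros s; unfold b, b', iheight; rewrite RtoC_opp; ring).
  set (c := (exp_monomial l p m b + exp_monomial l p m b')%C).
  assert (Z := divdiff_low_degree (repeat l k ++ al) sig ND).
  rewrite length_app, repeat_length in Z. specialize (Z ltac:(lia)).
  transitivity (INR m * functional T (fun s => Cprod (fun a => s - a) (repeat l k ++ al) / dprod sig s)
     (fun s => monomial_primitive l p s (pred m)) sig
     + - c * divdiff sig (fun s => Cprod (fun a => s - a) (repeat l k ++ al)))%C;
    [|rewrite Z; ring].
  unfold functional, divdiff. rewrite <- !Csum_scal, <- Csum_plus.
  apply Csum_ext. intros s Hs. fold b b'.
  assert (P := monomial_primitive_parts l p s m b' b).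
  assert (E1 := Cexp_opp_l s b).
  assert (E2 := Hn s Hs). unfold cos_node in E2. fold b in E2.
  simpl repeat. simpl app. simpl Cprod.
  set (q := Cprod _ _). set (d := dprod sig s).
  transitivity (q / d * Cexp (s * b) * ((s - l) *
     (monomial_primitive l p s m b - monomial_primitive l p s m b')))%C.
  { unfold Cdiv. ring. }
  rewrite P.
  assert (E3 : (Cexp (s * b) * Cexp (- s * b'))%C = (- (1))%C).
  { replace (- s * b')%C with (s * b)%C by (rewrite Eb; ring).
    rewrite E2 at 1. rewrite <- E1. ring. }
  transitivity (q / d * (INR m * Cexp (s * b) * (monomial_primitive l p s (pred m) b -
        monomial_primitive l p s (pred m) b')
     - ((Cexp (s * b) * Cexp (- s * b)) * exp_monomial l p m b
       - (Cexp (s * b) * Cexp (- s * b')) * exp_monomial l p m b')))%C.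
  { ring. }
  rewrite E1, E3. unfold c, Cdiv. ring.
Qed.

Lemma functional_kill (T : R) (l p : C) (m : nat) (al sig : list C) :
  NoDup sig -> (forall s, In s sig -> cos_node T s) ->
  (length al + m + 2 <= length sig)%nat ->
  functional T (fun s => Cprod (fun a => s - a) (repeat l (S m) ++ al) / dprod sig s)%C
     (fun s => monomial_primitive l p s m) sig = RtoC 0.
Proof.
  revert al. induction m as [|m IH]; intros al ND Hn Hl.
  - rewrite functional_parts by (auto; lia). simpl INR. ring.
  - rewrite functional_parts by (auto; lia). simpl pred.
    rewrite IH by (auto; lia). ring.
Qed.

(** The m integrations by parts consume the m zeros at 0 and produce m!. The remaining integral of
    exp (- s z) is explicit, each node contributes a multiple of 2 / (0 - s), and the sum is a
    partial fraction expansion at 0. *)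
Lemma functional_power (T : R) (m : nat) (al sig : list C) :
  NoDup sig -> (forall s, In s sig -> cos_node T s) -> ~ In (RtoC 0) sig ->
  (length al + m + 1 <= length sig)%nat ->
  functional T (fun s => Cprod (fun a => s - a) (repeat (RtoC 0) m ++ al) / dprod sig s)%C
     (fun s => monomial_primitive 0 0 s m) sig
  = (2 * INR (fact m) * (Cprod (fun a => 0 - a) al / Cprod (fun s => 0 - s) sig))%C.
Proof.
  intros ND Hn H0. induction m as [|m IH]; intros Hl.
  - rewrite <- partial_fractions by (auto; lia).
    simpl fact. simpl INR. rewrite <- Csum_scal. apply Csum_ext. intros s Hs.
    assert (Hs0 : s <> RtoC 0) by congruence.
    set (b := iheight T). set (b' := iheight (- T)).
    assert (Eb : forall s : C, (s * b' = - s * b)%C)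
      by (intros t; unfold b, b', iheight; rewrite RtoC_opp; ring).
    assert (P := monomial_primitive_parts 0 0 s 0 b' b).
    assert (E1 := Cexp_opp_l s b).
    assert (E2 := Hn s Hs). unfold cos_node in E2. fold b in E2.
    assert (E3 : (Cexp (s * b) * Cexp (- s * b'))%C = (- (1))%C).
    { replace (- s * b')%C with (s * b)%C by (rewrite Eb; ring).
      rewrite E2 at 1. rewrite <- E1. ring. }
    assert (X : forall z, exp_monomial 0 0 0 z = RtoC 1).
    { intros z. unfold exp_monomial. simpl.
      replace (0 * (z + 0))%C with (RtoC 0) by ring. rewrite Cexp_0. ring. }
    rewrite !X in P. simpl INR in P.
    set (Dl := (monomial_primitive 0 0 s 0 b - monomial_primitive 0 0 s 0 b')%C) in *.
    assert (Q : (Cexp (s * b) * Dl = - (2) / s)%C).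
    { transitivity (Cexp (s * b) * ((s - 0) * Dl) / s)%C; [field; exact Hs0|].
      rewrite P.
      transitivity (- (Cexp (s * b) * Cexp (- s * b) - Cexp (s * b) * Cexp (- s * b')) / s)%C;
        [field; exact Hs0|].
      rewrite E1, E3. field. exact Hs0. }
    transitivity (Cprod (fun a => s - a) al / dprod sig s * (Cexp (s * b) * Dl))%C.
    { simpl. unfold Cdiv. ring. }
    assert (Hs1 : (0 - s)%C <> RtoC 0) by (apply Cminus_neq0; congruence).
    rewrite Q. field. repeat split; try exact Hs0; try exact Hs1; apply dprod_neq0.
  - rewrite functional_parts by (auto; lia). simpl pred.
    rewrite IH by lia.
    change (fact (S m)) with (S m * fact m)%nat. rewrite mult_INR, RtoC_mult. ring.
Qed.

Lemma path_derive_Csum {A : Type} (F F' : A -> R -> C) (l : list A) (t : R) :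
  (forall a, In a l -> path_derive (F a) t (F' a t)) ->
  path_derive (fun t => Csum (fun a => F a t) l) t (Csum (fun a => F' a t) l).
Proof.
  induction l as [|a l IH]; simpl; intros H.
  - split; apply (is_derive_const (K := R_AbsRing) (V := R_NormedModule)).
  - destruct IH as [A1 B1]; [auto|]. destruct (H a) as [A2 B2]; [auto|].
    split; simpl.
    + exact (is_derive_plus (K := R_AbsRing) (V := R_NormedModule) _ _ _ _ _ A2 A1).
    + exact (is_derive_plus (K := R_AbsRing) (V := R_NormedModule) _ _ _ _ _ B2 B1).
Qed.

Lemma Re_Csum {A : Type} (f : A -> C) (l : list A) :
  Re (Csum f l) = Rsum (fun a => Re (f a)) l.
Proof. induction l as [|a l IH]; simpl; [reflexivity|]. now rewrite <- IH. Qed.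

Lemma Im_Csum {A : Type} (f : A -> C) (l : list A) :
  Im (Csum f l) = Rsum (fun a => Im (f a)) l.
Proof. induction l as [|a l IH]; simpl; [reflexivity|]. now rewrite <- IH. Qed.

(** Used in place of the Cauchy-Schwarz inequality: the integral of a modulus over a segment is at
    most its length plus half the energy. *)
Lemma Cmod_le_squares (a : C) : Cmod a <= 1 + (Re a ^ 2 + Im a ^ 2) / 2.
Proof.
  assert (E : Cmod a ^ 2 = Re a ^ 2 + Im a ^ 2).
  { unfold Cmod. rewrite pow2_sqrt; [reflexivity|]. nra. }
  rewrite <- E. assert (0 <= (Cmod a - 1) ^ 2) by apply pow2_ge_0. nra.
Qed.

(** * Moving the contour for the nodes of one sign *)

Section HalfBound.
Variables (e T h S : R) (A : C -> C) (Phi : C -> C -> C) (f : C -> C) (sl : list R).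
Hypothesis He : e * e = 1.
Hypothesis HT : 0 < T.
Hypothesis Hh : 0 < h.
Hypothesis Hsl : forall s, In s sl -> 0 < s.
Hypothesis HPhi : forall s, In s sl ->
  line_primitive (Phi (RtoC (e * s))) (fun z => Cexp (- RtoC (e * s) * z) * f z)%C.
Hypothesis Hf : forall z, Rabs (Re z) <= h -> Rabs (Im z) <= T -> Cmod (f z) <= S.

Let AR := map (fun s => (Re (A (RtoC (e * s))), s)) sl.
Let AI := map (fun s => (Im (A (RtoC (e * s))), s)) sl.

Lemma S_ge0 : 0 <= S.
Proof.
  eapply Rle_trans; [apply (Cmod_ge_0 (f 0))|].
  apply Hf; simpl; rewrite Rabs_R0; lra.
Qed.

Lemma e_abs : Rabs e = 1.
Proof.
  assert (H : Rabs e * Rabs e = 1) by (rewrite <- Rabs_mult, He; apply Rabs_R1).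
  assert (0 <= Rabs e) by apply Rabs_pos. nra.
Qed.

(* On the horizontal line through [iheight T'] the weights collapse to the
   exponential sum [sum_s A_s exp (-s x)], whose energy is controlled. *)
Lemma horizontal_bound (T' : R) (kappa : C) (K : R) : Rabs T' <= T -> Cmod kappa = 1 ->
  (forall s, In s sl ->
     (Cexp (RtoC (e * s) * iheight T) * Cexp (- RtoC (e * s) * iheight T') = kappa)%C) ->
  (forall x, posexp_energy AR x <= K) -> (forall x, posexp_energy AI x <= K) ->
  Cmod (Csum (fun s => A (RtoC (e * s)) * Cexp (RtoC (e * s) * iheight T)
        * Phi (RtoC (e * s)) (iheight T' + RtoC h * RtoC e))%C sl
     - Csum (fun s => A (RtoC (e * s)) * Cexp (RtoC (e * s) * iheight T)
        * Phi (RtoC (e * s)) (iheight T' + RtoC 0 * RtoC e))%C sl) <= S * (h + K).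
Proof.
  intros HT' Hk Hkap HR HI.
  assert (S0 := S_ge0).
  set (al := fun x => Csum (fun s => A (RtoC (e * s)) * RtoC (exp (- s * x)))%C sl).
  assert (ER : forall x, Re (al x) = posexp AR x).
  { intros x. unfold al, posexp, AR. rewrite Re_Csum, Rsum_map. apply Rsum_ext.
    intros s Hs. simpl. destruct (Rlt_dec 0 s) as [_|N]; [|destruct N; auto].
    unfold Re, Cmult, RtoC; simpl. ring. }
  assert (EI : forall x, Im (al x) = posexp AI x).
  { intros x. unfold al, posexp, AI. rewrite Im_Csum, Rsum_map. apply Rsum_ext.
    intros s Hs. simpl. destruct (Rlt_dec 0 s) as [_|N]; [|destruct N; auto].
    unfold Im, Cmult, RtoC; simpl. ring. }
  set (F := fun x : R => Csum (fun s => A (RtoC (e * s)) * Cexp (RtoC (e * s) * iheight T)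
        * Phi (RtoC (e * s)) (iheight T' + RtoC x * RtoC e))%C sl).
  change (Cmod (F h - F 0) <= S * (h + K)).
  (* Antiderivative of S (1 + |al|^2 / 2), the majorant of S |al| provided by [Cmod_le_squares]. *)
  set (m := fun x => S * (x + (posexp_energy AR x + posexp_energy AI x) / 2)).
  apply Rle_trans with (m h - m 0).
  - apply (path_mean_value F
      (fun x => kappa * RtoC e * f (iheight T' + RtoC x * RtoC e) * al x)%C m
      (fun x => S * (1 + (posexp AR x ^ 2 + posexp AI x ^ 2) / 2))); [lra| | |].
    + intros x Hx.
      replace (kappa * RtoC e * f (iheight T' + RtoC x * RtoC e) * al x)%C with
       (Csum (fun s => A (RtoC (e * s)) * Cexp (RtoC (e * s) * iheight T)
        * (RtoC e * (Cexp (- RtoC (e * s) * (iheight T' + RtoC x * RtoC e))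
                     * f (iheight T' + RtoC x * RtoC e))))%C sl).
      * apply (path_derive_Csum (fun s x => A (RtoC (e * s)) * Cexp (RtoC (e * s) * iheight T)
          * Phi (RtoC (e * s)) (iheight T' + RtoC x * RtoC e))%C
          (fun s x => A (RtoC (e * s)) * Cexp (RtoC (e * s) * iheight T)
        * (RtoC e * (Cexp (- RtoC (e * s) * (iheight T' + RtoC x * RtoC e))
                     * f (iheight T' + RtoC x * RtoC e))))%C).
        intros s Hs.
        set (c := (A (RtoC (e * s)) * Cexp (RtoC (e * s) * iheight T))%C).
        assert (Q := line_primitive_scal c _ _ (HPhi s Hs) (iheight T') (RtoC e) x).
        cbv beta in Q.
        replace (c * (RtoC e * (Cexp (- RtoC (e * s) * (iheight T' + RtoC x * RtoC e))
                     * f (iheight T' + RtoC x * RtoC e))))%C with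
          (RtoC e * (c * (Cexp (- RtoC (e * s) * (iheight T' + RtoC x * RtoC e))
                     * f (iheight T' + RtoC x * RtoC e))))%C by ring.
        exact Q.
      * unfold al. rewrite <- Csum_scal. apply Csum_ext. intros s Hs.
        assert (X : Cexp (- RtoC (e * s) * (iheight T' + RtoC x * RtoC e))
                 = (Cexp (- RtoC (e * s) * iheight T') * RtoC (exp (- s * x)))%C).
        { replace (- RtoC (e * s) * (iheight T' + RtoC x * RtoC e))%C with
            (- RtoC (e * s) * iheight T' + RtoC (- s * x))%C.
          - rewrite Cexp_plus. f_equal. unfold Cexp, RtoC, Re, Im; simpl.
            rewrite cos_0, sin_0. f_equal; ring.
          - rewrite Cmult_plus_distr_l. f_equal.
            rewrite <- RtoC_opp, <- !RtoC_mult. f_equal.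
            replace (- (e * s) * (x * e)) with (- (e * e) * (s * x)) by ring.
            rewrite He. ring. }
        rewrite X. rewrite <- (Hkap s Hs). ring.
    + intros x _. unfold m. apply (is_derive_scal (fun x => x + (posexp_energy AR x + posexp_energy AI x) / 2)).
      apply (is_derive_plus (K := R_AbsRing) (V := R_NormedModule) (fun x => x)).
      * apply (is_derive_id (K := R_AbsRing)).
      * apply (is_derive_ext (fun x => / 2 * (posexp_energy AR x + posexp_energy AI x)));
          [intros t; apply Rmult_comm|].
        replace ((posexp AR x ^ 2 + posexp AI x ^ 2) / 2) with
          (/ 2 * (posexp AR x ^ 2 + posexp AI x ^ 2)) by (unfold Rdiv; ring).
        apply (is_derive_scal (fun x => posexp_energy AR x + posexp_energy AI x)).
        apply (is_derive_plus (K := R_AbsRing) (V := R_NormedModule));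
          apply is_derive_posexp_energy.
    + intros x Hx. rewrite !Cmod_mult, Hk, Cmod_R, e_abs.
      assert (Hz : Cmod (f (iheight T' + RtoC x * RtoC e)) <= S).
      { apply Hf.
        - replace (Re _) with (x * e) by (unfold iheight, Re, Ci; simpl; ring).
          rewrite Rabs_mult, e_abs, Rabs_pos_eq; lra.
        - replace (Im _) with T' by (unfold iheight, Im, Ci; simpl; ring). exact HT'. }
      assert (Ha := Cmod_le_squares (al x)). rewrite ER, EI in Ha.
      rewrite !Rmult_1_l.
      apply Rmult_le_compat; auto using Cmod_ge_0.
  - unfold m. rewrite !posexp_energy_0. specialize (HR h). specialize (HI h).
    replace (S * (h + (posexp_energy AR h + posexp_energy AI h) / 2) - S * (0 + (0 + 0) / 2))
      with (S * (h + (posexp_energy AR h + posexp_energy AI h) / 2)) by field.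
    apply Rmult_le_compat_l; [exact S0|]. lra.
Qed.

Lemma vertical_bound (s : R) : In s sl ->
  Cmod (Phi (RtoC (e * s)) (RtoC (h * e) + RtoC T * Ci)
        - Phi (RtoC (e * s)) (RtoC (h * e) + RtoC (- T) * Ci))%C <= 2 * T * S * exp (- s * h).
Proof.
  intros Hs. assert (S0 := S_ge0).
  set (F := fun t : R => Phi (RtoC (e * s)) (RtoC (h * e) + RtoC t * Ci)%C).
  change (Cmod (F T - F (- T)) <= 2 * T * S * exp (- s * h)).
  apply Rle_trans with (S * exp (- s * h) * T - S * exp (- s * h) * - T); [|right; ring].
  apply (path_mean_value F (fun t => Ci * (Cexp (- RtoC (e * s) * (RtoC (h * e) + RtoC t * Ci))
           * f (RtoC (h * e) + RtoC t * Ci)))%C (fun t => S * exp (- s * h) * t)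
           (fun _ => S * exp (- s * h))); [lra| | |].
  - intros t _. apply (HPhi s Hs (RtoC (h * e)) Ci t).
  - intros t _. auto_derive; [trivial|ring].
  - intros t Ht. rewrite !Cmod_mult.
    replace (Cmod Ci) with 1.
    2:{ unfold Cmod, Ci; simpl. replace (0 * _ + _) with 1 by ring. now rewrite sqrt_1. }
    rewrite Rmult_1_l, Rmult_comm, Cmod_Cexp.
    replace (Re (- RtoC (e * s) * (RtoC (h * e) + RtoC t * Ci))%C) with (- s * h).
    + apply Rmult_le_compat_r; [left; apply exp_pos|]. apply Hf.
      * replace (Re _) with (h * e) by (unfold Re, Ci; simpl; ring).
        rewrite Rabs_mult, e_abs, Rabs_pos_eq; lra.
      * replace (Im _) with t by (unfold Im, Ci; simpl; ring). apply Rabs_le. lra.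
    + unfold Re, Ci; simpl. transitivity (- (e * e) * (s * h)); [rewrite He; ring|ring].
Qed.

(** The segment from -iT to iT is exchanged for the other three sides of a rectangle lying on the
    side e, where exp (- s z) decays for the nodes of sign e. The equation [E] below is this
    exchange, a telescoping of primitives. *)
Lemma half_functional_bound (K M : R) :
  (forall s, In s sl -> cos_node T (RtoC (e * s))) ->
  (forall x, posexp_energy AR x <= K) -> (forall x, posexp_energy AI x <= K) ->
  Rsum (fun s => Cmod (A (RtoC (e * s))) * exp (- s * h)) sl <= M ->
  Cmod (functional T A Phi (map (fun s => RtoC (e * s)) sl))
    <= S * (2 * (h + K) + 2 * T * M).
Proof.
  intros Hn HR HI HM. assert (S0 := S_ge0).
  set (w := fun s : R => (A (RtoC (e * s)) * Cexp (RtoC (e * s) * iheight T))%C).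
  set (U := fun T' x : R => Csum (fun s => w s
        * Phi (RtoC (e * s)) (iheight T' + RtoC x * RtoC e))%C sl).
  set (V := Csum (fun s => w s * (Phi (RtoC (e * s)) (RtoC (h * e) + RtoC T * Ci)
        - Phi (RtoC (e * s)) (RtoC (h * e) + RtoC (- T) * Ci)))%C sl).
  assert (E : functional T A Phi (map (fun s => RtoC (e * s)) sl)
              = (- (U T h - U T 0%R) + V + (U (- T)%R h - U (- T)%R 0%R))%C).
  { unfold functional. rewrite Csum_map.
    assert (X : V = (U T h - U (- T)%R h)%C).
    { unfold V, U.
      transitivity (Csum (fun s => w s * Phi (RtoC (e * s)) (iheight T + RtoC h * RtoC e)) sl
         + (- 1) * Csum (fun s => w s * Phi (RtoC (e * s)) (iheight (- T) + RtoC h * RtoC e)) sl)%C;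
        [|ring].
      rewrite <- Csum_scal, <- Csum_plus. apply Csum_ext. intros s _.
      replace (iheight T + RtoC h * RtoC e)%C with (RtoC (h * e) + RtoC T * Ci)%C
        by (unfold iheight; rewrite RtoC_mult; ring).
      replace (iheight (- T) + RtoC h * RtoC e)%C with (RtoC (h * e) + RtoC (- T) * Ci)%C
        by (unfold iheight; rewrite RtoC_mult; ring).
      ring. }
    rewrite X.
    transitivity (U T 0%R + (- 1) * U (- T)%R 0%R)%C; [|ring].
    unfold U. rewrite <- Csum_scal, <- Csum_plus. apply Csum_ext. intros s _.
    replace (iheight T + RtoC 0 * RtoC e)%C with (iheight T) by ring.
    replace (iheight (- T) + RtoC 0 * RtoC e)%C with (iheight (- T)) by ring.
    unfold w. ring. }
  rewrite E.
  assert (B1 : Cmod (U T h - U T 0%R) <= S * (h + K)).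
  { apply (horizontal_bound T (RtoC 1)); auto.
    - rewrite Rabs_pos_eq; lra.
    - apply Cmod_1.
    - intros s _. apply Cexp_opp_l. }
  assert (B2 : Cmod (U (- T)%R h - U (- T)%R 0%R) <= S * (h + K)).
  { apply (horizontal_bound (- T) (- (1))%C); auto.
    - rewrite Rabs_Ropp, Rabs_pos_eq; lra.
    - rewrite Cmod_opp. apply Cmod_1.
    - intros s Hs. assert (N := Hn s Hs). unfold cos_node in N.
      replace (- RtoC (e * s) * iheight (- T))%C with (RtoC (e * s) * iheight T)%C
        by (unfold iheight; rewrite RtoC_opp; ring).
      rewrite N at 1. rewrite <- (Cexp_opp_l (RtoC (e * s)) (iheight T)). ring. }
  assert (B3 : Cmod V <= 2 * T * S * M).
  { unfold V. eapply Rle_trans; [apply Cmod_Csum|].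
    apply Rle_trans with (Rsum (fun s => 2 * T * S * (Cmod (A (RtoC (e * s))) * exp (- s * h))) sl).
    - apply Rsum_le. intros s Hs. unfold w. rewrite !Cmod_mult.
      replace (Cmod (Cexp (RtoC (e * s) * iheight T))) with 1.
      + assert (VB := vertical_bound s Hs).
        assert (H := Cmod_ge_0 (A (RtoC (e * s)))). nra.
      + rewrite Cmod_Cexp.
        replace (Re _) with 0 by (unfold iheight, Re, Ci; simpl; ring).
        now rewrite exp_0.
    - rewrite Rsum_scal. apply Rmult_le_compat_l; [|exact HM].
      apply Rmult_le_pos; lra. }
  eapply Rle_trans; [apply Cmod_triangle|].
  assert (T1 := Cmod_triangle (- (U T h - U T 0%R)) V).
  rewrite Cmod_opp in T1. nra.
Qed.

End HalfBound.

(** * Cost of replacing a zero by a lattice node *)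

(* For [x <> s] this is [|1 - x^2/z^2| / |1 - x^2/s^2|]; for [x = s] the vanishing
   factor [|x - s|] is dropped, as in a residue. *)
Definition fac (x : R) (z : C) (s : R) : R :=
  s ^ 2 / Cmod z ^ 2 * (Cmod (RtoC x - z) * Cmod (RtoC x + z))
  / ((if Req_EM_T x s then 1 else Rabs (x - s)) * (x + s)).

Lemma le_div_of_mul_le (a b c : R) : 0 < c -> a * c <= b -> a <= b / c.
Proof. intros Hc H. now apply Rle_div_r. Qed.

Lemma div_le_of_le_mul (a b c : R) : 0 < c -> a <= b * c -> a / c <= b.
Proof. intros Hc H. now apply Rle_div_l. Qed.

Lemma exp_le_compat (a b : R) : a <= b -> exp a <= exp b.
Proof.
  intros [H|H]; [left; now apply exp_increasing|right; now rewrite H].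
Qed.

Lemma ratio_le_1 (a b : R) : 0 < b -> a <= b -> a / b <= 1.
Proof. intros Hb H. apply div_le_of_le_mul; lra. Qed.

Lemma Cmod_add_real (x : R) (z : C) : 0 <= x -> Cmod (RtoC x + z) <= x + Cmod z.
Proof.
  intros H. eapply Rle_trans; [apply Cmod_triangle|].
  rewrite Cmod_R, Rabs_pos_eq; lra.
Qed.

Lemma fac_ge0 (x : R) (z : C) (s : R) : 0 < x -> 0 < s -> 0 < Cmod z -> 0 <= fac x z s.
Proof.
  intros Hx Hs Hz. unfold fac. apply Rmult_le_pos.
  - apply Rmult_le_pos.
    + apply Rmult_le_pos; [nra|]. left. apply Rinv_0_lt_compat. nra.
    + apply Rmult_le_pos; apply Cmod_ge_0.
  - left. apply Rinv_0_lt_compat. apply Rmult_lt_0_compat; [|lra].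
    destruct (Req_EM_T x s); [lra|]. apply Rabs_pos_lt. lra.
Qed.

(** Evenness in z lets zeros near the negative axis be treated as if they were near the positive
    one. *)
Lemma fac_opp (x : R) (z : C) (s : R) : fac x (- z) s = fac x z s.
Proof.
  unfold fac. rewrite Cmod_opp.
  replace (RtoC x - - z)%C with (RtoC x + z)%C by ring.
  replace (RtoC x + - z)%C with (RtoC x - z)%C by ring.
  now rewrite (Rmult_comm (Cmod (RtoC x + z))).
Qed.

(** Since s <= |z|, the quantity (s / |z|) |x + z| is at most x + s, so only the distance from x to
    z against that from x to s matters. The maximum with tau covers both branches of [fac], because
    tau <= 1. *)
Lemma fac_near (x X tau : R) (z : C) (s : R) :
  0 < x -> 0 < s -> s <= Cmod z -> 0 < tau <= 1 ->
  (x <> s -> tau <= Rabs (x - s)) -> Cmod (RtoC x - z) <= X ->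
  fac x z s <= X / Rmax tau (Rabs (x - s)).
Proof.
  intros Hx Hs Hz Ht Hxs HX.
  assert (H0 := Cmod_ge_0 (RtoC x - z)). assert (H1 := Cmod_ge_0 (RtoC x + z)).
  assert (H2 := Cmod_add_real x z ltac:(lra)).
  unfold fac. set (a := Cmod z) in *. set (u := Cmod (RtoC x - z)) in *.
  set (v := Cmod (RtoC x + z)) in *.
  assert (Ha : 0 < a) by lra.
  assert (Q1 : s / a <= 1) by (apply ratio_le_1; lra).
  assert (Q0 : 0 < s / a) by (apply Rdiv_lt_0_compat; lra).
  assert (Q2 : s / a * v <= x + s).
  { apply Rle_trans with (s / a * (x + a)); [apply Rmult_le_compat_l; lra|].
    replace (s / a * (x + a)) with (s / a * x + s) by (field; lra). nra. }
  assert (Q3 : s / a * u <= X) by nra.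
  destruct (Req_EM_T x s) as [E|E].
  - replace (Rmax tau (Rabs (x - s))) with tau.
    2:{ rewrite Rmax_left; [reflexivity|]. rewrite E, Rminus_diag, Rabs_R0. lra. }
    apply Rle_trans with X.
    + replace (s ^ 2 / a ^ 2 * (u * v) / (1 * (x + s))) with
        ((s / a * u) * ((s / a * v) / (x + s))) by (field; lra).
      rewrite <- (Rmult_1_r X).
      assert (0 <= s / a * v) by (apply Rmult_le_pos; lra).
      apply Rmult_le_compat; auto.
      * apply Rmult_le_pos; lra.
      * apply Rmult_le_pos; [lra|left; apply Rinv_0_lt_compat; lra].
      * apply ratio_le_1; lra.
    + apply le_div_of_mul_le; [lra|]. nra.
  - specialize (Hxs E). assert (Hp : 0 < Rabs (x - s)) by lra.
    rewrite Rmax_right by lra.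
    replace (s ^ 2 / a ^ 2 * (u * v) / (Rabs (x - s) * (x + s))) with
      ((s / a * u) * ((s / a * v) / (x + s)) / Rabs (x - s)) by (field; lra).
    apply Rmult_le_compat_r; [left; apply Rinv_0_lt_compat; lra|].
    rewrite <- (Rmult_1_r X).
    assert (0 <= s / a * v) by (apply Rmult_le_pos; lra).
    apply Rmult_le_compat; auto.
    + apply Rmult_le_pos; lra.
    + apply Rmult_le_pos; [lra|left; apply Rinv_0_lt_compat; lra].
    + apply ratio_le_1; lra.
Qed.

(** Rests on s^2 |x^2 - z^2| / |z|^2 <= (x + s)^2, which requires nothing of the argument of z; it
    serves the zeros away from the axis. *)
Lemma fac_crude (x tau : R) (z : C) (s : R) :
  0 < x -> 0 < s <= 4 * x -> s <= Cmod z -> 0 < tau <= 1 ->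
  (x <> s -> tau <= Rabs (x - s)) ->
  fac x z s <= 5 * x / Rmax tau (Rabs (x - s)).
Proof.
  intros Hx Hs Hz Ht Hxs.
  assert (H0 := Cmod_ge_0 (RtoC x - z)). assert (H1 := Cmod_ge_0 (RtoC x + z)).
  assert (H2 := Cmod_add_real x z ltac:(lra)).
  assert (H3 : Cmod (RtoC x - z) * Cmod (RtoC x + z) <= x ^ 2 + Cmod z ^ 2).
  { rewrite <- Cmod_mult.
    replace ((RtoC x - z) * (RtoC x + z))%C with (RtoC x * RtoC x - z * z)%C by ring.
    eapply Rle_trans; [apply Cmod_triangle|].
    rewrite Cmod_opp, !Cmod_mult, Cmod_R, Rabs_pos_eq by lra. lra. }
  unfold fac. set (a := Cmod z) in *. set (uv := Cmod (RtoC x - z) * Cmod (RtoC x + z)) in *.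
  assert (Ha : 0 < a) by lra.
  assert (Q0 : 0 < s / a <= 1) by (split; [apply Rdiv_lt_0_compat|apply ratio_le_1]; lra).
  assert (Q4 : s ^ 2 / a ^ 2 * uv <= (x + s) ^ 2).
  { apply Rle_trans with (s ^ 2 / a ^ 2 * (x ^ 2 + a ^ 2)).
    - apply Rmult_le_compat_l; [|lra]. apply Rmult_le_pos; [nra|].
      left. apply Rinv_0_lt_compat. nra.
    - replace (s ^ 2 / a ^ 2 * (x ^ 2 + a ^ 2)) with ((s / a) * (s / a) * x ^ 2 + s ^ 2)
        by (field; lra).
      assert ((s / a) * (s / a) <= 1) by nra. assert (0 < x ^ 2) by nra. nra. }
  destruct (Req_EM_T x s) as [E|E].
  - replace (Rmax tau (Rabs (x - s))) with tau.
    2:{ rewrite Rmax_left; [reflexivity|]. rewrite E, Rminus_diag, Rabs_R0. lra. }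
    apply le_div_of_mul_le; [lra|].
    apply Rle_trans with ((x + s) ^ 2 / (1 * (x + s)) * tau).
    + apply Rmult_le_compat_r; [lra|]. apply Rmult_le_compat_r; [|exact Q4].
      left. apply Rinv_0_lt_compat. lra.
    + replace ((x + s) ^ 2 / (1 * (x + s))) with (x + s) by (field; lra). nra.
  - specialize (Hxs E). assert (Hp : 0 < Rabs (x - s)) by lra.
    rewrite Rmax_right by lra.
    apply Rle_trans with ((x + s) ^ 2 / (Rabs (x - s) * (x + s))).
    + apply Rmult_le_compat_r; [|exact Q4].
      left. apply Rinv_0_lt_compat. apply Rmult_lt_0_compat; lra.
    + replace ((x + s) ^ 2 / (Rabs (x - s) * (x + s))) with ((x + s) / Rabs (x - s))
        by (field; lra).
      apply Rmult_le_compat_r; [left; apply Rinv_0_lt_compat; lra|lra].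
Qed.

(** With a = x^2 / lam^2, both 1 - x^2 / z^2 and 1 - x^2 / s^2 are close to 1 - a; the terms -a
    cancel and leave a times the relative displacements of z and s from lam. Without this
    cancellation the sharing among scales would gain nothing for zeros far beyond x. *)
Lemma fac_below (x lam d : R) (z : C) (s : R) :
  0 < x -> 4 * x < lam -> lam / 2 <= s <= lam -> lam <= Cmod z -> 0 <= d <= 1 ->
  Cmod (z - RtoC lam) <= d * lam ->
  fac x z s <= exp (x ^ 2 / lam ^ 2 * (6 * d + 12 * (1 - s / lam))).
Proof.
  intros Hx Hl Hs Hz Hd Hzl.
  assert (Hxs : x <> s) by lra.
  set (a := x ^ 2 / lam ^ 2). set (t := 1 - s / lam).
  assert (Hlam : 0 < lam) by lra.
  assert (Ex : x ^ 2 = a * lam ^ 2) by (unfold a; field; lra).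
  assert (Es : s = lam * (1 - t)) by (unfold t; field; lra).
  assert (Ht : 0 <= t <= 1 / 2).
  { unfold t. split.
    - assert (s / lam <= 1) by (apply ratio_le_1; lra). lra.
    - assert (1 / 2 <= s / lam) by (apply le_div_of_mul_le; lra). lra. }
  assert (Ha : 0 < a) by (unfold a; apply Rdiv_lt_0_compat; nra).
  assert (Ha' : a <= 1 / 16).
  { unfold a. apply div_le_of_le_mul; [nra|]. nra. }
  assert (Hw : Cmod (RtoC x - z) * Cmod (RtoC x + z) <= Cmod z ^ 2 * (1 - a + 3 * d * a)).
  { rewrite <- Cmod_mult.
    replace ((RtoC x - z) * (RtoC x + z))%C with
      (- (z * z) * RtoC (1 - a) - RtoC a * ((z - RtoC lam) * (z + RtoC lam)))%C.
    - eapply Rle_trans; [apply Cmod_triangle|].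
      rewrite Cmod_opp, !Cmod_mult, Cmod_opp, !Cmod_mult, !Cmod_R.
      rewrite (Rabs_pos_eq a), (Rabs_pos_eq (1 - a)) by lra.
      assert (B : Cmod (z + RtoC lam) <= (2 + d) * lam).
      { replace (z + RtoC lam)%C with ((z - RtoC lam) + RtoC (2 * lam))%C
          by (rewrite RtoC_mult; ring).
        eapply Rle_trans; [apply Cmod_triangle|].
        rewrite Cmod_R, Rabs_pos_eq by lra. lra. }
      assert (B0 := Cmod_ge_0 (z + RtoC lam)). assert (B1 := Cmod_ge_0 (z - RtoC lam)).
      assert (B2 : Cmod (z - RtoC lam) * Cmod (z + RtoC lam) <= 3 * d * lam ^ 2).
      { apply Rle_trans with ((d * lam) * ((2 + d) * lam)).
        - apply Rmult_le_compat; auto.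
        - assert (0 <= d * lam ^ 2) by nra. nra. }
      assert (B3 : 3 * d * lam ^ 2 <= 3 * d * Cmod z ^ 2) by
        (apply Rmult_le_compat_l; [lra|nra]).
      nra.
    - replace (RtoC (1 - a)) with (1 - RtoC a)%C by (rewrite RtoC_minus; reflexivity).
      assert (Ec : (RtoC x * RtoC x)%C = (RtoC a * (RtoC lam * RtoC lam))%C).
      { rewrite <- !RtoC_mult. f_equal. nra. }
      replace ((RtoC x - z) * (RtoC x + z))%C with (RtoC x * RtoC x - z * z)%C by ring.
      rewrite Ec. ring. }
  unfold fac. destruct (Req_EM_T x s) as [E|_]; [congruence|].
  rewrite (Rabs_left (x - s)) by lra.
  assert (Hz2 : 0 < Cmod z ^ 2) by nra.
  assert (Hsx : 0 < - (x - s) * (x + s)) by nra.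
  apply Rle_trans with (1 + a * (6 * d + 12 * t)); [|apply exp_ineq1_le].
  apply div_le_of_le_mul; [exact Hsx|].
  apply Rle_trans with (s ^ 2 * (1 - a + 3 * d * a)).
  - replace (s ^ 2 * (1 - a + 3 * d * a)) with
      (s ^ 2 / Cmod z ^ 2 * (Cmod z ^ 2 * (1 - a + 3 * d * a))) by (field; nra).
    apply Rmult_le_compat_l; [|exact Hw].
    apply Rmult_le_pos; [nra|left; now apply Rinv_0_lt_compat].
  - replace (- (x - s) * (x + s)) with (s ^ 2 - x ^ 2) by ring.
    rewrite Ex, Es. set (v := (1 - t) ^ 2).
    assert (Hv : 1 / 4 <= v <= 1) by (unfold v; nra).
    assert (Ev : v = 1 - 2 * t + t ^ 2) by (unfold v; ring).
    replace ((lam * (1 - t)) ^ 2) with (lam ^ 2 * v) by (unfold v; ring).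
    assert (Key : 0 <= a * ((3 * v - 6 * a) * d + 12 * t * (v - a) + v - 1)).
    { apply Rmult_le_pos; [lra|].
      assert (0 <= (3 * v - 6 * a) * d) by (apply Rmult_le_pos; lra).
      assert (12 * t * (3 / 16) <= 12 * t * (v - a)) by (apply Rmult_le_compat_l; lra).
      nra. }
    assert (Key2 : v * (1 - a + 3 * d * a) <= (1 + a * (6 * d + 12 * t)) * (v - a)) by nra.
    assert (0 < lam ^ 2) by nra. nra.
Qed.

(** No cancellation is available off the axis, and the full order a remains; there it is compensated
    by the smallness of the sum of 1 / |z|. *)
Lemma fac_below_crude (x lam : R) (z : C) (s : R) :
  0 < x -> 4 * x < lam -> lam / 2 <= s <= lam -> lam <= Cmod z ->
  fac x z s <= exp (x ^ 2 / lam ^ 2 * 9).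
Proof.
  intros Hx Hl Hs Hz.
  assert (Hxs : x <> s) by lra.
  set (a := x ^ 2 / lam ^ 2).
  assert (Ex : x ^ 2 = a * lam ^ 2) by (unfold a; field; lra).
  assert (Ha : 0 < a) by (unfold a; apply Rdiv_lt_0_compat; nra).
  assert (Ha' : a <= 1 / 16).
  { unfold a. apply div_le_of_le_mul; [nra|]. nra. }
  assert (H3 : Cmod (RtoC x - z) * Cmod (RtoC x + z) <= Cmod z ^ 2 * (1 + a)).
  { rewrite <- Cmod_mult.
    replace ((RtoC x - z) * (RtoC x + z))%C with (RtoC x * RtoC x - z * z)%C by ring.
    eapply Rle_trans; [apply Cmod_triangle|].
    rewrite Cmod_opp, !Cmod_mult, Cmod_R, Rabs_pos_eq by lra.
    assert (a * lam ^ 2 <= a * Cmod z ^ 2) by (apply Rmult_le_compat_l; nra). nra. }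
  unfold fac. destruct (Req_EM_T x s) as [E|_]; [congruence|].
  rewrite (Rabs_left (x - s)) by lra.
  assert (Hz2 : 0 < Cmod z ^ 2) by nra.
  assert (Hsx : 0 < - (x - s) * (x + s)) by nra.
  apply Rle_trans with ((1 + a) * (1 + 8 * a)).
  - apply div_le_of_le_mul; [exact Hsx|].
    apply Rle_trans with (s ^ 2 * (1 + a)).
    + replace (s ^ 2 * (1 + a)) with
        (s ^ 2 / Cmod z ^ 2 * (Cmod z ^ 2 * (1 + a))) by (field; nra).
      apply Rmult_le_compat_l; [|exact H3].
      apply Rmult_le_pos; [nra|left; now apply Rinv_0_lt_compat].
    + replace (- (x - s) * (x + s)) with (s ^ 2 - x ^ 2) by ring.
      assert (Hs4 : lam ^ 2 <= 4 * s ^ 2) by nra.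
      assert (s ^ 2 <= (1 + 8 * a) * (s ^ 2 - x ^ 2)).
      { assert (x ^ 2 <= 4 * a * s ^ 2) by (rewrite Ex; nra).
        assert (x ^ 2 * (1 + 8 * a) <= 4 * a * s ^ 2 * (1 + 8 * a))
          by (apply Rmult_le_compat_r; lra).
        assert (0 < a * s ^ 2) by (apply Rmult_lt_0_compat; nra).
        assert (a * (a * s ^ 2) <= 1 / 16 * (a * s ^ 2)) by (apply Rmult_le_compat_r; lra).
        nra. }
      assert (0 < 1 + a) by lra. nra.
  - replace (a * 9) with (a + 8 * a) by ring. rewrite exp_plus.
    apply Rmult_le_compat; try lra; apply exp_ineq1_le.
Qed.

(** * Products of distances to an arithmetic progression *)

Lemma fact_add_le (a b : nat) : (fact (a + b) <= 2 ^ (a + b) * (fact a * fact b))%nat.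
Proof.
  remember (a + b)%nat as n eqn:En. revert a b En.
  induction n as [|n IH]; intros a b En.
  - destruct a, b; simpl in *; lia.
  - destruct a as [|a].
    + simpl in En. subst b.
      assert (1 <= 2 ^ S n)%nat by (apply Nat.neq_0_lt_0, Nat.pow_nonzero; lia).
      simpl fact at 2. nia.
    + destruct b as [|b].
      * assert (S a = S n) by lia. rewrite H.
        assert (1 <= 2 ^ S n)%nat by (apply Nat.neq_0_lt_0, Nat.pow_nonzero; lia).
        simpl (fact 0). nia.
      * assert (H1 := IH a (S b) ltac:(lia)). assert (H2 := IH (S a) b ltac:(lia)).
        assert (E : S n = (S a + S b)%nat) by lia.
        change (fact (S n)) with (S n * fact n)%nat.
        change (2 ^ S n)%nat with (2 * 2 ^ n)%nat.
        assert (F1 : fact (S a) = (S a * fact a)%nat) by reflexivity.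
        assert (F2 : fact (S b) = (S b * fact b)%nat) by reflexivity.
        apply Nat.le_trans with (S a * fact n + S b * fact n)%nat; [rewrite E; nia|].
        assert (G1 : (S a * fact n <= 2 ^ n * (fact (S a) * fact (S b)))%nat).
        { apply Nat.le_trans with (S a * (2 ^ n * (fact a * fact (S b))))%nat;
            [now apply Nat.mul_le_mono_l|]. rewrite F1. apply Nat.eq_le_incl. ring. }
        assert (G2 : (S b * fact n <= 2 ^ n * (fact (S a) * fact (S b)))%nat).
        { apply Nat.le_trans with (S b * (2 ^ n * (fact (S a) * fact b)))%nat;
            [now apply Nat.mul_le_mono_l|]. rewrite F2. apply Nat.eq_le_incl. ring. }
        lia.
Qed.

(** A weak Stirling bound, from (1 + 1/n)^n <= e <= 3. *)
Lemma pow_self_le_fact (n : nat) : INR n ^ n <= 3 ^ n * INR (fact n).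
Proof.
  induction n as [|n IH]; [simpl; lra|].
  change (fact (S n)) with (S n * fact n)%nat. rewrite mult_INR.
  assert (Hp : INR (S n) ^ n <= 3 * INR n ^ n).
  { destruct n as [|n]; [simpl; lra|].
    assert (Hn : 0 < INR (S n)) by (apply lt_0_INR; lia).
    replace (INR (S (S n))) with (INR (S n) * (1 + / INR (S n)))
      by (rewrite (S_INR (S n)); field; lra).
    rewrite Rpow_mult_distr, Rmult_comm. apply Rmult_le_compat_r; [apply pow_le; lra|].
    apply Rle_trans with (exp (/ INR (S n)) ^ S n).
    - apply pow_incr. split; [|apply exp_ineq1_le].
      assert (0 < / INR (S n)) by now apply Rinv_0_lt_compat. lra.
    - rewrite <- Rpower_pow by apply exp_pos. unfold Rpower. rewrite ln_exp.
      replace (INR (S n) * / INR (S n)) with 1 by (field; lra). apply exp_le_3. }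
  assert (Hn : 0 < INR (S n)) by (apply lt_0_INR; lia).
  apply Rle_trans with (INR (S n) * (3 * INR n ^ n)).
  - rewrite <- tech_pow_Rmult. apply Rmult_le_compat_l; lra.
  - rewrite <- (tech_pow_Rmult 3).
    replace (3 * 3 ^ n * (INR (S n) * INR (fact n)))
      with (INR (S n) * (3 * (3 ^ n * INR (fact n)))) by ring.
    apply Rmult_le_compat_l; lra.
Qed.

(** Rounds u and clamps the result to the range. If m0 is within 1/2 of u, any other integer is at
    least half as far from u as from m0; a clamped m0 lies between u and all other indices. *)
Lemma nearest_index (M : nat) (u : R) : (1 <= M)%nat ->
  exists m0, (m0 < M)%nat /\
    forall m, (m < M)%nat -> Rabs (INR m - INR m0) / 2 <= Rabs (INR m - u).
Proof.
  intros HM.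
  assert (G : forall m0 : nat, (m0 < M)%nat ->
     (Rabs (INR m0 - u) <= 1 / 2 \/ (m0 = 0%nat /\ u <= 0) \/ (S m0 = M /\ INR m0 <= u)) ->
     forall m, (m < M)%nat -> Rabs (INR m - INR m0) / 2 <= Rabs (INR m - u)).
  { intros m0 H0 H m Hm. destruct (Nat.eq_dec m m0) as [->|Hne].
    - replace (INR m0 - INR m0) with 0 by ring. rewrite Rabs_R0.
      assert (A := Rabs_pos (INR m0 - u)). lra.
    - assert (D : INR m - INR m0 <= -1 \/ 1 <= INR m - INR m0).
      { assert (C : (S m <= m0)%nat \/ (S m0 <= m)%nat) by lia.
        destruct C as [C|C]; apply le_INR in C; rewrite S_INR in C; lra. }
      destruct H as [H|[[-> H]|[H1 H2]]].
      + revert H. unfold Rabs. repeat destruct Rcase_abs; lra.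
      + simpl INR in *. assert (P := pos_INR m).
        unfold Rabs. repeat destruct Rcase_abs; lra.
      + assert (C : (S m <= m0)%nat) by lia. apply le_INR in C. rewrite S_INR in C.
        unfold Rabs. repeat destruct Rcase_abs; lra. }
  destruct (Rle_dec u 0) as [Hu|Hu].
  - exists 0%nat. split; [lia|]. apply G; [lia|]. right; left; auto.
  - destruct (nfloor_ex (u + / 2)) as [n [Hn1 Hn2]]; [lra|].
    destruct (le_lt_dec M n) as [Hc|Hc].
    + exists (M - 1)%nat. split; [lia|]. apply G; [lia|]. right; right.
      split; [lia|]. assert (INR (M - 1) <= INR n - 1).
      { replace (INR n - 1) with (INR (n - 1)) by (rewrite minus_INR by lia; simpl; lra).
        apply le_INR. lia. }
      lra.
    + exists n. split; [exact Hc|]. apply G; [exact Hc|]. left.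
      apply Rabs_le. lra.
Qed.

Lemma Rprod_dist_left (c : R) (n : nat) :
  Rprod (fun m => c * (INR n - INR m)) (seq 0 n) = c ^ n * INR (fact n).
Proof.
  induction n as [|n IH]; [simpl; ring|].
  change (seq 0 (S n)) with (0%nat :: seq 1 n).
  rewrite <- seq_shift, Rprod_cons, Rprod_map.
  rewrite (Rprod_ext _ (fun m => c * (INR n - INR m))).
  - rewrite IH. change (fact (S n)) with (S n * fact n)%nat. rewrite mult_INR.
    change (INR 0) with 0. rewrite <- tech_pow_Rmult. ring.
  - intros m _. rewrite !S_INR. ring.
Qed.

Lemma Rprod_dist_right (c : R) (m0 n : nat) :
  Rprod (fun m => c * (INR m - INR m0)) (seq (S m0) n) = c ^ n * INR (fact n).
Proof.
  induction n as [|n IH]; [simpl; ring|].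
  rewrite seq_S, Rprod_app, IH. change (fact (S n)) with (S n * fact n)%nat.
  rewrite mult_INR, Rprod_cons.
  replace (INR (S m0 + n) - INR m0) with (INR (S n)) by (rewrite plus_INR, !S_INR; ring).
  rewrite <- tech_pow_Rmult. change (Rprod _ []) with 1. ring.
Qed.

(* A lattice version of [prod |x - s_m| >= (length / 2e)^M] for an arithmetic
   progression. *)
Lemma progression_prod (x lam D eta tau : R) (s : nat -> R) (M : nat) :
  (1 <= M)%nat -> 0 < tau -> 0 <= eta -> 4 * eta <= D -> 0 < D ->
  (forall m, (m < M)%nat ->
     lam - D * INR (S m) - eta <= s m <= lam - D * INR (S m)) ->
  tau * (D / 8) ^ (M - 1) * INR (fact (M - 1))
    <= Rprod (fun m => Rmax tau (Rabs (x - s m))) (seq 0 M).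
Proof.
  intros HM Ht He HeD HD Hs.
  destruct (nearest_index M ((lam - x) / D - 1) HM) as [m0 [H0 H]].
  (* The spacing D, halved by [nearest_index] and reduced by a rounding error eta <= D / 4, leaves D
     / 4 per unit of index; the nearest node keeps only tau. *)
  set (w := fun m : nat => if Nat.eq_dec m m0 then tau
              else D / 4 * Rabs (INR m - INR m0)).
  apply Rle_trans with (Rprod w (seq 0 M)).
  - replace M with (m0 + S (M - 1 - m0))%nat at 3 by lia.
    rewrite seq_app, Rprod_app. simpl seq. rewrite Rprod_cons.
    rewrite (Rprod_ext w (fun m => D / 4 * (INR m0 - INR m)) (seq 0 m0)).
    2:{ intros m Hm. apply in_seq in Hm. unfold w.
        destruct (Nat.eq_dec m m0); [lia|]. f_equal.
        assert (INR m <= INR m0) by (apply le_INR; lia).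
        rewrite Rabs_left1; lra. }
    rewrite (Rprod_ext w (fun m => D / 4 * (INR m - INR m0)) (seq (S m0) (M - 1 - m0))).
    2:{ intros m Hm. apply in_seq in Hm. unfold w.
        destruct (Nat.eq_dec m m0); [lia|]. f_equal.
        assert (INR m0 <= INR m) by (apply le_INR; lia).
        rewrite Rabs_pos_eq; lra. }
    rewrite Rprod_dist_left, Rprod_dist_right.
    unfold w. destruct (Nat.eq_dec m0 m0) as [_|]; [|congruence].
    set (k := (M - 1 - m0)%nat).
    assert (Ek : (M - 1 = m0 + k)%nat) by (unfold k; lia). rewrite Ek.
    (* The two sides of m0 give m0! k!, at least (m0 + k)! / 2^(m0 + k): this turns D / 4 into D /
       8. *)
    assert (F := fact_add_le m0 k). apply le_INR in F.
    rewrite !mult_INR, pow_INR in F. simpl (INR 2) in F.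
    replace ((D / 4) ^ m0 * INR (fact m0) * (tau * ((D / 4) ^ k * INR (fact k)))) with
      (tau * ((D / 8) ^ (m0 + k) * ((1 + 1) ^ (m0 + k) * (INR (fact m0) * INR (fact k))))).
    + rewrite Rmult_assoc. apply Rmult_le_compat_l; [lra|].
      apply Rmult_le_compat_l; [apply pow_le; lra|exact F].
    + replace (D / 4) with (D / 8 * (1 + 1)) by field.
      rewrite !Rpow_mult_distr, !pow_add. ring.
  - apply Rprod_le. intros m Hm. apply in_seq in Hm. unfold w.
    destruct (Nat.eq_dec m m0) as [E|E].
    + split; [lra|apply Rmax_l].
    + split; [apply Rmult_le_pos; [lra|apply Rabs_pos]|].
      eapply Rle_trans; [|apply Rmax_r].
      specialize (H m ltac:(lia)). specialize (Hs m ltac:(lia)).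
      assert (D1 : 1 <= Rabs (INR m - INR m0)).
      { assert (C : (S m <= m0)%nat \/ (S m0 <= m)%nat) by lia.
        destruct C as [C|C]; apply le_INR in C; rewrite S_INR in C;
          unfold Rabs; destruct Rcase_abs; lra. }
      assert (E1 : Rabs (x - (lam - D * INR (S m))) = D * Rabs (INR m - ((lam - x) / D - 1))).
      { rewrite <- (Rabs_pos_eq D) at 2 by lra. rewrite <- Rabs_mult. f_equal.
        rewrite S_INR. field. lra. }
      assert (E2 : Rabs (x - (lam - D * INR (S m))) - eta <= Rabs (x - s m)).
      { assert (A := Rabs_triang (x - s m) (s m - (lam - D * INR (S m)))).
        replace (x - s m + (s m - (lam - D * INR (S m)))) with (x - (lam - D * INR (S m))) in A by ring.
        assert (Rabs (s m - (lam - D * INR (S m))) <= eta) by (apply Rabs_le; lra). lra. }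
      rewrite E1 in E2.
      assert (D * (Rabs (INR m - INR m0) / 2) <= D * Rabs (INR m - ((lam - x) / D - 1)))
        by (apply Rmult_le_compat_l; lra).
      nra.
Qed.

Lemma Rprod_inv {A : Type} (f : A -> R) (l : list A) :
  Rprod (fun a => / f a) l = / Rprod f l.
Proof.
  induction l as [|a l IH]; simpl; [now rewrite Rinv_1|].
  rewrite IH. now rewrite Rinv_mult.
Qed.

(** The spacing is r lam / M, and [pow_self_le_fact] cancels M^M against the factorial, leaving 24 X
    / (r lam) per node with 24 = 3 * 8. The nearest node, perhaps only tau away, costs B once for
    the whole progression, whatever M is. *)
Lemma progression_near (x lam r eta tau X B : R) (s : nat -> R) (M : nat) :
  0 < tau -> 0 <= eta -> 0 < r -> 0 < lam -> 0 <= X ->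
  1 <= B -> r * lam / (8 * tau) <= B -> 4 * eta * INR M <= r * lam ->
  (forall m, (m < M)%nat ->
     lam - r * lam / INR M * INR (S m) - eta <= s m <= lam - r * lam / INR M * INR (S m)) ->
  Rprod (fun m => X / Rmax tau (Rabs (x - s m))) (seq 0 M)
    <= B * (24 * X / (r * lam)) ^ M.
Proof.
  intros Ht He Hr Hl HX HB1 HB HM Hs.
  destruct M as [|M]; [simpl; lra|].
  assert (Hm : 0 < INR (S M)) by (apply lt_0_INR; lia).
  assert (Hrl : 0 < r * lam) by nra.
  set (D := r * lam / INR (S M)) in *.
  assert (HD : 0 < D) by (unfold D; apply Rdiv_lt_0_compat; lra).
  assert (HeD : 4 * eta <= D) by (unfold D; apply le_div_of_mul_le; lra).
  assert (P := progression_prod x lam D eta tau s (S M) ltac:(lia) Ht He HeD HD Hs).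
  replace (S M - 1)%nat with M in P by lia.
  assert (F := pow_self_le_fact (S M)).
  unfold Rdiv at 1. rewrite Rprod_mult, Rprod_const, length_seq, Rprod_inv.
  set (Q := Rprod (fun m => Rmax tau (Rabs (x - s m))) (seq 0 (S M))) in *.
  set (q0 := tau * (D / 8) ^ M * INR (fact M)) in *.
  assert (Hf : 0 < INR (fact M)) by apply INR_fact_lt_0.
  assert (Hq0 : 0 < q0).
  { unfold q0. apply Rmult_lt_0_compat; [|exact Hf].
    apply Rmult_lt_0_compat; [exact Ht|]. apply pow_lt. lra. }
  apply Rle_trans with (X ^ S M * / q0).
  { apply Rmult_le_compat_l; [now apply pow_le|]. now apply Rinv_le_contravar. }
  apply Rle_trans with (r * lam / (8 * tau) * (24 * X / (r * lam)) ^ S M).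
  2:{ apply Rmult_le_compat_r; [|exact HB]. apply pow_le.
      apply Rmult_le_pos; [lra|]. left. now apply Rinv_0_lt_compat. }
  assert (E : r * lam / (8 * tau) * (24 * X / (r * lam)) ^ S M
     = X ^ S M * (3 ^ S M / (tau * (r * lam / 8) ^ M))).
  { replace (24 * X / (r * lam)) with (X * 3 * / (r * lam / 8)) by (field; lra).
    rewrite !Rpow_mult_distr. rewrite pow_inv.
    assert (0 < (r * lam / 8) ^ M) by (apply pow_lt; lra).
    simpl pow. field. repeat split; lra. }
  rewrite E. apply Rmult_le_compat_l; [now apply pow_le|].
  assert (Hrm : 0 < (r * lam / 8) ^ M) by (apply pow_lt; lra).
  assert (H3 : 0 < 3 ^ S M) by (apply pow_lt; lra).
  replace (3 ^ S M / (tau * (r * lam / 8) ^ M)) with (/ (tau * (r * lam / 8) ^ M / 3 ^ S M))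
    by (field; repeat split; lra).
  assert (Hd1 : 0 < tau * (r * lam / 8) ^ M / 3 ^ S M).
  { apply Rdiv_lt_0_compat; [apply Rmult_lt_0_compat|]; lra. }
  apply Rinv_le_contravar; [exact Hd1|].
  unfold q0, D.
  replace (r * lam / INR (S M) / 8) with (r * lam / 8 * / INR (S M)) by (field; lra).
  rewrite Rpow_mult_distr, pow_inv.
  assert (Hmm : 0 < INR (S M) ^ M) by (apply pow_lt; lra).
  replace (tau * ((r * lam / 8) ^ M * / INR (S M) ^ M) * INR (fact M)) with
    ((tau * (r * lam / 8) ^ M) * (INR (fact M) / INR (S M) ^ M)) by (field; lra).
  unfold Rdiv at 1. apply Rmult_le_compat_l; [apply Rmult_le_pos; lra|].
  apply le_div_of_mul_le; [exact Hmm|].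
  apply Rmult_le_reg_l with (3 ^ S M); [exact H3|].
  replace (3 ^ S M * (/ 3 ^ S M * INR (S M) ^ M)) with (INR (S M) ^ M) by (field; lra).
  change (fact (S M)) with (S M * fact M)%nat in F. rewrite mult_INR in F.
  change (INR (S M) ^ S M) with (INR (S M) * INR (S M) ^ M) in F.
  apply Rmult_le_reg_l with (INR (S M)); [exact Hm|]. lra.
Qed.

Lemma progression_far (x lam r eta tau X : R) (s : nat -> R) (M : nat) :
  0 < tau -> 0 < r -> 0 < lam -> 0 <= X -> eta <= r * lam -> 4 * r * lam <= Rabs (x - lam) ->
  (forall m, (m < M)%nat -> lam - r * lam - eta <= s m <= lam) ->
  Rprod (fun m => X / Rmax tau (Rabs (x - s m))) (seq 0 M)
    <= (X / (Rabs (x - lam) - 2 * r * lam)) ^ M.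
Proof.
  intros Ht Hr Hl HX He Hx Hs.
  rewrite <- (length_seq M 0) at 2. rewrite <- Rprod_const.
  assert (Hrl : 0 < r * lam) by nra.
  apply Rprod_le. intros m Hm. apply in_seq in Hm. specialize (Hs m ltac:(lia)).
  assert (P : 0 < Rmax tau (Rabs (x - s m))) by (eapply Rlt_le_trans; [exact Ht|apply Rmax_l]).
  split.
  - apply Rmult_le_pos; [exact HX|]. left. now apply Rinv_0_lt_compat.
  - apply Rmult_le_compat_l; [exact HX|]. apply Rinv_le_contravar; [lra|].
    eapply Rle_trans; [|apply Rmax_r].
    revert Hx. unfold Rabs. repeat destruct Rcase_abs; lra.
Qed.

(* Bound for the contribution, per zero near [lam], of the nodes at scale
   [2^-j lam], evaluated at a point [x] with [|x - lam| = theta lam]. *)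
Definition kap (d theta : R) (j : nat) : R :=
  if Rlt_dec theta ((/ 2) ^ j) then 96 * 2 ^ j * (theta + d)
  else (theta + d) / (theta - (/ 2) ^ j / 2).

Lemma half_pow_pos (j : nat) : 0 < (/ 2) ^ j.
Proof. apply pow_lt. lra. Qed.

Lemma half_pow_le (i j : nat) : (i <= j)%nat -> (/ 2) ^ j <= (/ 2) ^ i.
Proof.
  intros H. replace j with (i + (j - i))%nat by lia. rewrite pow_add.
  assert (P := half_pow_pos i).
  assert ((/ 2) ^ (j - i) <= 1).
  { rewrite <- (pow1 (j - i)). apply pow_incr. lra. }
  nra.
Qed.

Lemma half_pow_two (j : nat) : 2 ^ j * (/ 2) ^ j = 1.
Proof. rewrite <- Rpow_mult_distr. replace (2 * / 2) with 1 by field. apply pow1. Qed.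

(** The product equals 2^(9 k - k (k + 1) / 2); the exponent peaks at k = 8 and k = 9 with value
    36. *)
Lemma Rprod_half_bound (k : nat) :
  Rprod (fun j => 512 * (2 ^ j * (/ 2) ^ k)) (seq 0 k) <= 2 ^ 36.
Proof.
  assert (Rec : forall k, Rprod (fun j => 512 * (2 ^ j * (/ 2) ^ S k)) (seq 0 (S k))
     = 512 * (/ 2) ^ S k * Rprod (fun j => 512 * (2 ^ j * (/ 2) ^ k)) (seq 0 k)).
  { intros n. change (seq 0 (S n)) with (0%nat :: seq 1 n).
    rewrite <- seq_shift, Rprod_cons, Rprod_map.
    rewrite (Rprod_ext _ (fun j => 512 * (2 ^ j * (/ 2) ^ n))).
    - simpl pow. ring.
    - intros j _. simpl pow. field. }
  assert (N : Rprod (fun j => 512 * (2 ^ j * (/ 2) ^ 9)) (seq 0 9) <= 2 ^ 36)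
    by (rewrite !Rec; simpl; lra).
  destruct (le_lt_dec 9 k) as [Hk|Hk].
  - induction Hk as [|k Hk IH]; [exact N|].
    rewrite Rec.
    assert (H9 := half_pow_le 9 (S k) ltac:(lia)).
    assert (H9' : (/ 2) ^ 9 = / 512) by (simpl; field). rewrite H9' in H9.
    assert (P := half_pow_pos (S k)).
    assert (P2 : 0 <= Rprod (fun j => 512 * (2 ^ j * (/ 2) ^ k)) (seq 0 k)).
    { apply Rprod_ge0. intros j _. apply Rmult_le_pos; [lra|].
      apply Rmult_le_pos; apply pow_le; lra. }
    assert (512 * (/ 2) ^ S k <= 1) by lra. nra.
  - do 9 (destruct k as [|k]; [rewrite ?Rec; simpl; lra|]). lia.
Qed.

(* Zeros clustered at [lam] are shared equally among [J] dyadic scales; at any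
   point only boundedly many scales contribute a factor larger than [1]. *)
Lemma kap_prod (d theta : R) (J : nat) :
  0 <= theta -> 0 < d -> 2 * INR J * d <= (/ 2) ^ J -> d <= (/ 2) ^ J ->
  Rprod (kap d theta) (seq 0 J) <= 2 ^ 36 * exp 3.
Proof.
  intros Hth Hd HJ HJ2.
  (* The scales split at k: for j < k the point is within range of the nodes, from k on it is clear
     of them. *)
  assert (Hk : exists k, (k <= J)%nat /\ (forall j, (j < k)%nat -> theta < (/ 2) ^ j) /\
             ((k < J)%nat -> (/ 2) ^ k <= theta)).
  { clear HJ HJ2. induction J as [|J IH].
    - exists 0%nat. repeat split; intros; lia.
    - destruct IH as [k [H1 [H2 H3]]].
      destruct (Nat.eq_dec k J) as [E|E].
      + subst k. destruct (Rlt_dec theta ((/ 2) ^ J)) as [L|L].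
        * exists (S J). repeat split; [lia| |intros; lia]. intros j Hj.
          destruct (Nat.eq_dec j J) as [->|]; [exact L|]. apply H2. lia.
        * exists J. repeat split; [lia|auto|intros; lra].
      + exists k. repeat split; [lia|auto|intros; apply H3; lia]. }
  destruct Hk as [k [Hk1 [Hk2 Hk3]]].
  replace J with (k + (J - k))%nat by lia. rewrite seq_app, Rprod_app. simpl plus.
  apply Rmult_le_compat.
  - apply Rprod_ge0. intros j Hj. apply in_seq in Hj. unfold kap.
    destruct (Rlt_dec theta ((/ 2) ^ j)) as [L|L]; [|destruct L; apply Hk2; lia].
    apply Rmult_le_pos; [apply Rmult_le_pos; [lra|apply pow_le; lra]|lra].
  - apply Rprod_ge0. intros j Hj. apply in_seq in Hj. unfold kap.
    assert (P := half_pow_pos j).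
    destruct (Rlt_dec theta ((/ 2) ^ j)) as [L|L].
    + apply Rmult_le_pos; [apply Rmult_le_pos; [lra|apply pow_le; lra]|lra].
    + apply Rmult_le_pos; [lra|]. left. apply Rinv_0_lt_compat. lra.
  - eapply Rle_trans; [|apply (Rprod_half_bound k)].
    apply Rprod_le. intros j Hj. apply in_seq in Hj. unfold kap.
    destruct (Rlt_dec theta ((/ 2) ^ j)) as [L|L]; [|destruct L; apply Hk2; lia].
    assert (P2 : 0 < 2 ^ j) by (apply pow_lt; lra).
    split; [apply Rmult_le_pos; [apply Rmult_le_pos; lra|lra]|].
    (* A near factor is at most 96 * 3 = 288 times 2^(j - k), within the 512 of
       [Rprod_half_bound]. *)
    assert (T1 : theta <= 2 * (/ 2) ^ k).
    { destruct k as [|k]; [lia|]. specialize (Hk2 k ltac:(lia)). simpl pow. lra. }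
    assert (T2 := half_pow_le k J ltac:(lia)).
    assert (T3 : theta + d <= 3 * (/ 2) ^ k) by lra.
    assert (0 < (/ 2) ^ k) by apply half_pow_pos.
    assert (2 ^ j * (theta + d) <= 2 ^ j * (3 * (/ 2) ^ k)) by (apply Rmult_le_compat_l; lra).
    assert (0 < 2 ^ j * (/ 2) ^ k) by (apply Rmult_lt_0_compat; lra).
    lra.
  - destruct (Nat.eq_dec k J) as [E|E].
    { replace (J - k)%nat with 0%nat by lia. simpl.
      assert (H := exp_ineq1_le 3). lra. }
    specialize (Hk3 ltac:(lia)).
    assert (P0 := half_pow_pos k).
    (* The numerators sum to at most 2 J d + 2 * 2^-k <= 3 * 2^-k <= 3 theta, whence exp 3. *)
    apply Rle_trans with (Rprod (fun j => exp ((2 * d + (/ 2) ^ j) / theta)) (seq k (J - k))).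
    + apply Rprod_le. intros j Hj. apply in_seq in Hj. unfold kap.
      assert (P := half_pow_pos j). assert (L2 := half_pow_le k j ltac:(lia)).
      destruct (Rlt_dec theta ((/ 2) ^ j)) as [L|L]; [lra|].
      split; [apply Rmult_le_pos; [lra|left; apply Rinv_0_lt_compat; lra]|].
      eapply Rle_trans; [|apply exp_ineq1_le].
      set (q := (/ 2) ^ j) in *.
      apply div_le_of_le_mul; [lra|].
      replace ((1 + (2 * d + q) / theta) * (theta - q / 2)) with
        (theta - q / 2 + (2 * d + q) * (1 - q / (2 * theta))) by (field; lra).
      assert (q / (2 * theta) <= 1 / 2).
      { apply div_le_of_le_mul; lra. }
      nra.
    + rewrite Rprod_exp. apply exp_le_compat.
      assert (G : forall n, Rsum (fun j => (2 * d + (/ 2) ^ j)) (seq k n)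
                   = INR n * (2 * d) + 2 * (/ 2) ^ k - 2 * (/ 2) ^ (k + n)).
      { induction n as [|n IH]; [simpl; rewrite Nat.add_0_r; ring|].
        rewrite seq_S, Rsum_app, IH. simpl Rsum. rewrite S_INR.
        replace (k + S n)%nat with (S (k + n)) by lia. simpl pow. field. }
      rewrite (Rsum_ext _ (fun j => / theta * (2 * d + (/ 2) ^ j))) by (intros; apply Rmult_comm).
      rewrite Rsum_scal, G. rewrite Rmult_comm. apply div_le_of_le_mul; [lra|].
      replace (k + (J - k))%nat with J by lia.
      assert (INR (J - k) <= INR J) by (apply le_INR; lia).
      assert (PJ := half_pow_pos J). assert (L2 := half_pow_le k J ltac:(lia)).
      assert (INR (J - k) * (2 * d) <= INR J * (2 * d)) by (apply Rmult_le_compat_r; lra).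
      lra.
Qed.

(** * Geometric blocks of zeros *)

Lemma NoDup_flat_map {A B : Type} (h : A -> list B) (l : list A) :
  NoDup l -> (forall a, In a l -> NoDup (h a)) ->
  (forall a a' b, In a l -> In a' l -> In b (h a) -> In b (h a') -> a = a') ->
  NoDup (flat_map h l).
Proof.
  induction l as [|a l IH]; simpl; intros ND H1 H2; [constructor|].
  inversion ND as [|? ? Ha ND']; subst.
  apply NoDup_app; [now apply H1; left|apply IH; auto; intros; eapply H2; eauto|].
  intros b Hb Hb'. apply in_flat_map in Hb'. destruct Hb' as [a' [Ha' Hb']].
  apply Ha. replace a with a'; [exact Ha'|].
  apply (H2 a' a b); auto.
Qed.

Lemma map_snd_combine {A B : Type} (l : list A) (l' : list B) :
  length l = length l' -> map snd (combine l l') = l'.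
Proof.
  revert l'. induction l as [|a l IH]; intros [|b l'] H; simpl in *; try congruence.
  f_equal. apply IH. congruence.
Qed.

Lemma map_fst_combine {A B : Type} (l : list A) (l' : list B) :
  length l = length l' -> map fst (combine l l') = l.
Proof.
  revert l'. induction l as [|a l IH]; intros [|b l'] H; simpl in *; try congruence.
  f_equal. apply IH. congruence.
Qed.

Lemma Rprod_combine_le {A B : Type} (F : A -> B -> R) (g : B -> R) (l : list A) (l' : list B) :
  length l = length l' ->
  (forall a b, In a l -> In b l' -> 0 <= F a b <= g b) ->
  Rprod (fun p => F (fst p) (snd p)) (combine l l') <= Rprod g l'.
Proof.
  intros Hl H.
  rewrite <- (map_snd_combine l l' Hl) at 2. rewrite Rprod_map.
  apply Rprod_le. intros [a b] Hp. simpl.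
  apply H; [eapply in_combine_l|eapply in_combine_r]; eauto.
Qed.

Section Blocks.
Variables (J W : nat) (d ph C1 tau : R).
Hypothesis HJ : (1 <= J)%nat.
Hypothesis HW : (1 <= W)%nat.
Hypothesis Hd : 0 < d.
Hypothesis HdJ : 2 * INR J * d <= (/ 2) ^ J.
Hypothesis Hph : 1 < ph.
Hypothesis HqW : 4 <= (ph ^ 2) ^ W.
Hypothesis HC1 : 1 <= C1.
Hypothesis Htau : 0 < tau <= 1.

(* Block [i] holds zeros of modulus in [lam i, lam (i + 1)).  The zeros close to
   the real axis are matched with the groups [j < J], whose nodes lie within
   [radius j * lam i] below [lam i]; the others with the group [J].  Nodes of group
   [j] are chosen with index congruent to [class i j] modulo [modulus]; two blocks
   with the same class differ by a multiple of [W], hence are separated in modulus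
   by a factor at least 4, and no node is used twice. *)
Definition modulus : nat := (W * S J + 1)%nat.

Hypothesis Htau2 : 16 * (INR modulus * tau) * C1 <= (/ 2) ^ J.

Definition node (n : nat) : R := tau * (INR n + / 2).

(** The ratio is a square because the estimates also use ph^i, the square root of [lam i]. *)
Definition lam (i : nat) : R := (ph ^ 2) ^ i.

(** Index J belongs to the zeros off the axis, hence the separate value. *)
Definition radius (j : nat) : R := if le_lt_dec J j then / 4 else (/ 2) ^ j / 4.

Definition class (i j : nat) : nat := ((i mod W) * S J + j)%nat.

(** For c < [modulus] and y >= eta this is the last index congruent to c whose node does not exceed
    y; the maximum with 0 only makes the floor total. *)
Definition gridpt (c : nat) (y : R) : nat :=
  (modulus * proj1_sig (nfloor_ex _ (Rmax_l 0 ((y / tau - / 2 - INR c) / INR modulus))) + c)%nat.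

(** Targets equally spaced below [lam i], each rounded down within the residue class. Rounding down
    keeps every node below the moduli of the zeros in the block. *)
Definition group (i j M : nat) : list nat :=
  map (fun m => gridpt (class i j) (lam i - radius j * lam i / INR M * INR (S m))) (seq 0 M).

Definition on_nodes (i M : nat) : list nat := flat_map (fun j => group i j M) (seq 0 J).

Let eta := INR modulus * tau.

Lemma modulus_ge1 : 1 <= INR modulus.
Proof. replace 1 with (INR 1) by reflexivity. apply le_INR. unfold modulus. lia. Qed.

Lemma eta_pos : 0 < eta.
Proof. assert (H := modulus_ge1). unfold eta. nra. Qed.

Lemma d_le : d <= (/ 2) ^ J.
Proof. assert (H : 1 <= INR J) by (apply (le_INR 1); lia). nra. Qed.

Lemma lam_ge1 (i : nat) : 1 <= lam i.
Proof. unfold lam. apply pow_R1_Rle. nra. Qed.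

Lemma node_pos (n : nat) : 0 < node n.
Proof. unfold node. assert (H := pos_INR n). nra. Qed.

Lemma node_gap (n m : nat) : node n <> node m -> tau <= Rabs (node n - node m).
Proof.
  intros H. assert (Hnm : n <> m) by congruence. unfold node.
  replace (tau * (INR n + / 2) - tau * (INR m + / 2)) with (tau * (INR n - INR m)) by ring.
  rewrite Rabs_mult, (Rabs_pos_eq tau) by lra.
  assert (1 <= Rabs (INR n - INR m)).
  { assert (C : (S n <= m)%nat \/ (S m <= n)%nat) by lia.
    destruct C as [C|C]; apply le_INR in C; rewrite S_INR in C;
      unfold Rabs; destruct Rcase_abs; lra. }
  nra.
Qed.

Lemma radius_bounds (j : nat) : (/ 2) ^ J / 4 <= radius j <= / 4.
Proof.
  unfold radius. destruct (le_lt_dec J j) as [H|H].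
  - assert (K := half_pow_le 0 J ltac:(lia)). simpl in K. lra.
  - assert (K := half_pow_le j J ltac:(lia)). assert (K2 := half_pow_le 0 j ltac:(lia)).
    simpl in K2. lra.
Qed.

Lemma radius_pos (j : nat) : 0 < radius j.
Proof. assert (H := radius_bounds j). assert (P := half_pow_pos J). lra. Qed.

(** The spacing inside a group is at least four times the rounding error. This is what the smallness
    of tau is for, a block containing O (lam i) zeros. *)
Lemma eta_small (i j : nat) (M : nat) : INR M <= C1 * lam i ->
  4 * eta * INR M <= radius j * lam i.
Proof.
  intros HM. assert (H := radius_bounds j). assert (E := eta_pos). assert (L := lam_ge1 i).
  fold eta in Htau2.
  apply Rle_trans with (4 * eta * (C1 * lam i)); [apply Rmult_le_compat_l; lra|].
  replace (4 * eta * (C1 * lam i)) with (16 * eta * C1 * lam i / 4) by field.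
  assert (16 * eta * C1 * lam i <= (/ 2) ^ J * lam i) by (apply Rmult_le_compat_r; lra).
  nra.
Qed.

Lemma eta_small1 (i j : nat) : 4 * eta <= radius j * lam i.
Proof.
  assert (L := lam_ge1 i). assert (E := eta_pos).
  assert (H := eta_small i j 1). simpl INR in H.
  rewrite Rmult_1_r in H. apply H. nra.
Qed.

Lemma class_lt (i j : nat) : (j <= J)%nat -> (class i j < W * S J)%nat.
Proof.
  intros H. unfold class. assert (i mod W < W)%nat by (apply Nat.mod_upper_bound; lia). nia.
Qed.

Lemma gridpt_mod (c : nat) (y : R) : (c < modulus)%nat -> (gridpt c y mod modulus = c)%nat.
Proof.
  intros H. unfold gridpt. rewrite Nat.add_comm, Nat.mul_comm, Nat.Div0.mod_add.
  now apply Nat.mod_small.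
Qed.

Lemma gridpt_spec (c : nat) (y : R) : (c < modulus)%nat -> eta <= y ->
  y - eta < node (gridpt c y) <= y.
Proof.
  intros Hc Hy. unfold gridpt, node.
  destruct (nfloor_ex _ (Rmax_l 0 ((y / tau - / 2 - INR c) / INR modulus))) as [k [Hk1 Hk2]].
  simpl proj1_sig. rewrite plus_INR, mult_INR.
  assert (G := modulus_ge1).
  set (v := y / tau - / 2 - INR c) in *.
  assert (Ey : y = tau * (v + / 2 + INR c)) by (unfold v; field; lra).
  assert (Hv : 0 <= v).
  { assert (C : INR c + 1 <= INR modulus) by (rewrite <- S_INR; apply le_INR; lia).
    assert (INR modulus <= y / tau) by (apply le_div_of_mul_le; [lra|exact Hy]).
    unfold v. lra. }
  rewrite Rmax_right in Hk1, Hk2 by (apply Rmult_le_pos; [lra|left; apply Rinv_0_lt_compat; lra]).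
  assert (K1 : INR modulus * INR k <= v).
  { apply Rmult_le_compat_l with (r := INR modulus) in Hk1; [|lra].
    replace (INR modulus * (v / INR modulus)) with v in Hk1 by (field; lra). exact Hk1. }
  assert (K2 : v < INR modulus * INR k + INR modulus).
  { apply Rmult_lt_compat_l with (r := INR modulus) in Hk2; [|lra].
    replace (INR modulus * (v / INR modulus)) with v in Hk2 by (field; lra). lra. }
  rewrite Ey. unfold eta. split; nra.
Qed.

Lemma group_spec (i j M m : nat) : (j <= J)%nat -> INR M <= C1 * lam i -> (m < M)%nat ->
  let y := lam i - radius j * lam i / INR M * INR (S m) in
  y - eta < node (gridpt (class i j) y) <= y.
Proof.
  intros Hj HM Hm y. apply gridpt_spec.
  - assert (H := class_lt i j Hj). unfold modulus. lia.
  - unfold y. assert (L := lam_ge1 i). assert (R1 := radius_bounds j). assert (R2 := radius_pos j).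
    assert (E := eta_small1 i j).
    assert (HMp : 0 < INR M) by (apply lt_0_INR; lia).
    assert (HSm : INR (S m) <= INR M) by (apply le_INR; lia).
    assert (radius j * lam i / INR M * INR (S m) <= radius j * lam i).
    { replace (radius j * lam i / INR M * INR (S m)) with
        (radius j * lam i * (INR (S m) / INR M)) by (field; lra).
      assert (INR (S m) / INR M <= 1) by (apply ratio_le_1; lra).
      assert (0 < radius j * lam i) by nra. nra. }
    nra.
Qed.

Lemma group_bounds (i j M n : nat) : (j <= J)%nat -> INR M <= C1 * lam i ->
  In n (group i j M) -> lam i * (1 - 2 * radius j) <= node n <= lam i.
Proof.
  intros Hj HM Hn. unfold group in Hn. apply in_map_iff in Hn.
  destruct Hn as [m [E Hm]]. apply in_seq in Hm. subst n.
  assert (H := group_spec i j M m Hj HM ltac:(lia)). simpl in H.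
  assert (L := lam_ge1 i). assert (R1 := radius_bounds j). assert (R2 := radius_pos j).
  assert (E := eta_small1 i j).
  assert (HMp : 0 < INR M) by (apply lt_0_INR; lia).
  assert (HSm : INR (S m) <= INR M) by (apply le_INR; lia).
  assert (HSm' : 0 < INR (S m)) by (apply lt_0_INR; lia).
  assert (Y : 0 <= radius j * lam i / INR M * INR (S m) <= radius j * lam i).
  { replace (radius j * lam i / INR M * INR (S m)) with
      (radius j * lam i * (INR (S m) / INR M)) by (field; lra).
    assert (INR (S m) / INR M <= 1) by (apply ratio_le_1; lra).
    assert (0 < INR (S m) / INR M) by (apply Rdiv_lt_0_compat; lra).
    assert (0 < radius j * lam i) by nra. nra. }
  simpl INR in *. nra.
Qed.

Lemma group_half (i j M n : nat) : (j <= J)%nat -> INR M <= C1 * lam i ->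
  In n (group i j M) -> lam i / 2 <= node n <= lam i.
Proof.
  intros Hj HM Hn. assert (H := group_bounds i j M n Hj HM Hn).
  assert (R1 := radius_bounds j). assert (L := lam_ge1 i). nra.
Qed.

Lemma group_mod (i j M n : nat) : (j <= J)%nat -> In n (group i j M) ->
  (n mod modulus = class i j)%nat.
Proof.
  intros Hj Hn. unfold group in Hn. apply in_map_iff in Hn.
  destruct Hn as [m [E Hm]]. subst n. apply gridpt_mod.
  assert (H := class_lt i j Hj). unfold modulus. lia.
Qed.

Lemma group_NoDup (i j M : nat) : (j <= J)%nat -> INR M <= C1 * lam i -> NoDup (group i j M).
Proof.
  intros Hj HM. unfold group. apply NoDup_map_NoDup_ForallPairs; [|apply seq_NoDup].
  assert (K : forall m m', (m < m')%nat -> (m' < M)%nat ->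
     gridpt (class i j) (lam i - radius j * lam i / INR M * INR (S m)) <>
     gridpt (class i j) (lam i - radius j * lam i / INR M * INR (S m'))).
  { intros m m' H1 H2 E.
    assert (A := group_spec i j M m Hj HM ltac:(lia)).
    assert (B := group_spec i j M m' Hj HM ltac:(lia)).
    cbv zeta in A, B. rewrite E in A.
    assert (HMp : 0 < INR M) by (apply lt_0_INR; lia).
    assert (E1 := eta_small i j M HM). assert (E0 := eta_pos).
    assert (D : 4 * eta <= radius j * lam i / INR M) by (apply le_div_of_mul_le; lra).
    assert (D2 : INR (S m) + 1 <= INR (S m')) by (rewrite <- S_INR; apply le_INR; lia).
    nra. }
  intros m m' Hm Hm' E. apply in_seq in Hm, Hm'.
  destruct (Nat.lt_trichotomy m m') as [L|[L|L]]; auto.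
  - destruct (K m m' L ltac:(lia) E).
  - destruct (K m' m L ltac:(lia)). now symmetry.
Qed.

Lemma lam_separated (i i' : nat) : (i mod W = i' mod W)%nat -> (i < i')%nat ->
  4 * lam i <= lam i'.
Proof.
  intros Hmod Hlt.
  assert (Hw : (i + W <= i')%nat).
  { assert (A := Nat.div_mod_eq i W). assert (B := Nat.div_mod_eq i' W).
    rewrite Hmod in A.
    assert (D : (S (i / W) <= i' / W)%nat).
    { destruct (le_lt_dec (S (i / W)) (i' / W)) as [D|D]; [exact D|exfalso].
      assert (W * (i' / W) <= W * (i / W))%nat by (apply Nat.mul_le_mono_l; lia). lia. }
    apply (Nat.mul_le_mono_l _ _ W) in D. lia. }
  unfold lam. replace i' with (i + (W + (i' - i - W)))%nat by lia. rewrite !pow_add.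
  assert (L := lam_ge1 i). assert (L2 := lam_ge1 (i' - i - W)). unfold lam in L, L2.
  assert (4 <= (ph ^ 2) ^ W * (ph ^ 2) ^ (i' - i - W)) by nra. nra.
Qed.

Lemma class_inj (i j i' j' : nat) : (j <= J)%nat -> (j' <= J)%nat ->
  class i j = class i' j' -> (i mod W = i' mod W)%nat /\ j = j'.
Proof.
  unfold class. intros H1 H2 E.
  set (a := (i mod W)%nat) in *. set (b := (i' mod W)%nat) in *.
  assert (a = b) by nia. split; [assumption|nia].
Qed.

Lemma group_disjoint (i j M i' j' M' n : nat) : (j <= J)%nat -> (j' <= J)%nat ->
  INR M <= C1 * lam i -> INR M' <= C1 * lam i' ->
  In n (group i j M) -> In n (group i' j' M') -> i = i' /\ j = j'.
Proof.
  intros Hj Hj' HM HM' H H'.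
  assert (A := group_mod _ _ _ _ Hj H). assert (B := group_mod _ _ _ _ Hj' H').
  rewrite A in B. apply class_inj in B; auto. destruct B as [B1 B2]. split; [|exact B2].
  assert (P := group_half _ _ _ _ Hj HM H). assert (P' := group_half _ _ _ _ Hj' HM' H').
  assert (L := lam_ge1 i). assert (L' := lam_ge1 i').
  destruct (Nat.lt_trichotomy i i') as [K|[K|K]]; auto.
  - assert (Q := lam_separated i i' B1 K). lra.
  - assert (Q := lam_separated i' i (eq_sym B1) K). lra.
Qed.

(** * Cost of a single block of zeros *)

Definition on_target (i : nat) (z : C) : Prop :=
  lam i <= Cmod z /\
  (Cmod (z - RtoC (lam i)) <= d * lam i \/ Cmod (- z - RtoC (lam i)) <= d * lam i).

Definition kap_const : R := 2 ^ 36 * exp 3.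

Lemma group_length (i j M : nat) : length (group i j M) = M.
Proof. unfold group. now rewrite length_map, length_seq. Qed.

Lemma Rprod_group (f : nat -> R) (i j M : nat) : Rprod f (group i j M)
  = Rprod (fun m => f (gridpt (class i j) (lam i - radius j * lam i / INR M * INR (S m)))) (seq 0 M).
Proof. apply Rprod_map. Qed.

Lemma group_near (x X : R) (i j M : nat) : (j <= J)%nat -> INR M <= C1 * lam i ->
  lam i <= 4 * x -> 0 <= X -> tau <= 2 * x ->
  Rprod (fun n => X / Rmax tau (Rabs (x - node n))) (group i j M)
    <= 4 * x / tau * (24 * X / (radius j * lam i)) ^ M.
Proof.
  intros Hj HM Hx HX Hxt.
  assert (L := lam_ge1 i). assert (R1 := radius_bounds j). assert (R2 := radius_pos j).
  assert (E := eta_pos).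
  rewrite Rprod_group.
  apply (progression_near x (lam i) (radius j) eta tau X (4 * x / tau)
    (fun m => node (gridpt (class i j) (lam i - radius j * lam i / INR M * INR (S m)))));
    try lra.
  - apply le_div_of_mul_le; lra.
  - replace (radius j * lam i / (8 * tau)) with (radius j * lam i / 8 / tau) by (field; lra).
    apply Rmult_le_compat_r; [left; apply Rinv_0_lt_compat; lra|nra].
  - now apply eta_small.
  - intros m Hm. assert (H := group_spec i j M m Hj HM Hm). cbv zeta in H. lra.
Qed.

Lemma group_far (x X : R) (i j M : nat) : (j <= J)%nat -> INR M <= C1 * lam i ->
  0 <= X -> 4 * radius j * lam i <= Rabs (x - lam i) ->
  Rprod (fun n => X / Rmax tau (Rabs (x - node n))) (group i j M)
    <= (X / (Rabs (x - lam i) - 2 * radius j * lam i)) ^ M.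
Proof.
  intros Hj HM HX Hx.
  assert (L := lam_ge1 i). assert (R1 := radius_bounds j). assert (R2 := radius_pos j).
  assert (E := eta_pos). assert (E1 := eta_small1 i j).
  rewrite Rprod_group.
  apply (progression_far x (lam i) (radius j) eta tau X
    (fun m => node (gridpt (class i j) (lam i - radius j * lam i / INR M * INR (S m)))));
    try lra.
  intros m Hm.
  assert (HMp : 0 < INR M) by (apply lt_0_INR; lia).
  assert (HSm : INR (S m) <= INR M) by (apply le_INR; lia).
  assert (HSm' : 0 < INR (S m)) by (apply lt_0_INR; lia).
  assert (Y : 0 <= radius j * lam i / INR M * INR (S m) <= radius j * lam i).
  { replace (radius j * lam i / INR M * INR (S m)) with
      (radius j * lam i * (INR (S m) / INR M)) by (field; lra).
    assert (INR (S m) / INR M <= 1) by (apply ratio_le_1; lra).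
    assert (0 < INR (S m) / INR M) by (apply Rdiv_lt_0_compat; lra).
    assert (0 < radius j * lam i) by nra. nra. }
  assert (H := group_spec i j M m Hj HM Hm). cbv zeta in H. lra.
Qed.

Lemma length_flat_map_const {A B : Type} (h : A -> list B) (l : list A) (M : nat) :
  (forall a, length (h a) = M) -> length (flat_map h l) = (length l * M)%nat.
Proof.
  intros H. induction l as [|a l IH]; simpl; [reflexivity|].
  now rewrite length_app, H, IH.
Qed.

Lemma on_nodes_length (i M : nat) : length (on_nodes i M) = (J * M)%nat.
Proof.
  unfold on_nodes. rewrite (length_flat_map_const _ _ M), length_seq; [reflexivity|].
  intros j. apply group_length.
Qed.

Lemma fac_target (x : R) (i n : nat) (z : C) : 0 < x ->
  (x <> node n -> tau <= Rabs (x - node n)) -> node n <= lam i -> on_target i z ->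
  fac x z (node n) <= (Rabs (x - lam i) + d * lam i) / Rmax tau (Rabs (x - node n)).
Proof.
  intros Hx Hxs Hn [Hz1 Hz2]. assert (Hnp := node_pos n).
  assert (T : forall y : C, Cmod (y - RtoC (lam i)) <= d * lam i ->
            Cmod (RtoC x - y) <= Rabs (x - lam i) + d * lam i).
  { intros y Hy. rewrite <- Cmod_R.
    replace (RtoC x - y)%C with (RtoC (x - lam i) + - (y - RtoC (lam i)))%C
      by (rewrite RtoC_minus; ring).
    eapply Rle_trans; [apply Cmod_triangle|]. rewrite Cmod_opp. lra. }
  destruct Hz2 as [Hz2|Hz2].
  - apply fac_near; auto; lra.
  - rewrite <- fac_opp. apply fac_near; auto; try lra. rewrite Cmod_opp. lra.
Qed.

(** All zeros of the block obey the same bound, so it is irrelevant which zero meets which node. A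
    group costs 4 x / tau once and a factor [kap] per node; since the J values of [kap] multiply to
    a constant independent of J, the J * M zeros together cost only [kap_const ^ M]. *)
Lemma on_block_above (x : R) (i M : nat) (zs : list C) : lam i <= 4 * x -> tau <= 2 * x ->
  (forall n, x <> node n -> tau <= Rabs (x - node n)) ->
  INR M <= C1 * lam i -> length zs = (J * M)%nat -> (forall z, In z zs -> on_target i z) ->
  Rprod (fun p => fac x (fst p) (node (snd p))) (combine zs (on_nodes i M))
    <= (4 * x / tau) ^ J * kap_const ^ M.
Proof.
  intros Hx Hxt Hxn HM Hlen Hzs.
  assert (L := lam_ge1 i).
  set (X := Rabs (x - lam i) + d * lam i).
  assert (HX : 0 <= X) by (unfold X; assert (P := Rabs_pos (x - lam i)); nra).
  eapply Rle_trans.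
  { apply (Rprod_combine_le (fun z n => fac x z (node n))
       (fun n => X / Rmax tau (Rabs (x - node n)))).
    - now rewrite on_nodes_length.
    - intros z n Hz Hn. specialize (Hzs z Hz).
      apply in_flat_map in Hn. destruct Hn as [j [Hj Hn]]. apply in_seq in Hj.
      assert (B := group_half i j M n ltac:(lia) HM Hn).
      split.
      + apply fac_ge0; try lra. destruct Hzs. lra.
      + apply fac_target; auto; lra. }
  unfold on_nodes. rewrite Rprod_flat_map.
  set (theta := Rabs (x - lam i) / lam i).
  assert (Eth : Rabs (x - lam i) = theta * lam i) by (unfold theta; field; lra).
  assert (Hth : 0 <= theta).
  { unfold theta. apply Rmult_le_pos; [apply Rabs_pos|left; apply Rinv_0_lt_compat; lra]. }
  apply Rle_trans with (Rprod (fun j => 4 * x / tau * kap d theta j ^ M) (seq 0 J)).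
  - apply Rprod_le. intros j Hj. apply in_seq in Hj. split.
    + apply Rprod_ge0. intros n _. apply Rmult_le_pos; [exact HX|].
      left. apply Rinv_0_lt_compat. eapply Rlt_le_trans; [apply (proj1 Htau)|apply Rmax_l].
    + assert (Er : radius j = (/ 2) ^ j / 4).
      { unfold radius. destruct (le_lt_dec J j); [lia|reflexivity]. }
      assert (P := half_pow_pos j). assert (TT := half_pow_two j).
      unfold kap. destruct (Rlt_dec theta ((/ 2) ^ j)) as [C|C].
      (* With radius (/ 2)^j / 4, the base 24 X / (radius lam) carries 24 * 4 = 96, the constant in
         [kap]. *)
      * eapply Rle_trans; [apply group_near; auto; lia|].
        right. f_equal. f_equal. unfold X. rewrite Eth, Er.
        assert (T2 : 2 ^ j = / (/ 2) ^ j) by (field_simplify_eq; lra).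
        rewrite T2. field. split; lra.
      * eapply Rle_trans; [apply group_far; auto; [lia|]|].
        { rewrite Eth, Er. nra. }
        assert (B1 : 1 <= 4 * x / tau) by (apply le_div_of_mul_le; lra).
        assert (B2 : X / (Rabs (x - lam i) - 2 * radius j * lam i)
                     = (theta + d) / (theta - (/ 2) ^ j / 2)).
        { unfold X. rewrite Eth, Er. field. repeat split; try lra.
          intros E0. assert (0 < lam i * (theta - (/ 2) ^ j / 2)) by (apply Rmult_lt_0_compat; lra).
          lra. }
        rewrite B2.
        assert (0 <= ((theta + d) / (theta - (/ 2) ^ j / 2)) ^ M).
        { apply pow_le. apply Rmult_le_pos; [lra|]. left. apply Rinv_0_lt_compat. lra. }
        nra.
  - rewrite Rprod_mult, Rprod_const, length_seq.
    apply Rmult_le_compat_l.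
    { apply pow_le. apply Rmult_le_pos; [lra|]. left. apply Rinv_0_lt_compat. lra. }
    assert (Ep : forall l, Rprod (fun j => kap d theta j ^ M) l = Rprod (kap d theta) l ^ M).
    { induction l as [|a l IH]; simpl; [now rewrite pow1|].
      rewrite IH, Rpow_mult_distr. reflexivity. }
    rewrite Ep. apply pow_incr. split.
    + apply Rprod_ge0. intros j _. unfold kap. assert (P := half_pow_pos j).
      destruct (Rlt_dec theta ((/ 2) ^ j)).
      * apply Rmult_le_pos; [apply Rmult_le_pos; [lra|apply pow_le; lra]|lra].
      * apply Rmult_le_pos; [lra|]. left. apply Rinv_0_lt_compat. lra.
    + apply kap_prod; auto. apply d_le.
Qed.

(** A node of group j is displaced by at most 2 * [radius j], relative to lam, so its exponent is a
    (6 d + 6 * 2^-j); over the scales this sums to less than 18 a, independently of J. *)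
Lemma on_block_below (x : R) (i M : nat) (zs : list C) : 0 < x -> 4 * x < lam i ->
  INR M <= C1 * lam i -> length zs = (J * M)%nat -> (forall z, In z zs -> on_target i z) ->
  Rprod (fun p => fac x (fst p) (node (snd p))) (combine zs (on_nodes i M))
    <= exp (x ^ 2 / lam i ^ 2 * (18 * INR M)).
Proof.
  intros Hx0 Hx HM Hlen Hzs.
  assert (L := lam_ge1 i). set (a := x ^ 2 / lam i ^ 2).
  assert (Ha : 0 < a) by (unfold a; apply Rdiv_lt_0_compat; nra).
  assert (D1 := d_le). assert (D2 := half_pow_le 0 J ltac:(lia)). simpl in D2.
  eapply Rle_trans.
  { apply (Rprod_combine_le (fun z n => fac x z (node n))
       (fun n => exp (a * (6 * d + 12 * (1 - node n / lam i))))).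
    - now rewrite on_nodes_length.
    - intros z n Hz Hn. specialize (Hzs z Hz).
      apply in_flat_map in Hn. destruct Hn as [j [Hj Hn]]. apply in_seq in Hj.
      assert (B := group_half i j M n ltac:(lia) HM Hn). assert (Np := node_pos n).
      destruct Hzs as [Hz1 Hz2].
      split.
      + apply fac_ge0; lra.
      + destruct Hz2 as [Hz2|Hz2].
        * apply fac_below; auto; lra.
        * rewrite <- fac_opp. apply fac_below; auto; try lra. rewrite Cmod_opp. lra. }
  unfold on_nodes. rewrite Rprod_flat_map.
  apply Rle_trans with (Rprod (fun j => exp (a * INR M * (6 * d + 6 * (/ 2) ^ j))) (seq 0 J)).
  - apply Rprod_le. intros j Hj. apply in_seq in Hj. split.
    + apply Rprod_ge0. intros n _. left. apply exp_pos.
    + apply Rle_trans with (Rprod (fun _ => exp (a * (6 * d + 6 * (/ 2) ^ j))) (group i j M)).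
      * apply Rprod_le. intros n Hn. split; [left; apply exp_pos|].
        assert (B := group_bounds i j M n ltac:(lia) HM Hn).
        apply exp_le_compat. apply Rmult_le_compat_l; [lra|].
        assert (1 - 2 * radius j <= node n / lam i) by (apply le_div_of_mul_le; lra).
        assert (Er : radius j = (/ 2) ^ j / 4).
        { unfold radius. destruct (le_lt_dec J j); [lia|reflexivity]. }
        rewrite Er in *. lra.
      * rewrite Rprod_exp, Rsum_const, group_length. right. f_equal. ring.
  - rewrite Rprod_exp. apply exp_le_compat. rewrite Rsum_scal.
    replace (a * (18 * INR M)) with (a * INR M * 18) by ring.
    apply Rmult_le_compat_l; [apply Rmult_le_pos; [lra|apply pos_INR]|].
    rewrite Rsum_plus, Rsum_const, Rsum_scal, length_seq.
    assert (G : forall n, Rsum (fun j => (/ 2) ^ j) (seq 0 n) = 2 - 2 * (/ 2) ^ n).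
    { induction n as [|n IH]; [simpl; ring|].
      rewrite seq_S, Rsum_app, IH. simpl. field. }
    rewrite G. assert (P := half_pow_pos J). lra.
Qed.

(** For x >= 2 lam all nodes are at distance at least x / 2, which gives 10 per zero. Otherwise lam
    > x / 2 and 24 * 5 x / (lam / 4) <= 960. *)
Lemma off_block_above (x : R) (i M : nat) (zs : list C) : lam i <= 4 * x -> tau <= 2 * x ->
  (forall n, x <> node n -> tau <= Rabs (x - node n)) ->
  INR M <= C1 * lam i -> length zs = M -> (forall z, In z zs -> lam i <= Cmod z) ->
  Rprod (fun p => fac x (fst p) (node (snd p))) (combine zs (group i J M))
    <= 4 * x / tau * 960 ^ M.
Proof.
  intros Hx Hxt Hxn HM Hlen Hzs.
  assert (L := lam_ge1 i).
  eapply Rle_trans.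
  { apply (Rprod_combine_le (fun z n => fac x z (node n))
       (fun n => 5 * x / Rmax tau (Rabs (x - node n)))).
    - now rewrite group_length.
    - intros z n Hz Hn. specialize (Hzs z Hz).
      assert (B := group_half i J M n ltac:(lia) HM Hn).
      split; [apply fac_ge0; lra|apply fac_crude; auto; lra]. }
  assert (Er : radius J = / 4).
  { unfold radius. destruct (le_lt_dec J J); [reflexivity|lia]. }
  assert (B1 : 1 <= 4 * x / tau) by (apply le_div_of_mul_le; lra).
  destruct (Rle_dec (2 * lam i) x) as [C|C].
  - apply Rle_trans with (10 ^ M).
    + rewrite <- (group_length i J M) at 2. rewrite <- Rprod_const.
      apply Rprod_le. intros n Hn.
      assert (B := group_half i J M n ltac:(lia) HM Hn).
      assert (P : 0 < Rmax tau (Rabs (x - node n))) by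
        (eapply Rlt_le_trans; [apply (proj1 Htau)|apply Rmax_l]).
      split; [apply Rmult_le_pos; [lra|left; now apply Rinv_0_lt_compat]|].
      apply div_le_of_le_mul; [exact P|].
      assert (x / 2 <= Rmax tau (Rabs (x - node n))).
      { eapply Rle_trans; [|apply Rmax_r]. rewrite Rabs_pos_eq; lra. }
      lra.
    + assert (10 ^ M <= 960 ^ M) by (apply pow_incr; lra).
      assert (0 < 960 ^ M) by (apply pow_lt; lra). nra.
  - eapply Rle_trans; [apply group_near; auto; lra|].
    apply Rmult_le_compat_l; [lra|]. apply pow_incr. rewrite Er. split.
    + apply Rmult_le_pos; [lra|]. left. apply Rinv_0_lt_compat. lra.
    + apply div_le_of_le_mul; lra.
Qed.

Lemma off_block_below (x : R) (i M : nat) (zs : list C) : 0 < x -> 4 * x < lam i ->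
  INR M <= C1 * lam i -> length zs = M -> (forall z, In z zs -> lam i <= Cmod z) ->
  Rprod (fun p => fac x (fst p) (node (snd p))) (combine zs (group i J M))
    <= exp (x ^ 2 / lam i ^ 2 * (9 * INR M)).
Proof.
  intros Hx0 Hx HM Hlen Hzs.
  assert (L := lam_ge1 i).
  eapply Rle_trans.
  { apply (Rprod_combine_le (fun z n => fac x z (node n))
       (fun n => exp (x ^ 2 / lam i ^ 2 * 9))).
    - now rewrite group_length.
    - intros z n Hz Hn. specialize (Hzs z Hz).
      assert (B := group_half i J M n ltac:(lia) HM Hn).
      split; [apply fac_ge0; lra|apply fac_below_crude; auto; lra]. }
  rewrite Rprod_exp, Rsum_const, group_length. right. f_equal. ring.
Qed.

(** * Assembling the blocks *)

Section Family.
Variables (M : nat -> nat) (on off : nat -> list C).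
Hypothesis HMon : forall i, INR (M i) <= C1 * lam i.
Hypothesis Hoff_len : forall i, INR (length (off i)) <= C1 * lam i.
Hypothesis Hon_len : forall i, length (on i) = (J * M i)%nat.
Hypothesis Hon : forall i z, In z (on i) -> on_target i z.
Hypothesis Hoff : forall i z, In z (off i) -> lam i <= Cmod z.

Definition block_pairs (i : nat) : list (C * nat) :=
  combine (on i) (on_nodes i (M i)) ++ combine (off i) (group i J (length (off i))).

Definition all_pairs (I : nat) : list (C * nat) := flat_map block_pairs (seq 0 I).

(** Logarithm of the bound for the cost of block i at x, according to whether the block is within
    reach of x or far beyond it. *)
Definition block_exponent (x : R) (i : nat) : R :=
  if Rle_dec (lam i) (4 * x) then
    INR (S J) * ln (4 * x / tau) + ln kap_const * INR (M i) + ln 960 * INR (length (off i))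
  else x ^ 2 / lam i ^ 2 * (18 * INR (M i) + 9 * INR (length (off i))).

Lemma kap_const_pos : 0 < kap_const.
Proof. unfold kap_const. assert (H := exp_pos 3). nra. Qed.

Lemma block_nodes (i : nat) :
  map snd (block_pairs i) = on_nodes i (M i) ++ group i J (length (off i)).
Proof.
  unfold block_pairs. rewrite map_app, !map_snd_combine; auto.
  - now rewrite group_length.
  - now rewrite on_nodes_length.
Qed.

Lemma block_zeros (i : nat) : map fst (block_pairs i) = on i ++ off i.
Proof.
  unfold block_pairs. rewrite map_app, !map_fst_combine; auto.
  - now rewrite group_length.
  - now rewrite on_nodes_length.
Qed.

Lemma block_nodes_In (i n : nat) : In n (map snd (block_pairs i)) ->
  exists j N, (j <= J)%nat /\ INR N <= C1 * lam i /\ In n (group i j N).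
Proof.
  rewrite block_nodes. intros H. apply in_app_or in H. destruct H as [H|H].
  - apply in_flat_map in H. destruct H as [j [Hj H]]. apply in_seq in Hj.
    exists j, (M i). repeat split; auto. lia.
  - exists J, (length (off i)). repeat split; auto.
Qed.

Lemma block_pair_le (i : nat) (p : C * nat) : In p (block_pairs i) ->
  node (snd p) <= Cmod (fst p).
Proof.
  intros H.
  assert (H1 : In (snd p) (map snd (block_pairs i))) by now apply in_map.
  assert (H2 : In (fst p) (map fst (block_pairs i))) by now apply in_map.
  apply block_nodes_In in H1. destruct H1 as [j [N [Hj [HN H1]]]].
  assert (B := group_half _ _ _ _ Hj HN H1).
  rewrite block_zeros in H2. apply in_app_or in H2. destruct H2 as [H2|H2].
  - apply Hon in H2. destruct H2. lra.
  - apply Hoff in H2. lra.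
Qed.

Lemma block_NoDup (i : nat) : NoDup (map snd (block_pairs i)).
Proof.
  rewrite block_nodes. apply NoDup_app.
  - unfold on_nodes. apply NoDup_flat_map; [apply seq_NoDup| |].
    + intros j Hj. apply in_seq in Hj. apply group_NoDup; auto. lia.
    + intros j j' n Hj Hj' H H'. apply in_seq in Hj, Hj'.
      apply (group_disjoint i j (M i) i j' (M i) n); auto; lia.
  - apply group_NoDup; auto.
  - intros n H H'. unfold on_nodes in H. apply in_flat_map in H.
    destruct H as [j [Hj H]]. apply in_seq in Hj.
    destruct (group_disjoint i j (M i) i J (length (off i)) n) as [_ E]; auto; lia.
Qed.

Lemma all_pairs_NoDup (I : nat) : NoDup (map snd (all_pairs I)).
Proof.
  unfold all_pairs. rewrite flat_map_concat_map, concat_map, map_map, <- flat_map_concat_map.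
  apply NoDup_flat_map; [apply seq_NoDup| |].
  - intros i _. apply block_NoDup.
  - intros i i' n _ _ H H'.
    apply block_nodes_In in H, H'.
    destruct H as [j [N [Hj [HN H]]]]. destruct H' as [j' [N' [Hj' [HN' H']]]].
    now destruct (group_disjoint i j N i' j' N' n).
Qed.

(** [modulus] exceeds the number of classes by one, so one residue stays free for nodes to be added
    later. *)
Lemma all_pairs_mod (I : nat) (p : C * nat) : In p (all_pairs I) ->
  (snd p mod modulus < W * S J)%nat.
Proof.
  intros H. unfold all_pairs in H. apply in_flat_map in H. destruct H as [i [_ H]].
  apply (in_map snd) in H. apply block_nodes_In in H.
  destruct H as [j [N [Hj [HN H]]]].
  rewrite (group_mod _ _ _ _ Hj H). now apply class_lt.
Qed.

Lemma all_pairs_le (I : nat) (p : C * nat) : In p (all_pairs I) -> node (snd p) <= Cmod (fst p).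
Proof.
  intros H. unfold all_pairs in H. apply in_flat_map in H. destruct H as [i [_ H]].
  now apply block_pair_le with i.
Qed.

Lemma all_pairs_bound (I n0 : nat) : let x := node n0 in
  Rprod (fun p => fac x (fst p) (node (snd p))) (all_pairs I)
    <= exp (Rsum (block_exponent x) (seq 0 I)).
Proof.
  intros x.
  assert (Hx0 : 0 < x) by apply node_pos.
  assert (Hxt : tau <= 2 * x).
  { unfold x, node. assert (P := pos_INR n0). nra. }
  assert (Hxn : forall n, x <> node n -> tau <= Rabs (x - node n)) by (intros n; apply node_gap).
  assert (Kp := kap_const_pos).
  unfold all_pairs. rewrite Rprod_flat_map, <- Rprod_exp.
  assert (Fp : forall i l l', incl l (on i ++ off i) ->
     0 <= Rprod (fun p => fac x (fst p) (node (snd p))) (combine l l')).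
  { intros i l l' Hl. apply Rprod_ge0. intros [z n] Hp. simpl.
    apply in_combine_l in Hp. apply Hl in Hp. apply fac_ge0; [lra|apply node_pos|].
    assert (L := lam_ge1 i).
    apply in_app_or in Hp. destruct Hp as [Hp|Hp];
      [apply Hon in Hp; destruct Hp|apply Hoff in Hp]; lra. }
  apply Rprod_le. intros i _. unfold block_pairs. rewrite Rprod_app.
  assert (F1 := Fp i (on i) (on_nodes i (M i)) (incl_appl _ (incl_refl _))).
  assert (F2 := Fp i (off i) (group i J (length (off i))) (incl_appr _ (incl_refl _))).
  split; [now apply Rmult_le_pos|].
  assert (Zon := Hon i). assert (Zoff := Hoff i).
  unfold block_exponent. destruct (Rle_dec (lam i) (4 * x)) as [C|C].
  - assert (B1 : 0 < 4 * x / tau) by (apply Rdiv_lt_0_compat; lra).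
    apply Rle_trans with (((4 * x / tau) ^ J * kap_const ^ M i)
                           * (4 * x / tau * 960 ^ length (off i))).
    + apply Rmult_le_compat; auto.
      * apply on_block_above; auto.
      * apply off_block_above; auto.
    + right. rewrite !exp_plus.
      assert (Ep : forall a n, 0 < a -> exp (ln a * INR n) = a ^ n).
      { intros a n Ha. rewrite Rmult_comm. change (Rpower a (INR n) = a ^ n). now apply Rpower_pow. }
      rewrite (Rmult_comm (INR (S J))), !Ep by lra. simpl pow. ring.
  - replace (x ^ 2 / lam i ^ 2 * (18 * INR (M i) + 9 * INR (length (off i)))) with
      (x ^ 2 / lam i ^ 2 * (18 * INR (M i)) + x ^ 2 / lam i ^ 2 * (9 * INR (length (off i)))) by ring.
    rewrite exp_plus. apply Rmult_le_compat; auto.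
    + apply on_block_below; auto; lra.
    + apply off_block_below; auto; lra.
Qed.

End Family.
End Blocks.

(** * Regular pairing of zeros with nodes *)

Definition Rleb (a b : R) : bool := if Rle_dec a b then true else false.

Lemma Rleb_spec (a b : R) : reflect (a <= b) (Rleb a b).
Proof. unfold Rleb. destruct (Rle_dec a b); constructor; auto. Qed.

Definition count_le (l : list C) (r : R) : nat :=
  length (filter (fun z => Rleb (Cmod z) r) l).

Lemma Rsum_filter_split {A : Type} (f : A -> R) (p : A -> bool) (l : list A) :
  Rsum f (filter p l) = Rsum (fun a => if p a then f a else 0) l.
Proof.
  induction l as [|a l IH]; simpl; [reflexivity|].
  destruct (p a); simpl; rewrite IH; lra.
Qed.

(* Dyadic halving: the points of modulus in (y, 2y] contribute at most 2K/y. *)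
Lemma inverse_square_tail (l : list C) (K y : R) : 0 < y -> 0 <= K ->
  (forall r, 0 < r -> INR (count_le l r) <= K * r) ->
  Rsum (fun z => if Rleb (Cmod z) y then 0 else / Cmod z ^ 2) l <= 4 * K / y.
Proof.
  intros Hy HK Hc.
  assert (Hn : exists n : nat, forall z, In z l -> Cmod z <= y * 2 ^ n).
  { induction l as [|z l IH].
    - exists 0%nat. intros ? [].
    - destruct IH as [n Hn].
      { intros r Hr. eapply Rle_trans; [|now apply Hc]. apply le_INR.
        unfold count_le. simpl. destruct (Rleb (Cmod z) r); simpl; lia. }
      destruct (Pow_x_infinity 2 ltac:(rewrite Rabs_pos_eq; lra) (Cmod z / y)) as [m Hm].
      exists (n + m)%nat. intros w [E|Hw].
      + subst w. specialize (Hm (n + m)%nat ltac:(lia)).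
        rewrite Rabs_pos_eq in Hm by (apply pow_le; lra).
        apply Rge_le in Hm. apply Rle_div_l in Hm; [|lra]. lra.
      + specialize (Hn w Hw). rewrite pow_add.
        assert (1 <= 2 ^ m) by (apply pow_R1_Rle; lra).
        assert (0 < 2 ^ n) by (apply pow_lt; lra).
        assert (2 ^ n <= 2 ^ n * 2 ^ m) by nra.
        assert (y * 2 ^ n <= y * (2 ^ n * 2 ^ m)) by (apply Rmult_le_compat_l; lra). lra. }
  destruct Hn as [n Hn]. revert y Hy Hn. induction n as [|n IH]; intros y Hy Hn.
  - rewrite (Rsum_ext _ (fun _ => 0)).
    + rewrite Rsum_const, Rmult_0_r. apply Rmult_le_pos; [lra|left; now apply Rinv_0_lt_compat].
    + intros z Hz. specialize (Hn z Hz). simpl in Hn.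
      destruct (Rleb_spec (Cmod z) y); [reflexivity|lra].
  - assert (I := IH (2 * y) ltac:(lra)).
    apply Rle_trans with (Rsum (fun z => (if Rleb (Cmod z) (2 * y) then 0 else / Cmod z ^ 2)
        + (if Rleb (Cmod z) (2 * y) then / y ^ 2 else 0)) l).
    + apply Rsum_le. intros z _.
      assert (Hy2 : 0 < / y ^ 2) by (apply Rinv_0_lt_compat; nra).
      destruct (Rleb_spec (Cmod z) y), (Rleb_spec (Cmod z) (2 * y)); try lra.
      rewrite Rplus_0_l. apply Rinv_le_contravar; nra.
    + rewrite Rsum_plus, <- Rsum_filter_split, Rsum_const.
      assert (I' := I ltac:(intros z Hz; specialize (Hn z Hz); simpl in Hn; lra)).
      assert (Q := Hc (2 * y) ltac:(lra)). unfold count_le in Q.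
      assert (Hy2 : 0 < / y ^ 2) by (apply Rinv_0_lt_compat; nra).
      assert (Q2 : INR (length (filter (fun z => Rleb (Cmod z) (2 * y)) l)) * / y ^ 2
                   <= K * (2 * y) * / y ^ 2) by (apply Rmult_le_compat_r; lra).
      replace (4 * K / y) with (4 * K / (2 * y) + K * (2 * y) * / y ^ 2) by (field; lra).
      lra.
Qed.

Lemma Rsum_blocks {A : Type} (f : A -> R) (blk : A -> nat) (p : A -> bool) (I : nat) (l : list A) :
  (forall a, In a l -> (blk a < I)%nat) ->
  Rsum (fun i => Rsum f (filter (fun a => (blk a =? i)%nat && p a) l)) (seq 0 I)
  = Rsum f (filter p l).
Proof.
  intros H. rewrite (Rsum_ext _ (fun i => Rsum (fun a => if (blk a =? i)%nat && p a then f a else 0) l))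
    by (intros; apply Rsum_filter_split).
  rewrite Rsum_exchange, Rsum_filter_split. apply Rsum_ext. intros a Ha. specialize (H a Ha).
  assert (G : forall n m, Rsum (fun i => if (blk a =? i)%nat && p a then f a else 0) (seq n m)
     = if (n <=? blk a)%nat && (blk a <? n + m)%nat then (if p a then f a else 0) else 0).
  { intros n m. revert n. induction m as [|m IH]; intros n.
    - simpl. destruct (Nat.leb_spec n (blk a)), (Nat.ltb_spec (blk a) (n + 0)); simpl; lra || lia.
    - simpl. rewrite IH.
      destruct (Nat.eqb_spec (blk a) n), (Nat.leb_spec n (blk a)), (Nat.leb_spec (S n) (blk a)),
        (Nat.ltb_spec (blk a) (S n + m)), (Nat.ltb_spec (blk a) (n + S m)), (p a); simpl;
        try lia; try lra. }
  rewrite G. simpl. destruct (Nat.ltb_spec (blk a) I); [reflexivity|lia].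
Qed.

Lemma count_occ_filter (f : C -> bool) (l : list C) (z : C) : f z = true ->
  count_occ Ceq_dec (filter f l) z = count_occ Ceq_dec l z.
Proof.
  intros H. induction l as [|a l IH]; simpl; [reflexivity|].
  destruct (Ceq_dec a z) as [E|E].
  - subst a. rewrite H. simpl. destruct (Ceq_dec z z); congruence.
  - destruct (f a); simpl; [destruct (Ceq_dec a z)|]; congruence.
Qed.

Lemma count_occ_flat_map {A : Type} (g : A -> list C) (l : list A) (a : A) (z : C) :
  In a l -> (count_occ Ceq_dec (g a) z <= count_occ Ceq_dec (flat_map g l) z)%nat.
Proof.
  induction l as [|b l IH]; simpl; intros H; [easy|].
  rewrite count_occ_app. destruct H as [->|H]; [lia|]. specialize (IH H). lia.
Qed.

Lemma quartic_dominates (a b e : R) : 0 <= a -> 0 <= b -> 0 < e ->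
  exists K, forall v, 0 <= v -> a * v ^ 2 + b * v ^ 3 <= e * v ^ 4 + K.
Proof.
  intros Ha Hb He. set (V := (a + b) / e + 1).
  assert (H0 : 0 <= (a + b) / e) by (apply Rmult_le_pos; [lra|left; now apply Rinv_0_lt_compat]).
  exists ((a + b) * V ^ 3). intros v Hv.
  assert (HV : 1 <= V) by (unfold V; lra).
  destruct (Rle_dec V v) as [C|C].
  - assert (E : a + b <= e * v).
    { assert ((a + b) / e <= v) by (unfold V in C; lra).
      apply Rle_div_l in H; lra. }
    assert (V2 : v ^ 2 <= v ^ 3) by (simpl; nra).
    assert (V3 : 0 <= v ^ 3) by (apply pow_le; lra).
    assert ((a + b) * v ^ 3 <= e * v * v ^ 3) by (apply Rmult_le_compat_r; lra).
    assert (0 <= (a + b) * V ^ 3) by (apply Rmult_le_pos; [lra|apply pow_le; lra]).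
    replace (e * v ^ 4) with (e * v * v ^ 3) by ring. nra.
  - assert (V3 : v ^ 3 <= V ^ 3) by (apply pow_incr; lra).
    assert (V2 : v ^ 2 <= V ^ 3).
    { apply Rle_trans with (V ^ 2); [apply pow_incr; lra|]. simpl. nra. }
    assert (0 <= e * v ^ 4) by (apply Rmult_le_pos; [lra|apply pow_le; lra]).
    nra.
Qed.

Lemma ln_le_self (v : R) : 0 < v -> ln v <= v.
Proof.
  intros Hv. assert (H := exp_ineq1_le (ln v)). rewrite exp_ln in H by lra. lra.
Qed.

(** In terms of v = x^(1/4) the logarithm is at most a constant plus 4 v, so the left side is O (v^2
    + v^3), absorbed by e v^4. This disposes of the overhead of the blocks. *)
Lemma sqrt_log_small (A B t e : R) : 0 <= A -> 0 <= B -> 0 < t -> 0 < e ->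
  exists K, forall x, 0 < x -> (A * ln (t * x) + B) * sqrt x <= e * x + K.
Proof.
  intros HA HB Ht He.
  destruct (quartic_dominates (A * Rabs (ln t) + B) (4 * A) e) as [K HK]; try lra.
  { assert (0 <= A * Rabs (ln t)) by (apply Rmult_le_pos; [lra|apply Rabs_pos]). lra. }
  exists K. intros x Hx. set (v := sqrt (sqrt x)).
  assert (Hs : 0 < sqrt x) by now apply sqrt_lt_R0.
  assert (Hv : 0 < v) by now apply sqrt_lt_R0.
  assert (E1 : sqrt x = v ^ 2) by (unfold v; rewrite pow2_sqrt; lra).
  assert (E2 : x = v ^ 4).
  { replace (v ^ 4) with (v ^ 2 * v ^ 2) by ring. rewrite <- E1, sqrt_sqrt; lra. }
  specialize (HK v ltac:(lra)). rewrite E1, E2.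
  assert (L : ln (t * v ^ 4) <= Rabs (ln t) + 4 * v).
  { rewrite ln_mult, ln_pow by (try apply pow_lt; lra).
    assert (P := Rle_abs (ln t)). assert (Q := ln_le_self v Hv).
    simpl INR. lra. }
  assert (A * ln (t * v ^ 4) <= A * (Rabs (ln t) + 4 * v)) by (apply Rmult_le_compat_l; lra).
  assert (0 < v ^ 2) by nra.
  apply Rle_trans with ((A * (Rabs (ln t) + 4 * v) + B) * v ^ 2); [nra|].
  eapply Rle_trans; [|exact HK]. right. ring.
Qed.

Lemma geometric_le (ph : R) (I : nat) : 1 < ph ->
  Rsum (fun i => / ph ^ i) (seq 0 I) <= ph / (ph - 1).
Proof.
  intros H.
  assert (G : Rsum (fun i => / ph ^ i) (seq 0 I) = ph / (ph - 1) * (1 - / ph ^ I)).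
  { induction I as [|I IH]; [simpl; field; lra|].
    rewrite seq_S, Rsum_app, IH. simpl.
    assert (ph ^ I <> 0) by (apply pow_nonzero; lra). field. repeat split; lra. }
  rewrite G.
  assert (0 < / ph ^ I) by (apply Rinv_0_lt_compat, pow_lt; lra).
  assert (0 < ph / (ph - 1)) by (apply Rdiv_lt_0_compat; lra). nra.
Qed.

(** Both components of the difference are at most |Im z|, because |z| - Re z <= |Im z| when Re z >=
    0. *)
Lemma Cmod_near_modulus (z : C) : 0 <= Re z ->
  Cmod (z - RtoC (Cmod z)) <= 2 * Rabs (Im z).
Proof.
  intros H.
  assert (Hr : 0 <= Cmod z - Re z <= Rabs (Im z)).
  { split.
    - assert (A := Rmax_Cmod z). assert (B := Rmax_l (Rabs (fst z)) (Rabs (snd z))).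
      assert (D := Rle_abs (fst z)). unfold Re. lra.
    - assert (E : Cmod z <= Re z + Rabs (Im z)); [|lra].
      unfold Cmod. apply Rsqr_incr_0_var; [|assert (P := Rabs_pos (Im z)); lra].
      rewrite Rsqr_sqrt by nra. unfold Rsqr.
      assert (P := Rabs_pos (Im z)).
      assert (Q : snd z ^ 2 = Rabs (Im z) * Rabs (Im z)).
      { rewrite <- Rabs_mult. unfold Im. rewrite Rabs_pos_eq; nra. }
      rewrite Q. unfold Re in *. nra. }
  unfold Cmod at 1. apply Rsqr_incr_0_var; [|assert (P := Rabs_pos (Im z)); lra].
  rewrite Rsqr_sqrt by nra. unfold Rsqr.
  replace (fst (z - RtoC (Cmod z))%C) with (- (Cmod z - Re z)) by (unfold Re; simpl; ring).
  replace (snd (z - RtoC (Cmod z))%C) with (Im z) by (unfold Im; simpl; ring).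
  assert (Q : Im z ^ 2 = Rabs (Im z) * Rabs (Im z)).
  { rewrite <- Rabs_mult, Rabs_pos_eq; nra. }
  rewrite Q. nra.
Qed.

Definition nearly_real (delta : R) (z : C) : bool := Rleb (Rabs (Im z)) (delta * Cmod z).

Section RegularPairs.
Variables (J W : nat) (d ph K0 tau eta : R).
Hypothesis HJ : (1 <= J)%nat.
Hypothesis HW : (1 <= W)%nat.
Hypothesis Hd : 0 < d.
Hypothesis HdJ : 2 * INR J * d <= (/ 2) ^ J.
Hypothesis Hph : 1 < ph.
Hypothesis Hphd : ph ^ 2 <= 1 + d / 4.
Hypothesis HqW : 4 <= (ph ^ 2) ^ W.
Hypothesis HK0 : 0 <= K0.
Hypothesis Htau : 0 < tau <= 1.
Let C1 := 2 * K0 + 1.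
Hypothesis Htau2 : 16 * (INR (modulus J W) * tau) * C1 <= (/ 2) ^ J.

Variable l : list C.
Hypothesis Hl1 : forall z, In z l -> 1 <= Cmod z.
Hypothesis Hlc : forall r, 0 < r -> INR (count_le l r) <= K0 * r.
Hypothesis Hloff : Rsum (fun z => / Cmod z)
   (filter (fun z => negb (nearly_real (d / 8) z)) l) <= eta.

Definition blk (z : C) : nat :=
  proj1_sig (nfloor_ex _ (Rmax_l 0 (ln (Cmod z) / ln (ph ^ 2)))).

Let isOn := nearly_real (d / 8).
Let on0 (i : nat) : list C := filter (fun z => (blk z =? i)%nat && isOn z) l.
Let off (i : nat) : list C := filter (fun z => (blk z =? i)%nat && negb (isOn z)) l.
Let M (i : nat) : nat := S (length (on0 i) / J).
(** Padding to a multiple of J permits equal sharing among the scales. Fictitious zeros are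
    harmless: the functional only annihilates more. *)
Let on (i : nat) : list C := on0 i ++ repeat (RtoC (lam ph i)) (J * M i - length (on0 i)).

Lemma d_small : d <= / 4.
Proof.
  assert (H : 1 <= INR J) by (apply (le_INR 1); lia).
  assert (P := half_pow_le 1 J ltac:(lia)). simpl in P. nra.
Qed.

Lemma blk_spec (z : C) : 1 <= Cmod z ->
  lam ph (blk z) <= Cmod z /\ Cmod z <= ph ^ 2 * lam ph (blk z).
Proof.
  intros Hz. unfold blk.
  destruct (nfloor_ex _ (Rmax_l 0 (ln (Cmod z) / ln (ph ^ 2)))) as [k [H1 H2]].
  simpl proj1_sig.
  assert (Hq : 1 < ph ^ 2) by nra.
  assert (Lq : 0 < ln (ph ^ 2)) by (rewrite <- ln_1; apply ln_increasing; lra).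
  assert (Lz : 0 <= ln (Cmod z)) by (rewrite <- ln_1; apply ln_le; lra).
  rewrite Rmax_right in H1, H2 by (apply Rmult_le_pos; [lra|left; now apply Rinv_0_lt_compat]).
  assert (E : forall n, (ph ^ 2) ^ n = exp (INR n * ln (ph ^ 2))).
  { intros n. change (exp (INR n * ln (ph ^ 2))) with (Rpower (ph ^ 2) (INR n)).
    symmetry. apply Rpower_pow. lra. }
  assert (Ez : Cmod z = exp (ln (Cmod z))) by (rewrite exp_ln; lra).
  unfold lam. split.
  - rewrite E, Ez. apply exp_le_compat.
    apply Rmult_le_compat_r with (r := ln (ph ^ 2)) in H1; [|lra].
    replace (ln (Cmod z) / ln (ph ^ 2) * ln (ph ^ 2)) with (ln (Cmod z)) in H1 by (field; lra).
    exact H1.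
  - change (ph ^ 2 * (ph ^ 2) ^ k) with ((ph ^ 2) ^ S k).
    rewrite E, S_INR, Ez. apply exp_le_compat.
    apply Rmult_lt_compat_r with (r := ln (ph ^ 2)) in H2; [|lra].
    replace (ln (Cmod z) / ln (ph ^ 2) * ln (ph ^ 2)) with (ln (Cmod z)) in H2 by (field; lra).
    lra.
Qed.

Lemma blk_double (z : C) : 1 <= Cmod z ->
  lam ph (blk z) <= Cmod z <= 2 * lam ph (blk z).
Proof.
  intros Hz. destruct (blk_spec z Hz) as [A B]. assert (D := d_small).
  assert (P : 0 < lam ph (blk z)) by (unfold lam; apply pow_lt; nra). split; [exact A|]. nra.
Qed.

Lemma block_count (i : nat) (p : C -> bool) :
  INR (length (filter (fun z => (blk z =? i)%nat && p z) l)) <= 2 * K0 * lam ph i.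
Proof.
  assert (P : 0 < lam ph i) by (unfold lam; apply pow_lt; nra).
  eapply Rle_trans; [|apply Rle_trans with (1 := Hlc (2 * lam ph i) ltac:(lra)); right; ring].
  apply le_INR. unfold count_le.
  assert (G : forall l', (forall z, In z l' -> 1 <= Cmod z) ->
     (length (filter (fun z => (blk z =? i)%nat && p z) l')
       <= length (filter (fun z => Rleb (Cmod z) (2 * lam ph i)) l'))%nat).
  { induction l' as [|a l' IH]; simpl; intros H; [lia|].
    assert (IH' := IH (fun z Hz => H z (or_intror Hz))).
    destruct (Nat.eqb_spec (blk a) i) as [E|E].
    - destruct (Rleb_spec (Cmod a) (2 * lam ph i)) as [Q|Q].
      + simpl. destruct (p a); simpl; lia.
      + destruct Q. rewrite <- E. apply blk_double. auto.
    - simpl. destruct (Rleb (Cmod a) (2 * lam ph i)); simpl; lia. }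
  now apply G.
Qed.

Lemma M_le (i : nat) : INR (M i) <= INR (length (on0 i)) / INR J + 1.
Proof.
  unfold M. rewrite S_INR. apply Rplus_le_compat_r.
  assert (HJp : 0 < INR J) by (apply lt_0_INR; lia).
  apply le_div_of_mul_le; [exact HJp|]. rewrite <- mult_INR. apply le_INR.
  rewrite Nat.mul_comm. apply Nat.Div0.mul_div_le.
Qed.

Lemma HMon' (i : nat) : INR (M i) <= C1 * lam ph i.
Proof.
  assert (P := lam_ge1 ph Hph i). assert (B := block_count i isOn). fold (on0 i) in B.
  eapply Rle_trans; [apply M_le|].
  assert (H : 1 <= INR J) by (apply (le_INR 1); lia).
  assert (INR (length (on0 i)) / INR J <= INR (length (on0 i))).
  { apply div_le_of_le_mul; [lra|]. assert (Q := pos_INR (length (on0 i))). nra. }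
  unfold C1. nra.
Qed.

Lemma Hofflen' (i : nat) : INR (length (off i)) <= C1 * lam ph i.
Proof.
  assert (P := lam_ge1 ph Hph i). assert (B : INR (length (off i)) <= 2 * K0 * lam ph i)
    by exact (block_count i (fun z => negb (isOn z))).
  unfold C1. nra.
Qed.

Lemma Honlen' (i : nat) : length (on i) = (J * M i)%nat.
Proof.
  unfold on. rewrite length_app, repeat_length.
  assert (length (on0 i) <= J * M i)%nat; [|lia].
  unfold M. assert (A := Nat.div_mod_eq (length (on0 i)) J).
  assert (B := Nat.mod_upper_bound (length (on0 i)) J ltac:(lia)). lia.
Qed.

(** In the sector of parameter d / 8 the zero, or its negative, is within (d / 4) |z| of its
    modulus, and the modulus within (d / 4) lam of lam. As |z| <= 2 lam, the total is below d
    lam. *)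
Lemma Hon' (i : nat) (z : C) : In z (on i) -> on_target d ph i z.
Proof.
  assert (P := lam_ge1 ph Hph i).
  unfold on. intros H. apply in_app_or in H. destruct H as [H|H].
  - unfold on0 in H. apply filter_In in H. destruct H as [Hz H].
    apply andb_prop in H. destruct H as [H1 H2]. apply Nat.eqb_eq in H1.
    unfold isOn, nearly_real in H2. destruct (Rleb_spec (Rabs (Im z)) (d / 8 * Cmod z)) as [Q|]; [|easy].
    destruct (blk_spec z (Hl1 z Hz)) as [A B]. rewrite H1 in A, B.
    assert (D := d_small).
    split; [exact A|].
    assert (T : forall w, 0 <= Re w -> Cmod w = Cmod z -> Rabs (Im w) = Rabs (Im z) ->
       Cmod (w - RtoC (lam ph i)) <= d * lam ph i).
    { intros w Hw Ew Ei. assert (N := Cmod_near_modulus w Hw).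
      replace (w - RtoC (lam ph i))%C with ((w - RtoC (Cmod w)) + RtoC (Cmod w - lam ph i))%C
        by (rewrite RtoC_minus; ring).
      eapply Rle_trans; [apply Cmod_triangle|].
      rewrite Cmod_R, Rabs_pos_eq by lra. rewrite Ei in N. rewrite Ew in *.
      assert (E1 : Cmod z <= (1 + d / 4) * lam ph i).
      { apply Rle_trans with (1 := B). apply Rmult_le_compat_r; lra. }
      assert (E2 : 0 < d * lam ph i) by nra.
      assert (E3 : d * Cmod z <= 2 * (d * lam ph i)).
      { assert (Cmod z <= 2 * lam ph i) by nra. nra. }
      nra. }
    destruct (Rle_dec 0 (Re z)) as [R|R].
    + left. now apply T.
    + right. apply T.
      * unfold Re in *. simpl. lra.
      * apply Cmod_opp.
      * unfold Im. simpl. apply Rabs_Ropp.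
  - apply repeat_spec in H. subst z. split.
    + rewrite Cmod_R, Rabs_pos_eq; lra.
    + left. replace (RtoC (lam ph i) - RtoC (lam ph i))%C with (RtoC 0) by ring.
      rewrite Cmod_0. nra.
Qed.

Lemma Hoff' (i : nat) (z : C) : In z (off i) -> lam ph i <= Cmod z.
Proof.
  intros H. unfold off in H. apply filter_In in H. destruct H as [Hz H].
  apply andb_prop in H. destruct H as [H1 _]. apply Nat.eqb_eq in H1.
  rewrite <- H1. now apply blk_spec, Hl1.
Qed.

Let c0 := ln kap_const.
Let c2 := ln 960.

Lemma c0_pos : 0 <= c0.
Proof.
  unfold c0. rewrite <- ln_1. apply ln_le; [lra|]. unfold kap_const.
  assert (H := exp_ineq1_le 3). nra.
Qed.

Lemma c2_pos : 0 <= c2.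
Proof. unfold c2. rewrite <- ln_1. apply ln_le; lra. Qed.

(** Logarithmic cost of a zero near the axis before division by J. The ranges overlap since a block
    with lam <= 4 x reaches up to 8 x; 72 = 18 * 4 allows for |z| <= 2 lam. *)
Definition on_weight (x : R) (z : C) : R :=
  c0 * (if Rleb (Cmod z) (8 * x) then 1 else 0)
  + 72 * x ^ 2 * (if Rleb (Cmod z) (4 * x) then 0 else / Cmod z ^ 2).

(** Three costs are separated: an overhead independent of the number of zeros, the zeros near the
    axis with their gain 1 / J, and the zeros off the axis measured by 1 / |z|. The overhead
    includes the rounding up of [M i]. It is multiplied by t = 2 sqrt x / ph^i, where t^2 = 4 x /
    lam: t is at least 1 for blocks within reach and at least x^2 / lam^2 beyond, and it is
    geometric in i, so the overhead sums to O (sqrt x log x). *)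
Lemma block_exponent_le (x : R) (i : nat) : 0 < x -> tau <= 2 * x ->
  block_exponent J ph tau M off x i
  <= (INR (S J) * ln (4 * x / tau) + c0 + 18) * (2 * sqrt x * / ph ^ i)
     + / INR J * Rsum (on_weight x) (on0 i)
     + (8 * c2 + 9) * x * Rsum (fun z => / Cmod z) (off i).
Proof.
  intros Hx Hxt.
  assert (P := lam_ge1 ph Hph i). assert (C0 := c0_pos). assert (C2 := c2_pos).
  assert (HJp : 0 < INR J) by (apply lt_0_INR; lia).
  assert (B1 : 1 <= 4 * x / tau) by (apply le_div_of_mul_le; lra).
  assert (Lp : 0 <= ln (4 * x / tau)) by (rewrite <- ln_1; apply ln_le; lra).
  set (kx := INR (S J) * ln (4 * x / tau) + c0 + 18).
  assert (Hkx : 0 <= INR (S J) * ln (4 * x / tau)) by (apply Rmult_le_pos; [apply pos_INR|lra]).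
  set (t := 2 * sqrt x * / ph ^ i).
  assert (Hs : 0 < sqrt x) by now apply sqrt_lt_R0.
  assert (Hp : 0 < ph ^ i) by (apply pow_lt; lra).
  assert (Ht : 0 < t).
  { unfold t. apply Rmult_lt_0_compat; [lra|now apply Rinv_0_lt_compat]. }
  assert (Elam : lam ph i = ph ^ i * ph ^ i).
  { unfold lam. rewrite <- Rpow_mult_distr. f_equal. ring. }
  assert (Et2 : t * t = 4 * x / lam ph i).
  { unfold t. rewrite Elam.
    replace (2 * sqrt x * / ph ^ i * (2 * sqrt x * / ph ^ i)) with
      (4 * (sqrt x * sqrt x) / (ph ^ i * ph ^ i)) by (field; lra).
    rewrite sqrt_sqrt; lra. }
  assert (HM := M_le i). set (n := INR (length (on0 i))) in *.
  set (m := INR (length (off i))).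
  assert (Hn : 0 <= n) by apply pos_INR. assert (Hm : 0 <= m) by apply pos_INR.
  assert (Hin : forall z, In z (on0 i) \/ In z (off i) -> lam ph i <= Cmod z <= 2 * lam ph i).
  { assert (G : forall q z, In z (filter (fun z => (blk z =? i)%nat && q z) l) ->
        lam ph i <= Cmod z <= 2 * lam ph i).
    { intros q z H. apply filter_In in H. destruct H as [Hz H].
      apply andb_prop in H. destruct H as [H1 _]. apply Nat.eqb_eq in H1.
      rewrite <- H1. now apply blk_double, Hl1. }
    intros z [H|H]; eapply G; exact H. }
  unfold block_exponent. fold c0 c2 m.
  destruct (Rle_dec (lam ph i) (4 * x)) as [Hc|Hc].
  - assert (Ht1 : 1 <= t).
    { assert (1 <= t * t) by (rewrite Et2; apply le_div_of_mul_le; lra). nra. }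
    assert (S1 : c0 * n <= Rsum (on_weight x) (on0 i)).
    { rewrite Rmult_comm. unfold n. rewrite <- Rsum_const. apply Rsum_le. intros z Hz.
      destruct (Hin z (or_introl Hz)) as [Z1 Z2]. unfold on_weight.
      destruct (Rleb_spec (Cmod z) (8 * x)) as [_|N]; [|lra].
      destruct (Rleb_spec (Cmod z) (4 * x)); [lra|].
      assert (0 < / Cmod z ^ 2) by (apply Rinv_0_lt_compat; nra).
      assert (0 <= 72 * x ^ 2 * / Cmod z ^ 2) by (apply Rmult_le_pos; nra). lra. }
    assert (S2 : c2 * m <= 8 * c2 * x * Rsum (fun z => / Cmod z) (off i)).
    { rewrite <- Rsum_scal, Rmult_comm. unfold m. rewrite <- Rsum_const. apply Rsum_le.
      intros z Hz. destruct (Hin z (or_intror Hz)) as [Z1 Z2].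
      apply le_div_of_mul_le; [lra|]. nra. }
    assert (S3 : 0 <= Rsum (fun z => / Cmod z) (off i)).
    { apply Rsum_ge0. intros z Hz. destruct (Hin z (or_intror Hz)) as [Z1 Z2].
      left. apply Rinv_0_lt_compat. lra. }
    assert (S4 : c0 * INR (M i) <= c0 + / INR J * Rsum (on_weight x) (on0 i)).
    { apply Rle_trans with (c0 * (n / INR J + 1)); [apply Rmult_le_compat_l; lra|].
      assert (/ INR J * (c0 * n) <= / INR J * Rsum (on_weight x) (on0 i)).
      { apply Rmult_le_compat_l; [left; now apply Rinv_0_lt_compat|exact S1]. }
      unfold Rdiv. lra. }
    assert (S5 : INR (S J) * ln (4 * x / tau) + c0 <= kx * t) by (unfold kx; nra).
    assert (S6 : 0 <= 9 * x * Rsum (fun z => / Cmod z) (off i)) by (apply Rmult_le_pos; lra).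
    lra.
  - assert (Hc' : 4 * x < lam ph i) by lra.
    set (a := x ^ 2 / lam ph i ^ 2).
    assert (Ha : 0 < a) by (unfold a; apply Rdiv_lt_0_compat; nra).
    assert (Ea : a = (t * t) * (t * t) / 16) by (rewrite Et2; unfold a; field; lra).
    assert (Ht1 : t * t <= 1) by (rewrite Et2; apply div_le_of_le_mul; lra).
    assert (Ht2 : t <= 1) by nra.
    assert (Hat : a <= t).
    { rewrite Ea. assert ((t * t) * (t * t) <= t * t) by nra. nra. }
    assert (S1 : 18 * a * n <= Rsum (on_weight x) (on0 i)).
    { rewrite Rmult_comm. unfold n. rewrite <- Rsum_const. apply Rsum_le. intros z Hz.
      destruct (Hin z (or_introl Hz)) as [Z1 Z2]. unfold on_weight.
      destruct (Rleb_spec (Cmod z) (4 * x)) as [N|_]; [lra|].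
      assert (0 <= c0 * (if Rleb (Cmod z) (8 * x) then 1 else 0)).
      { apply Rmult_le_pos; [lra|]. destruct (Rleb (Cmod z) (8 * x)); lra. }
      assert (Q : a * 4 <= 16 * (x ^ 2 * / Cmod z ^ 2)).
      { unfold a. replace (x ^ 2 / lam ph i ^ 2 * 4) with (x ^ 2 * (16 * / (2 * lam ph i) ^ 2)) by (field; lra).
        replace (16 * (x ^ 2 * / Cmod z ^ 2)) with (x ^ 2 * (16 * / Cmod z ^ 2)) by ring.
        apply Rmult_le_compat_l; [nra|]. apply Rmult_le_compat_l; [lra|].
        apply Rinv_le_contravar; [nra|]. apply pow_incr. lra. }
      lra. }
    assert (S2 : 9 * a * m <= 9 * x * Rsum (fun z => / Cmod z) (off i)).
    { rewrite <- Rsum_scal, Rmult_comm. unfold m. rewrite <- Rsum_const. apply Rsum_le.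
      intros z Hz. destruct (Hin z (or_intror Hz)) as [Z1 Z2].
      apply le_div_of_mul_le; [lra|].
      apply Rle_trans with (9 * a * (2 * lam ph i)); [apply Rmult_le_compat_l; lra|].
      unfold a. replace (9 * (x ^ 2 / lam ph i ^ 2) * (2 * lam ph i)) with
        (18 * x * (x / lam ph i)) by (field; lra).
      assert (x / lam ph i <= / 4) by (apply div_le_of_le_mul; lra). nra. }
    assert (S3 : 0 <= Rsum (fun z => / Cmod z) (off i)).
    { apply Rsum_ge0. intros z Hz. destruct (Hin z (or_intror Hz)) as [Z1 Z2].
      left. apply Rinv_0_lt_compat. lra. }
    assert (S4 : 18 * a * INR (M i) <= 18 * a + / INR J * Rsum (on_weight x) (on0 i)).
    { apply Rle_trans with (18 * a * (n / INR J + 1)); [apply Rmult_le_compat_l; lra|].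
      assert (/ INR J * (18 * a * n) <= / INR J * Rsum (on_weight x) (on0 i)).
      { apply Rmult_le_compat_l; [left; now apply Rinv_0_lt_compat|exact S1]. }
      unfold Rdiv. lra. }
    assert (S5 : 18 * a <= kx * t) by (unfold kx; nra).
    assert (S6 : 0 <= 8 * c2 * x * Rsum (fun z => / Cmod z) (off i)).
    { apply Rmult_le_pos; [|exact S3]. apply Rmult_le_pos; lra. }
    lra.
Qed.

(** The density bound counts the zeros below 8 x, and [inverse_square_tail] handles those above 4 x:
    the total is linear in x with a factor proportional to the density. *)
Lemma on_weight_sum (x : R) : 0 < x ->
  Rsum (on_weight x) (filter isOn l) <= (8 * c0 + 72) * K0 * x.
Proof.
  intros Hx. assert (C0 := c0_pos).
  eapply Rle_trans.
  { apply Rsum_filter_le. intros z Hz. assert (Z := Hl1 z Hz). unfold on_weight.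
    assert (0 < / Cmod z ^ 2) by (apply Rinv_0_lt_compat; nra).
    assert (0 < x ^ 2) by nra.
    destruct (Rleb (Cmod z) (8 * x)), (Rleb (Cmod z) (4 * x)); nra. }
  unfold on_weight. rewrite Rsum_plus, !Rsum_scal.
  assert (A := Hlc (8 * x) ltac:(lra)).
  assert (B := inverse_square_tail l K0 (4 * x) ltac:(lra) HK0 Hlc).
  rewrite <- Rsum_filter_split, Rsum_const. unfold count_le in A.
  assert (c0 * (INR (length (filter (fun z => Rleb (Cmod z) (8 * x)) l)) * 1) <= c0 * (K0 * (8 * x)))
    by (apply Rmult_le_compat_l; lra).
  assert (72 * x ^ 2 * Rsum (fun z => if Rleb (Cmod z) (4 * x) then 0 else / Cmod z ^ 2) l
     <= 72 * x ^ 2 * (4 * K0 / (4 * x))) by (apply Rmult_le_compat_l; [nra|exact B]).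
  replace (72 * x ^ 2 * (4 * K0 / (4 * x))) with (72 * K0 * x) in H0 by (field; lra).
  lra.
Qed.

Definition num_blocks : nat := S (list_max (map blk l)).

Lemma blk_lt (z : C) : In z l -> (blk z < num_blocks)%nat.
Proof.
  intros H. unfold num_blocks.
  assert (A := proj1 (list_max_le (map blk l) (list_max (map blk l))) (le_n _)).
  rewrite Forall_forall in A. specialize (A (blk z) (in_map blk _ _ H)). lia.
Qed.

Lemma regular_pairs_section : exists pr : list (C * nat),
  (forall z, (count_occ Ceq_dec l z <= count_occ Ceq_dec (map fst pr) z)%nat) /\
  NoDup (map snd pr) /\
  (forall p, In p pr -> (snd p mod modulus J W < W * S J)%nat) /\
  (forall p, In p pr -> node tau (snd p) <= Cmod (fst p)) /\
  (forall n0, let x := node tau n0 in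
     Rprod (fun p => fac x (fst p) (node tau (snd p))) pr
     <= exp ((INR (S J) * ln (4 * x / tau) + c0 + 18) * (2 * sqrt x * (ph / (ph - 1)))
             + / INR J * ((8 * c0 + 72) * K0 * x) + (8 * c2 + 9) * x * eta)).
Proof.
  assert (HC1 : 1 <= C1) by (unfold C1; lra).
  exists (all_pairs J W ph tau M on off num_blocks). repeat split.
  - intros z. destruct (in_dec Ceq_dec z l) as [Hz|Hz].
    2:{ apply (count_occ_not_In Ceq_dec) in Hz. rewrite Hz. lia. }
    unfold all_pairs. rewrite flat_map_concat_map, concat_map, map_map, <- flat_map_concat_map.
    eapply Nat.le_trans; [|apply (count_occ_flat_map _ _ (blk z))].
    2:{ apply in_seq. assert (B := blk_lt z Hz). lia. }
    cbv beta. rewrite block_zeros by apply Honlen'.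
    rewrite count_occ_app. unfold on. rewrite count_occ_app.
    destruct (isOn z) eqn:E.
    + assert (A : count_occ Ceq_dec (on0 (blk z)) z = count_occ Ceq_dec l z).
      { apply count_occ_filter. now rewrite Nat.eqb_refl, E. }
      lia.
    + assert (A : count_occ Ceq_dec (off (blk z)) z = count_occ Ceq_dec l z).
      { apply count_occ_filter. now rewrite Nat.eqb_refl, E. }
      lia.
  - eapply (all_pairs_NoDup J W ph C1 tau HJ HW Hph HqW HC1 Htau Htau2); eauto using HMon', Hofflen', Honlen', Hon', Hoff'.
  - intros p Hp.
    eapply (all_pairs_mod J W ph C1 tau HJ HW); eauto using HMon', Hofflen', Honlen', Hon', Hoff'.
  - intros p Hp.
    eapply (all_pairs_le J W d ph C1 tau HJ HW Hph HC1 Htau Htau2); eauto using HMon', Hofflen', Honlen', Hon', Hoff'.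
  - intros n0 x.
    eapply Rle_trans.
    { eapply (all_pairs_bound J W d ph C1 tau); eauto using HMon', Hofflen', Honlen', Hon', Hoff'. }
    fold x. apply exp_le_compat.
    assert (Hx : 0 < x) by (unfold x, node; assert (P := pos_INR n0); nra).
    assert (Hxt : tau <= 2 * x) by (unfold x, node; assert (P := pos_INR n0); nra).
    assert (C0 := c0_pos). assert (C2 := c2_pos).
    assert (B1 : 1 <= 4 * x / tau) by (apply le_div_of_mul_le; lra).
    assert (Lp : 0 <= ln (4 * x / tau)) by (rewrite <- ln_1; apply ln_le; lra).
    assert (Hkx : 0 <= INR (S J) * ln (4 * x / tau)) by (apply Rmult_le_pos; [apply pos_INR|lra]).
    assert (Hs : 0 < sqrt x) by now apply sqrt_lt_R0.
    eapply Rle_trans; [apply Rsum_le; intros i _; apply (block_exponent_le x i Hx Hxt)|].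
    rewrite !Rsum_plus, !Rsum_scal.
    apply Rplus_le_compat; [apply Rplus_le_compat|].
    + apply Rmult_le_compat_l; [lra|].
      apply Rmult_le_compat_l; [lra|]. now apply geometric_le.
    + apply Rmult_le_compat_l.
      { left. apply Rinv_0_lt_compat, lt_0_INR. lia. }
      unfold on0. rewrite (Rsum_blocks (on_weight x) blk isOn) by apply blk_lt.
      now apply on_weight_sum.
    + apply Rmult_le_compat_l; [apply Rmult_le_pos; lra|].
      unfold off. rewrite (Rsum_blocks _ blk (fun z => negb (isOn z))) by apply blk_lt.
      exact Hloff.
Qed.

End RegularPairs.

(** All parameters depend on K0 and e only, not on the list; the final contradiction lives on this
    uniformity. Each of the three costs in [block_exponent_le] receives a third of e x, up to a
    constant. *)
Lemma regular_pairs (K0 e : R) : 0 <= K0 -> 0 < e ->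
  exists (delta eta tau K : R) (G w : nat),
  0 < delta /\ 0 < eta /\ 0 < tau <= 1 /\ 0 < K /\ (w < G)%nat /\
  forall l : list C, (forall z, In z l -> 1 <= Cmod z) ->
  (forall r, 0 < r -> INR (count_le l r) <= K0 * r) ->
  Rsum (fun z => / Cmod z) (filter (fun z => negb (nearly_real delta z)) l) <= eta ->
  exists pr : list (C * nat),
  (forall z, (count_occ Ceq_dec l z <= count_occ Ceq_dec (map fst pr) z)%nat) /\
  NoDup (map snd pr) /\
  (forall p, In p pr -> (snd p mod G < w)%nat) /\
  (forall p, In p pr -> node tau (snd p) <= Cmod (fst p)) /\
  (forall n0, Rprod (fun p => fac (node tau n0) (fst p) (node tau (snd p))) pr
     <= K * exp (e * node tau n0)).
Proof.
  intros HK0 He.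
  set (c0 := ln kap_const). set (c2 := ln 960).
  assert (C0 : 0 <= c0) by apply c0_pos. assert (C2 : 0 <= c2) by apply c2_pos.
  set (A := (8 * c0 + 72) * K0).
  assert (HA : 0 <= A) by (unfold A; apply Rmult_le_pos; lra).
  (* J is chosen so that the zeros near the axis cost at most e x / 3. *)
  destruct (nfloor_ex (3 * A / e)) as [J0 [_ HJ0]].
  { apply Rmult_le_pos; [lra|left; now apply Rinv_0_lt_compat]. }
  set (J := S J0).
  assert (HJ1 : (1 <= J)%nat) by (unfold J; lia).
  assert (HJp : 1 <= INR J) by (apply (le_INR 1); lia).
  assert (HJA : / INR J * A <= e / 3).
  { rewrite Rmult_comm. apply div_le_of_le_mul; [lra|].
    assert (3 * A / e <= INR J) by (unfold J; rewrite S_INR; lra).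
    apply Rle_div_l in H; [|lra]. lra. }
  (* The cluster width that [kap_prod] tolerates. *)
  set (d := (/ 2) ^ J / (2 * INR J)).
  assert (HP := half_pow_pos J).
  assert (Hd : 0 < d) by (unfold d; apply Rdiv_lt_0_compat; lra).
  assert (HdJ : 2 * INR J * d <= (/ 2) ^ J) by (unfold d; right; field; lra).
  assert (Hd4 : d <= / 4) by (eapply (d_small J); eauto).
  (* Blocks of relative width at most d / 4 look like a single point at the scale d. *)
  set (ph := 1 + d / 16).
  assert (Hph : 1 < ph) by (unfold ph; lra).
  assert (Hphd : ph ^ 2 <= 1 + d / 4) by (unfold ph; nra).
  assert (Hq : 1 < ph ^ 2) by nra.
  destruct (Pow_x_infinity (ph ^ 2) ltac:(rewrite Rabs_pos_eq; lra) 4) as [W0 HW0].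
  set (W := S W0).
  assert (HqW : 4 <= (ph ^ 2) ^ W).
  { specialize (HW0 W ltac:(unfold W; lia)).
    rewrite Rabs_pos_eq in HW0 by (apply pow_le; lra). lra. }
  set (G := modulus J W).
  assert (HG : 1 <= INR G) by (unfold G; apply modulus_ge1; [exact HJ1|unfold W; lia]).
  set (C1 := 2 * K0 + 1).
  (* Nodes dense enough that rounding within one residue class stays small against the spacing of
     every group. *)
  set (tau := (/ 2) ^ J / (16 * INR G * C1)).
  assert (HC1 : 1 <= C1) by (unfold C1; lra).
  assert (HGC : 1 <= INR G * C1) by nra.
  assert (Htau : 0 < tau) by (unfold tau; apply Rdiv_lt_0_compat; nra).
  assert (Htau2 : 16 * (INR G * tau) * C1 <= (/ 2) ^ J) by (unfold tau; right; field; lra).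
  assert (Htau1 : tau <= 1).
  { assert (H1 := half_pow_le 0 J ltac:(lia)). rewrite pow_O in H1.
    unfold tau. apply div_le_of_le_mul; nra. }
  set (eta := e / (3 * (8 * c2 + 9))).
  assert (Heta : 0 < eta) by (unfold eta; apply Rdiv_lt_0_compat; lra).
  destruct (sqrt_log_small (INR (S J) * (2 * (ph / (ph - 1)))) ((c0 + 18) * (2 * (ph / (ph - 1))))
     (4 / tau) (e / 3)) as [K HK]; try lra.
  { apply Rmult_le_pos; [apply pos_INR|]. apply Rmult_le_pos; [lra|].
    apply Rmult_le_pos; [lra|left; apply Rinv_0_lt_compat; lra]. }
  { apply Rmult_le_pos; [lra|]. apply Rmult_le_pos; [lra|].
    apply Rmult_le_pos; [lra|left; apply Rinv_0_lt_compat; lra]. }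
  { apply Rdiv_lt_0_compat; lra. }
  exists (d / 8), eta, tau, (exp K), G, (W * S J)%nat.
  split; [lra|]. split; [exact Heta|]. split; [lra|]. split; [apply exp_pos|].
  split; [unfold G, modulus; lia|].
  intros l Hl1 Hlc Hloff.
  destruct (regular_pairs_section J W d ph K0 tau eta HJ1 ltac:(unfold W; lia) Hd HdJ Hph Hphd HqW HK0
     (conj Htau Htau1) Htau2 l Hl1 Hlc Hloff) as [pr [P1 [P2 [P3 [P4 P5]]]]].
  exists pr. repeat (split; [assumption|]).
  intros n0. eapply Rle_trans; [apply P5|]. fold c0 c2 A.
  set (x := node tau n0).
  assert (Hx : 0 < x) by (unfold x, node; assert (P := pos_INR n0); nra).
  rewrite <- exp_plus. apply exp_le_compat.
  specialize (HK x Hx).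
  replace (4 / tau * x) with (4 * x / tau) in HK by (field; lra).
  assert (E1 : / INR J * (A * x) <= e / 3 * x).
  { rewrite <- Rmult_assoc. apply Rmult_le_compat_r; lra. }
  assert (E2 : (8 * c2 + 9) * x * eta = e / 3 * x) by (unfold eta; field; lra).
  rewrite E2.
  set (pp := ph / (ph - 1)) in *.
  replace ((INR (S J) * ln (4 * x / tau) + c0 + 18) * (2 * sqrt x * pp)) with
    ((INR (S J) * (2 * pp) * ln (4 * x / tau) + (c0 + 18) * (2 * pp)) * sqrt x) by ring.
  lra.
Qed.

(** * The weights *)

Lemma count_occ_extract (l : list C) (a : C) (k : nat) : (k <= count_occ Ceq_dec l a)%nat ->
  exists rest, Permutation l (repeat a k ++ rest)
    /\ (count_occ Ceq_dec l a = k + count_occ Ceq_dec rest a)%nat.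
Proof.
  induction k as [|k IH]; intros H; [exists l; auto|].
  destruct IH as [rest [P E]]; [lia|].
  assert (Hin : In a rest) by (apply (count_occ_In Ceq_dec); lia).
  apply in_split in Hin. destruct Hin as [r1 [r2 ->]].
  exists (r1 ++ r2). split.
  - rewrite P. simpl. rewrite <- Permutation_middle. rewrite !app_assoc.
    symmetry. rewrite <- !app_assoc. apply Permutation_middle.
  - rewrite E, !count_occ_app. simpl. destruct (Ceq_dec a a); [lia|congruence].
Qed.

Lemma Rsum_incl (f : nat -> R) (l l' : list nat) : (forall n, 0 <= f n) ->
  NoDup l -> incl l l' -> Rsum f l <= Rsum f l'.
Proof.
  intros Hf. revert l'. induction l as [|a l IH]; intros l' ND Hi.
  - apply Rsum_ge0. auto.
  - inversion ND as [|? ? Ha ND']; subst.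
    assert (Hin := Hi a (or_introl eq_refl)). apply in_split in Hin.
    destruct Hin as [l1 [l2 ->]].
    rewrite Rsum_app. simpl.
    assert (I : Rsum f l <= Rsum f (l1 ++ l2)).
    { apply IH; auto. intros b Hb.
      assert (Hb' := Hi b (or_intror Hb)). apply in_app_or in Hb'.
      apply in_or_app. destruct Hb' as [|[E|]]; auto. subst b. contradiction. }
    rewrite Rsum_app in I. lra.
Qed.

Lemma Rsum_pow_NoDup (q : R) (l : list nat) : 0 < q < 1 -> NoDup l ->
  Rsum (fun n => q ^ n) l <= / (1 - q).
Proof.
  intros Hq ND.
  apply Rle_trans with (Rsum (fun n => q ^ n) (seq 0 (S (list_max l)))).
  - apply Rsum_incl; auto.
    + intros n. apply pow_le. lra.
    + intros n Hn. apply in_seq.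
      assert (A := proj1 (list_max_le l (list_max l)) (le_n _)).
      rewrite Forall_forall in A. specialize (A n Hn). lia.
  - generalize (S (list_max l)) as N. intros N.
    assert (G : Rsum (fun n => q ^ n) (seq 0 N) = / (1 - q) * (1 - q ^ N)).
    { induction N as [|N IH]; [simpl; ring|].
      rewrite seq_S, Rsum_app, IH. simpl. field. lra. }
    rewrite G. assert (0 < q ^ N) by (apply pow_lt; lra).
    assert (0 < / (1 - q)) by (apply Rinv_0_lt_compat; lra). nra.
Qed.

(** A polynomial grows more slowly than any exponential; each factor takes half of the remaining
    rate. *)
Lemma affine_prod_exp (l : list C) (e : R) : 0 < e ->
  exists K, 0 <= K /\ forall s, 0 <= s -> Rprod (fun a => s + Cmod a) l <= K * exp (e * s).
Proof.
  revert e. induction l as [|a l IH]; intros e He.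
  - exists 1. split; [lra|]. intros s Hs. simpl.
    assert (H := exp_ineq1_le (e * s)). assert (0 <= e * s) by nra. lra.
  - destruct (IH (e / 2) ltac:(lra)) as [K [HK H]].
    assert (Ha := Cmod_ge_0 a).
    assert (H2e : 0 < 2 / e) by (apply Rdiv_lt_0_compat; lra).
    exists ((2 / e + Cmod a) * K). split; [apply Rmult_le_pos; lra|].
    intros s Hs. simpl. specialize (H s Hs).
    assert (E1 := exp_ineq1_le (e / 2 * s)).
    assert (E2 : s + Cmod a <= (2 / e + Cmod a) * exp (e / 2 * s)).
    { assert (s <= 2 / e * exp (e / 2 * s)).
      { apply Rle_trans with (2 / e * (e / 2 * s)); [right; field; lra|].
        apply Rmult_le_compat_l; lra. }
      assert (0 <= e / 2 * s) by nra. nra. }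
    replace (exp (e * s)) with (exp (e / 2 * s) * exp (e / 2 * s))
      by (rewrite <- exp_plus; f_equal; field).
    replace ((2 / e + Cmod a) * K * (exp (e / 2 * s) * exp (e / 2 * s))) with
      (((2 / e + Cmod a) * exp (e / 2 * s)) * (K * exp (e / 2 * s))) by ring.
    apply Rmult_le_compat; auto; [lra|].
    apply Rprod_ge0. intros b _. assert (Hb := Cmod_ge_0 b). lra.
Qed.

(** One quadratic denominator absorbs each factor |y| + |a| up to a constant, and the one left over
    supplies the decay. *)
Lemma imaginary_axis_decay (l : list C) (ts : list R) : length ts = S (length l) ->
  (forall t, In t ts -> 0 < t) ->
  exists K, 0 <= K /\ forall y,
    Rprod (fun a => Rabs y + Cmod a) l * Rprod (fun t => / (y ^ 2 + t ^ 2)) ts <= K / (1 + y ^ 2).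
Proof.
  revert ts. induction l as [|a l IH]; intros ts Hl Ht.
  - destruct ts as [|t [|? ?]]; try discriminate. exists (1 + / t ^ 2).
    assert (Htp := Ht t (or_introl eq_refl)).
    assert (Ht2 : 0 < t ^ 2) by nra.
    assert (Hi : 0 < / t ^ 2) by now apply Rinv_0_lt_compat.
    split; [lra|]. intros y. simpl Rprod. rewrite Rmult_1_l, Rmult_1_r.
    apply le_div_of_mul_le; [nra|]. rewrite Rmult_comm. apply div_le_of_le_mul; [nra|].
    assert (E : / t ^ 2 * t ^ 2 = 1) by (field; lra).
    assert (0 <= y ^ 2) by nra. assert (0 <= y ^ 2 * / t ^ 2) by nra. nra.
  - destruct ts as [|t ts]; [discriminate|].
    destruct (IH ts) as [K [HK H]]; [simpl in Hl; congruence|intros; apply Ht; now right|].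
    assert (Htp := Ht t (or_introl eq_refl)).
    assert (Ht2 : 0 < t ^ 2) by nra.
    assert (Hi : 0 < / t ^ 2) by now apply Rinv_0_lt_compat.
    assert (Ha := Cmod_ge_0 a).
    exists ((1 + (1 + Cmod a) * / t ^ 2) * K).
    split; [apply Rmult_le_pos; nra|]. intros y. specialize (H y). rewrite !Rprod_cons.
    set (P := Rprod (fun a => Rabs y + Cmod a) l) in *.
    set (Q := Rprod (fun t => / (y ^ 2 + t ^ 2)) ts) in *.
    assert (HPQ : 0 <= P * Q).
    { apply Rmult_le_pos; apply Rprod_ge0.
      - intros b _. assert (Hb := Cmod_ge_0 b). assert (Hy := Rabs_pos y). lra.
      - intros u Hu. left. apply Rinv_0_lt_compat.
        assert (Hu' := Ht u (or_intror Hu)). nra. }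
    replace ((Rabs y + Cmod a) * P * (/ (y ^ 2 + t ^ 2) * Q)) with
      ((Rabs y + Cmod a) / (y ^ 2 + t ^ 2) * (P * Q)) by (unfold Rdiv; ring).
    replace ((1 + (1 + Cmod a) * / t ^ 2) * K / (1 + y ^ 2)) with
      ((1 + (1 + Cmod a) * / t ^ 2) * (K / (1 + y ^ 2))) by (unfold Rdiv; ring).
    apply Rmult_le_compat; auto.
    + apply Rmult_le_pos; [assert (Hy := Rabs_pos y); lra|].
      left. apply Rinv_0_lt_compat. nra.
    + apply div_le_of_le_mul; [nra|].
      assert (Y : Rabs y <= 1 + y ^ 2).
      { rewrite <- (pow2_abs y). assert (Hy := Rabs_pos y). nra. }
      assert (E : / t ^ 2 * t ^ 2 = 1) by (field; lra).
      assert (0 <= y ^ 2) by nra.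
      assert (0 <= (1 + Cmod a) * / t ^ 2 * y ^ 2) by (apply Rmult_le_pos; [apply Rmult_le_pos|]; lra).
      replace ((1 + (1 + Cmod a) * / t ^ 2) * (y ^ 2 + t ^ 2)) with
        (y ^ 2 + t ^ 2 + (1 + Cmod a) * / t ^ 2 * y ^ 2 + (1 + Cmod a) * (/ t ^ 2 * t ^ 2)) by ring.
      rewrite E. lra.
Qed.

Lemma posexp_energy_app (l1 l2 : list (R * R)) (x : R) :
  (forall p, In p l2 -> snd p <= 0) ->
  posexp_energy (l1 ++ l2) x = posexp_energy l1 x.
Proof.
  intros H. unfold posexp_energy, quadform. rewrite Rsum_app.
  replace (Rsum _ l2) with 0.
  2:{ rewrite (Rsum_ext _ (fun _ => 0)); [rewrite Rsum_const; ring|].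
      intros p Hp. rewrite (Rsum_ext _ (fun _ => 0)); [rewrite Rsum_const; ring|].
      intros q _. unfold poskernel. specialize (H p Hp).
      destruct (Rlt_dec 0 (snd p)); [lra|ring]. }
  rewrite Rplus_0_r. apply Rsum_ext. intros p _. rewrite Rsum_app.
  replace (Rsum _ l2) with 0; [ring|].
  rewrite (Rsum_ext _ (fun _ => 0)); [rewrite Rsum_const; ring|].
  intros q Hq. unfold poskernel. specialize (H q Hq).
  destruct (Rlt_dec 0 (snd p)), (Rlt_dec 0 (snd q)); try lra; ring.
Qed.

Definition half (e : R) (sl : list R) : list C := map (fun s => RtoC (e * s)) sl.
Definition both (sl : list R) : list C := half 1 sl ++ half (-1) sl.

Lemma Cprod_both (f : C -> C) (sl : list R) :
  Cprod f (both sl) = Cprod (fun s => f (RtoC s) * f (- RtoC s))%C sl.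
Proof.
  unfold both, half. induction sl as [|s sl IH]; simpl; [ring|].
  rewrite Cprod_app in *. simpl.
  rewrite <- IH.
  replace (RtoC (1 * s)) with (RtoC s) by (f_equal; ring).
  replace (RtoC (-1 * s)) with (- RtoC s)%C by (rewrite <- RtoC_opp; f_equal; ring).
  ring.
Qed.

Lemma in_both (sl : list R) (z : C) : In z (both sl) ->
  exists s, In s sl /\ (z = RtoC (1 * s) \/ z = RtoC (-1 * s)).
Proof.
  unfold both, half. intros H. apply in_app_or in H.
  destruct H as [H|H]; apply in_map_iff in H; destruct H as [s [E H]]; exists s; auto.
Qed.

Lemma both_NoDup (sl : list R) : NoDup sl -> (forall s, In s sl -> 0 < s) -> NoDup (both sl).
Proof.
  intros ND H. unfold both, half. apply NoDup_app.
  - apply FinFun.Injective_map_NoDup; auto. intros a b E. apply RtoC_inj in E. lra.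
  - apply FinFun.Injective_map_NoDup; auto. intros a b E. apply RtoC_inj in E. lra.
  - intros z H1 H2. apply in_map_iff in H1, H2.
    destruct H1 as [s [E1 H1]]. destruct H2 as [t [E2 H2]].
    rewrite <- E2 in E1. apply RtoC_inj in E1.
    specialize (H s H1) as Hs. specialize (H t H2). lra.
Qed.

Lemma both_length (sl : list R) : length (both sl) = (2 * length sl)%nat.
Proof. unfold both, half. rewrite length_app, !length_map. lia. Qed.

Lemma Cmod_dprod_both (e s : R) (sl : list R) : e = 1 \/ e = -1 -> 0 < s ->
  (forall t, In t sl -> 0 < t) ->
  Cmod (dprod (both sl) (RtoC (e * s)))
  = Rprod (fun t => (if Req_EM_T s t then 1 else Rabs (s - t)) * (s + t)) sl.
Proof.
  intros He Hs Ht. unfold dprod. rewrite Cprod_both, Cmod_Cprod. apply Rprod_ext.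
  intros t Hin. specialize (Ht t Hin). rewrite Cmod_mult, <- !RtoC_opp.
  assert (D : forall u v : R, Cmod (if Ceq_dec (RtoC u) (RtoC v) then RtoC 1 else (RtoC v - RtoC u)%C)
      = if Req_EM_T v u then 1 else Rabs (v - u)).
  { intros u v. destruct (Ceq_dec (RtoC u) (RtoC v)) as [E|E], (Req_EM_T v u) as [F|F].
    - apply Cmod_1.
    - apply RtoC_inj in E. congruence.
    - congruence.
    - rewrite <- RtoC_minus. apply Cmod_R. }
  rewrite !D. destruct He as [-> | ->].
  - rewrite Rmult_1_l. destruct (Req_EM_T s (- t)); [lra|].
    rewrite (Rabs_pos_eq (s - - t)) by lra.
    destruct (Req_EM_T s t); ring.
  - destruct (Req_EM_T (-1 * s) t); [lra|].
    replace (Rabs (-1 * s - t)) with (s + t) by (rewrite Rabs_left; lra).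
    destruct (Req_EM_T (-1 * s) (- t)), (Req_EM_T s t); try lra.
    replace (-1 * s - - t) with (- (s - t)) by ring. rewrite Rabs_Ropp. ring.
Qed.

Lemma functional_scal (T : R) (c : C) (w : C -> C) (Phi : C -> C -> C) (sg : list C) :
  functional T (fun s => c * w s)%C Phi sg = (c * functional T w Phi sg)%C.
Proof.
  unfold functional. rewrite <- Csum_scal. apply Csum_ext. intros s _. ring.
Qed.

Lemma functional_ext (T : R) (w w' : C -> C) (Phi Phi' : C -> C -> C) (sg : list C) :
  (forall s, In s sg -> w s = w' s) -> (forall s z, Phi s z = Phi' s z) ->
  functional T w Phi sg = functional T w' Phi' sg.
Proof.
  intros H1 H2. apply Csum_ext. intros s Hs. now rewrite H1, !H2.
Qed.

Lemma functional_linear (T : R) (c : C) (w : C -> C) (Phi Psi : C -> C -> C) (sg : list C) :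
  functional T w (fun s z => c * Phi s z + Psi s z)%C sg
  = (c * functional T w Phi sg + functional T w Psi sg)%C.
Proof.
  unfold functional. rewrite <- Csum_scal, <- Csum_plus. apply Csum_ext. intros s _. ring.
Qed.

(** * The rational function of a pairing and its bounds *)

Section Weights.
Variables (tau K h : R) (G w : nat) (A0 : list C).
Hypothesis Htau : 0 < tau <= 1.
Hypothesis HK : 0 < K.
Hypothesis Hh : 0 < h.
Hypothesis HwG : (w < G)%nat.

Definition height : R := PI / tau.

(* Paired nodes avoid the residue class [w]; one more of these nodes than there are
   points in [A0] makes the weights decay on the imaginary axis. *)
Definition extra : list nat := map (fun k => (G * k + w)%nat) (seq 0 (S (length A0))).

(** At a node, T s = n PI + PI / 2. *)
Lemma cos_node_node (e : R) (n : nat) : e = 1 \/ e = -1 ->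
  cos_node height (RtoC (e * node tau n)).
Proof.
  intros He. unfold cos_node.
  assert (E : node tau n * height = PI * INR n + PI / 2).
  { unfold node, height. field. lra. }
  assert (C0 : cos (node tau n * height) = 0).
  { rewrite E. replace (PI * INR n + PI / 2) with (PI / 2 + PI * INR n) by ring.
    rewrite <- sin_shift. replace (PI / 2 - (PI / 2 + PI * INR n)) with (- (INR n * PI)) by ring.
    rewrite sin_neg. clear E. assert (S0 : sin (INR n * PI) = 0).
    { apply sin_eq_0_1. exists (Z.of_nat n). now rewrite INR_IZR_INZ. }
    rewrite S0. ring. }
  unfold Cexp, iheight.
  assert (R1 : forall c : R, Re (RtoC c * (RtoC height * Ci))%C = 0)
    by (intros c; unfold Re, Ci; simpl; ring).
  assert (I1 : forall c : R, Im (RtoC c * (RtoC height * Ci))%C = c * height)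
    by (intros c; unfold Im, Ci; simpl; ring).
  rewrite <- RtoC_opp, !R1, !I1, exp_0.
  replace (- (e * node tau n) * height) with (- (e * (node tau n * height))) by ring.
  replace (e * node tau n * height) with (e * (node tau n * height)) by ring.
  rewrite cos_neg, sin_neg.
  assert (C1 : cos (e * (node tau n * height)) = 0).
  { destruct He as [-> | ->].
    - now rewrite Rmult_1_l.
    - replace (-1 * (node tau n * height)) with (- (node tau n * height)) by ring.
      now rewrite cos_neg. }
  rewrite C1. unfold Copp; simpl. f_equal; ring.
Qed.

Lemma extra_NoDup : NoDup extra.
Proof.
  unfold extra. apply FinFun.Injective_map_NoDup; [|apply seq_NoDup].
  intros a b E. assert (G * a = G * b)%nat by lia. apply Nat.mul_cancel_l in H; lia.
Qed.

Lemma extra_mod (n : nat) : In n extra -> (n mod G = w)%nat.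
Proof.
  intros H. unfold extra in H. apply in_map_iff in H. destruct H as [k [<- _]].
  rewrite Nat.add_comm, Nat.mul_comm, Nat.Div0.mod_add. now apply Nat.mod_small.
Qed.

Variable pr : list (C * nat).
Hypothesis Hnd : NoDup (map snd pr).
Hypothesis Hmod : forall p, In p pr -> (snd p mod G < w)%nat.
Hypothesis Hle : forall p, In p pr -> node tau (snd p) <= Cmod (fst p).
Hypothesis Hfac : forall n0, Rprod (fun p => fac (node tau n0) (fst p) (node tau (snd p))) pr
     <= K * exp (h / 4 * node tau n0).

Definition node_list : list nat := extra ++ map snd pr.
Definition nodes : list R := map (node tau) node_list.
Definition zeros : list C := A0 ++ flat_map (fun p => [fst p; (- fst p)%C]) pr.
(** Normalizes each paired factor to (1 - y^2 / z^2) / (1 - y^2 / s^2), which is 1 at the origin. *)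
Definition gam : C := Cprod (fun p => RtoC (node tau (snd p)) ^ 2 / fst p ^ 2)%C pr.
Definition weight (s : C) : C :=
  (gam * (Cprod (fun a => s - a) zeros / dprod (both nodes) s))%C.

Lemma node_gt0 (n : nat) : 0 < node tau n.
Proof. unfold node. assert (H := pos_INR n). nra. Qed.

Lemma node_inj (n m : nat) : node tau n = node tau m -> n = m.
Proof.
  unfold node. intros E. apply INR_eq. apply Rmult_eq_reg_l in E; lra.
Qed.

Lemma node_list_NoDup : NoDup node_list.
Proof.
  apply NoDup_app; [apply extra_NoDup|exact Hnd|].
  intros n H1 H2. apply extra_mod in H1. apply in_map_iff in H2.
  destruct H2 as [p [<- Hp]]. specialize (Hmod p Hp). lia.
Qed.

Lemma nodes_pos (s : R) : In s nodes -> 0 < s.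
Proof.
  unfold nodes. intros H. apply in_map_iff in H. destruct H as [n [<- _]]. apply node_gt0.
Qed.

Lemma nodes_NoDup : NoDup nodes.
Proof.
  apply FinFun.Injective_map_NoDup; [|apply node_list_NoDup].
  intros a b. apply node_inj.
Qed.

Lemma nodes_length : length nodes = (S (length A0) + length pr)%nat.
Proof.
  unfold nodes, node_list, extra. rewrite length_map, length_app, !length_map, length_seq. reflexivity.
Qed.

Lemma zeros_length : length zeros = (length A0 + 2 * length pr)%nat.
Proof.
  unfold zeros. rewrite length_app, (length_flat_map_const _ _ 2) by reflexivity. lia.
Qed.

Lemma zeros_pos (p : C * nat) : In p pr -> 0 < Cmod (fst p).
Proof. intros Hp. assert (H := Hle p Hp). assert (N := node_gt0 (snd p)). lra. Qed.

Lemma zeros_neq0 (p : C * nat) : In p pr -> fst p <> RtoC 0.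
Proof. intros Hp E. assert (H := zeros_pos p Hp). rewrite E, Cmod_0 in H. lra. Qed.

Lemma both_cos_node (s : C) : In s (both nodes) -> cos_node height s.
Proof.
  intros H. apply in_both in H. destruct H as [t [Ht H]].
  unfold nodes in Ht. apply in_map_iff in Ht. destruct Ht as [n [<- _]].
  destruct H as [-> | ->]; apply cos_node_node; auto.
Qed.

Lemma zero_notin_both : ~ In (RtoC 0) (both nodes).
Proof.
  intros H. apply in_both in H. destruct H as [t [Ht H]]. apply nodes_pos in Ht.
  destruct H as [H|H]; apply RtoC_inj in H; lra.
Qed.

Lemma both_nodes_NoDup : NoDup (both nodes).
Proof. apply both_NoDup; [apply nodes_NoDup|apply nodes_pos]. Qed.

Lemma Cprod_zeros (f : C -> C) :
  Cprod f zeros = (Cprod f A0 * Cprod (fun p => f (fst p) * f (- fst p)%C) pr)%C.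
Proof.
  unfold zeros. rewrite Cprod_app, Cprod_flat_map. f_equal. apply Cprod_ext.
  intros p _. simpl. ring.
Qed.

Lemma weight_kill (l p : C) (m : nat) : (S m <= count_occ Ceq_dec zeros l)%nat ->
  functional height weight (fun s => monomial_primitive l p s m) (both nodes) = RtoC 0.
Proof.
  intros H. destruct (count_occ_extract _ _ _ H) as [al [P _]].
  unfold weight. rewrite functional_scal.
  rewrite (functional_ext _ _ (fun s => Cprod (fun a => s - a) (repeat l (S m) ++ al) / dprod (both nodes) s)%C
    _ (fun s => monomial_primitive l p s m)).
  - rewrite functional_kill; [ring|apply both_nodes_NoDup|apply both_cos_node|].
    (* Degree count: |A0| + 2 |pr| zeros against 2 |A0| + 2 + 2 |pr| poles, a gap of at least 2. *)
    apply Permutation_length in P. rewrite length_app, repeat_length, zeros_length in P.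
    rewrite both_length, nodes_length. lia.
  - intros s _. f_equal. now apply Cprod_Permutation.
  - reflexivity.
Qed.

(** By the normalization every paired factor disappears at 0, so the value involves only the
    unpaired points and the additional nodes and is the same for all pairings. *)
Lemma weight_value (mu : nat) (A1 : list C) : Permutation A0 (repeat (RtoC 0) mu ++ A1) ->
  functional height weight (fun s => monomial_primitive 0 0 s mu) (both nodes)
  = (2 * INR (fact mu) * (Cprod (fun a => 0 - a) A1
       / Cprod (fun n => - RtoC (node tau n) ^ 2) extra))%C.
Proof.
  intros P. set (pz := flat_map (fun p : C * nat => [fst p; (- fst p)%C]) pr).
  assert (P2 : Permutation zeros (repeat (RtoC 0) mu ++ (A1 ++ pz))).
  { unfold zeros. fold pz. rewrite P, app_assoc. reflexivity. }
  unfold weight. rewrite functional_scal.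
  rewrite (functional_ext _ _ (fun s => Cprod (fun a => s - a) (repeat (RtoC 0) mu ++ (A1 ++ pz)) / dprod (both nodes) s)%C
    _ (fun s => monomial_primitive 0 0 s mu)).
  - rewrite functional_power; [|apply both_nodes_NoDup|apply both_cos_node|apply zero_notin_both|].
    + rewrite Cprod_app, Cprod_both. unfold pz. rewrite Cprod_flat_map.
      unfold nodes, node_list. rewrite map_app.
      set (f := fun s : R => ((0 - RtoC s) * (0 - - RtoC s))%C).
      assert (E1 : Cprod f (map (node tau) extra ++ map (node tau) (map snd pr))
        = (Cprod (fun n => - RtoC (node tau n) ^ 2) extra
           * Cprod (fun p => - RtoC (node tau (snd p)) ^ 2) pr)%C).
      { rewrite Cprod_app. f_equal.
        - induction extra as [|n ns IH]; simpl; [reflexivity|]. rewrite IH. unfold f.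
          simpl. ring.
        - clear. induction pr as [|q qs IH]; simpl; [reflexivity|]. rewrite IH. unfold f.
          simpl. ring. }
      rewrite E1.
      assert (E2 : (gam * Cprod (fun p => Cprod (fun a => 0 - a) [fst p; (- fst p)%C]) pr)%C
         = Cprod (fun p => - RtoC (node tau (snd p)) ^ 2)%C pr).
      { unfold gam.
        assert (Z := zeros_neq0). clear -Z. induction pr as [|q qs IH]; [simpl; ring|].
        simpl in *. rewrite <- IH by auto.
        assert (Hq : fst q <> RtoC 0) by auto.
        field. exact Hq. }
      assert (N1 : Cprod (fun p => - RtoC (node tau (snd p)) ^ 2)%C pr <> RtoC 0).
      { apply Cprod_neq0. intros p _ E.
        assert (N := node_gt0 (snd p)).
        apply (f_equal Cmod) in E. rewrite Cmod_opp, Cmod_0 in E. simpl in E.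
        rewrite !Cmod_mult, Cmod_1, Cmod_R, Rabs_pos_eq in E by lra. nra. }
      assert (N2 : Cprod (fun n => - RtoC (node tau n) ^ 2)%C extra <> RtoC 0).
      { apply Cprod_neq0. intros n _ E.
        assert (N := node_gt0 n).
        apply (f_equal Cmod) in E. rewrite Cmod_opp, Cmod_0 in E. simpl in E.
        rewrite !Cmod_mult, Cmod_1, Cmod_R, Rabs_pos_eq in E by lra. nra. }
      set (b := Cprod (fun p => - RtoC (node tau (snd p)) ^ 2)%C pr) in *.
      set (a := Cprod (fun n => - RtoC (node tau n) ^ 2)%C extra) in *.
      set (pzz := Cprod (fun p => Cprod (fun a => 0 - a) [fst p; (- fst p)%C])%C pr) in *.
      transitivity (2 * INR (fact mu) * (Cprod (fun a => 0 - a) A1 * (gam * pzz) / (a * b)))%C.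
      * field. auto.
      * rewrite E2. field. auto.
    + apply Permutation_length in P2. rewrite length_app, repeat_length, zeros_length in P2.
      rewrite both_length, nodes_length. lia.
  - intros s _. f_equal. now apply Cprod_Permutation.
  - reflexivity.
Qed.

Lemma Cmod_gam_term (p : C * nat) (y : C) : In p pr ->
  Cmod (RtoC (node tau (snd p)) ^ 2 / fst p ^ 2 * ((y - fst p) * (y - - fst p)))%C
  = node tau (snd p) ^ 2 / Cmod (fst p) ^ 2 * (Cmod (y - fst p) * Cmod (y + fst p)).
Proof.
  intros Hp. assert (Z := zeros_neq0 p Hp). assert (N := node_gt0 (snd p)).
  rewrite !Cmod_mult. unfold Cdiv. rewrite Cmod_mult, Cmod_inv by (simpl; repeat apply Cmult_neq_0; auto;
    intros E; apply RtoC_inj in E; lra).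
  simpl. rewrite !Cmod_mult, !Cmod_1, Cmod_R, Rabs_pos_eq by lra.
  replace (y - - fst p)%C with (y + fst p)%C by ring. reflexivity.
Qed.

Lemma gam_zeros (y : C) :
  (gam * Cprod (fun a => y - a) zeros)%C
  = (Cprod (fun a => y - a) A0
     * Cprod (fun p => RtoC (node tau (snd p)) ^ 2 / fst p ^ 2 * ((y - fst p) * (y - - fst p))) pr)%C.
Proof.
  rewrite Cprod_zeros. unfold gam.
  set (a := Cprod (fun a => y - a)%C A0). clearbody a.
  clear Hnd Hmod Hle Hfac. induction pr as [|q qs IH]; [simpl; ring|].
  rewrite !Cprod_cons.
  set (u := (RtoC (node tau (snd q)) ^ 2 / fst q ^ 2)%C) in *.
  set (v := ((y - fst q) * (y - - fst q))%C) in *.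
  match goal with |- (u * ?c * (a * (v * ?d)))%C = _ =>
    transitivity (u * v * (c * (a * d)))%C; [ring|] end.
  rewrite IH. ring.
Qed.

(** Separates unpaired points, paired zeros and additional nodes. The paired contribution is even,
    hence the same at s and -s. *)
Lemma weight_at_node (e : R) (n : nat) : e = 1 \/ e = -1 ->
  Cmod (weight (RtoC (e * node tau n)))
  = Rprod (fun a => Cmod (RtoC (e * node tau n) - a)) A0
    * Rprod (fun p => fac (node tau n) (fst p) (node tau (snd p))) pr
    * Rprod (fun k => / ((if Req_EM_T (node tau n) (node tau k) then 1
                 else Rabs (node tau n - node tau k)) * (node tau n + node tau k))) extra.
Proof.
  intros He. set (x := node tau n). assert (Hx : 0 < x) by apply node_gt0.
  unfold weight.
  replace (gam * (Cprod (fun a => RtoC (e * x) - a) zeros / dprod (both nodes) (RtoC (e * x))))%C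
    with (gam * Cprod (fun a => RtoC (e * x) - a) zeros * / dprod (both nodes) (RtoC (e * x)))%C
    by (unfold Cdiv; ring).
  rewrite gam_zeros, !Cmod_mult, Cmod_inv by apply dprod_neq0.
  rewrite Cmod_dprod_both by (auto using nodes_pos).
  rewrite !Cmod_Cprod.
  unfold nodes, node_list. rewrite map_app, Rprod_app, !Rprod_map, Rinv_mult.
  rewrite <- !Rprod_inv.
  set (a := Rprod (fun a => Cmod (RtoC (e * x) - a)) A0).
  set (b := Rprod _ extra).
  rewrite !Rmult_assoc. f_equal. rewrite (Rmult_comm b), <- Rmult_assoc. f_equal.
  rewrite <- Rprod_mult. apply Rprod_ext. intros p Hp.
  rewrite Cmod_gam_term by exact Hp. unfold fac, Rdiv. f_equal. f_equal.
  destruct He as [-> | ->].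
  - now rewrite Rmult_1_l.
  - replace (RtoC (-1 * x)) with (- RtoC x)%C by (rewrite <- RtoC_opp; f_equal; ring).
    replace (- RtoC x - fst p)%C with (- (RtoC x + fst p))%C by ring.
    replace (- RtoC x + fst p)%C with (- (RtoC x - fst p))%C by ring.
    rewrite !Cmod_opp. ring.
Qed.

(** Unpaired points and paired zeros use the rate h / 4 each. An additional node costs at most 1 /
    tau^2, as sums and nonzero differences of nodes are at least tau. *)
Lemma weight_decay (KA : R) (e : R) (n : nat) : 0 <= KA ->
  (forall s, 0 <= s -> Rprod (fun a => s + Cmod a) A0 <= KA * exp (h / 4 * s)) ->
  e = 1 \/ e = -1 ->
  Cmod (weight (RtoC (e * node tau n)))
  <= KA * K * (/ tau ^ 2) ^ length extra * exp (h / 2 * node tau n).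
Proof.
  intros HKA HA He. rewrite weight_at_node by exact He.
  set (x := node tau n). assert (Hx : 0 < x) by apply node_gt0.
  assert (B1 : Rprod (fun a => Cmod (RtoC (e * x) - a)) A0 <= KA * exp (h / 4 * x)).
  { eapply Rle_trans; [|apply HA; lra]. apply Rprod_le. intros a _.
    split; [apply Cmod_ge_0|]. eapply Rle_trans; [apply Cmod_triangle|].
    rewrite Cmod_opp, Cmod_R. right. f_equal.
    destruct He as [-> | ->]; [rewrite Rmult_1_l, Rabs_pos_eq|rewrite Rabs_left]; lra. }
  assert (B2 := Hfac n). fold x in B2.
  assert (B3 : Rprod (fun k => / ((if Req_EM_T x (node tau k) then 1
                 else Rabs (x - node tau k)) * (x + node tau k))) extra
               <= (/ tau ^ 2) ^ length extra).
  { rewrite <- Rprod_const. apply Rprod_le. intros k _.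
    assert (Hk := node_gt0 k).
    assert (T1 : tau <= if Req_EM_T x (node tau k) then 1 else Rabs (x - node tau k)).
    { destruct (Req_EM_T x (node tau k)); [lra|]. apply (node_gap 1 1 tau); auto. }
    assert (T2 : tau <= x + node tau k).
    { unfold x, node. assert (P1 := pos_INR n). assert (P2 := pos_INR k). nra. }
    split.
    - left. apply Rinv_0_lt_compat. nra.
    - apply Rinv_le_contravar; nra. }
  assert (P1 : 0 <= Rprod (fun a => Cmod (RtoC (e * x) - a)) A0)
    by (apply Rprod_ge0; intros; apply Cmod_ge_0).
  assert (P2 : 0 <= Rprod (fun p => fac x (fst p) (node tau (snd p))) pr).
  { apply Rprod_ge0. intros p Hp. apply fac_ge0; auto using node_gt0, zeros_pos. }
  assert (P3 : 0 <= (/ tau ^ 2) ^ length extra).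
  { apply pow_le. left. apply Rinv_0_lt_compat. nra. }
  assert (P4 : 0 <= Rprod (fun k => / ((if Req_EM_T x (node tau k) then 1
                 else Rabs (x - node tau k)) * (x + node tau k))) extra).
  { apply Rprod_ge0. intros k _. left. apply Rinv_0_lt_compat. assert (Hk := node_gt0 k).
    apply Rmult_lt_0_compat; [|lra].
    destruct (Req_EM_T x (node tau k)); [lra|]. apply Rabs_pos_lt. lra. }
  replace (exp (h / 2 * x)) with (exp (h / 4 * x) * exp (h / 4 * x))
    by (rewrite <- exp_plus; f_equal; field).
  replace (KA * K * (/ tau ^ 2) ^ length extra * (exp (h / 4 * x) * exp (h / 4 * x))) with
    ((KA * exp (h / 4 * x)) * (K * exp (h / 4 * x)) * (/ tau ^ 2) ^ length extra) by ring.
  apply Rmult_le_compat; auto; [now apply Rmult_le_pos|].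
  apply Rmult_le_compat; auto.
Qed.

(** The rational function at i y, expanded over its poles, in the shape to which Parseval
    applies. *)
Definition axis_value (y : R) : C :=
  Csum (fun s => weight s / (RtoC y * Ci - s))%C (both nodes).

Lemma axis_notin (y : R) : ~ In (RtoC y * Ci)%C (both nodes).
Proof.
  intros H. apply in_both in H. destruct H as [t [Ht H]]. apply nodes_pos in Ht.
  assert (E : Re (RtoC y * Ci)%C = 0) by (unfold Re, Ci; simpl; ring).
  destruct H as [H|H]; rewrite H in E; unfold Re in E; simpl in E; lra.
Qed.

Lemma Cmod_sub_axis (y : R) (z : C) : Cmod (RtoC y * Ci - z) <= Rabs y + Cmod z.
Proof.
  eapply Rle_trans; [apply Cmod_triangle|]. rewrite Cmod_opp, Cmod_mult, Cmod_R.
  replace (Cmod Ci) with 1; [lra|].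
  unfold Cmod, Ci; simpl. replace (0 * _ + _) with 1 by ring. now rewrite sqrt_1.
Qed.

Lemma axis_bound (KA : R) (y : R) : 0 <= KA ->
  (forall y, Rprod (fun a => Rabs y + Cmod a) A0
     * Rprod (fun t => / (y ^ 2 + t ^ 2)) (map (node tau) extra) <= KA / (1 + y ^ 2)) ->
  Cmod (axis_value y) <= KA / (1 + y ^ 2).
Proof.
  intros HKA HA. unfold axis_value.
  set (i := (RtoC y * Ci)%C).
  assert (E : Csum (fun s => weight s / (i - s))%C (both nodes)
     = (gam * Cprod (fun a => i - a) zeros / Cprod (fun s => i - s) (both nodes))%C).
  { transitivity (gam * (Cprod (fun a => i - a) zeros / Cprod (fun s => i - s) (both nodes)))%C;
      [|unfold Cdiv; ring].
    rewrite <- (partial_fractions zeros (both nodes) i).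
    - rewrite <- Csum_scal. apply Csum_ext. intros s _. unfold weight, Cdiv. ring.
    - apply both_nodes_NoDup.
    - apply axis_notin.
    - rewrite both_length, nodes_length, zeros_length. lia. }
  rewrite E.
  assert (N : Cprod (fun s => i - s)%C (both nodes) <> RtoC 0).
  { apply Cprod_neq0. intros s Hs. apply Cminus_neq0. intros Ei. apply (axis_notin y).
    fold i. now rewrite Ei. }
  rewrite Cmod_div by exact N. rewrite gam_zeros, Cprod_both, Cmod_mult, !Cmod_Cprod.
  assert (Ei2 : forall t : R, Cmod ((i - RtoC t) * (i - - RtoC t)) = y ^ 2 + t ^ 2).
  { intros t. replace ((i - RtoC t) * (i - - RtoC t))%C with (RtoC (- (y ^ 2 + t ^ 2))).
    - rewrite Cmod_R, Rabs_left1; nra.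
    - transitivity (RtoC y * RtoC y * (Ci * Ci) - RtoC t * RtoC t)%C; [|unfold i; ring].
      replace (Ci * Ci)%C with (- (1))%C
        by (unfold Ci, Cmult, Copp; simpl; f_equal; ring).
      rewrite <- !RtoC_mult. rewrite RtoC_opp, RtoC_plus. simpl pow. rewrite !Rmult_1_r. ring. }
  rewrite (Rprod_ext (fun s : R => Cmod ((i - RtoC s) * (i - - RtoC s))) (fun t => y ^ 2 + t ^ 2))
    by (intros; apply Ei2).
  unfold nodes, node_list. rewrite map_app, Rprod_app, !Rprod_map.
  set (a := Rprod (fun a => Cmod (i - a)) A0).
  set (b := Rprod (fun k => y ^ 2 + node tau k ^ 2) extra).
  set (c := Rprod (fun p => y ^ 2 + node tau (snd p) ^ 2) pr).
  set (g := Rprod _ pr).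
  assert (Pb : 0 < b).
  { apply Rprod_gt0. intros k _. assert (Hk := node_gt0 k). nra. }
  assert (Pc : 0 < c).
  { apply Rprod_gt0. intros k _. assert (Hk := node_gt0 (snd k)). nra. }
  assert (Hg : g <= c).
  { unfold g, c. apply Rprod_le. intros p Hp. split; [apply Cmod_ge_0|].
    rewrite Cmod_gam_term by exact Hp.
    assert (Np := node_gt0 (snd p)). assert (Lp := Hle p Hp).
    set (t := node tau (snd p)) in *.
    assert (Q : Cmod (i - fst p) * Cmod (i + fst p) <= y ^ 2 + Cmod (fst p) ^ 2).
    { rewrite <- Cmod_mult.
      replace ((i - fst p) * (i + fst p))%C with (i * i - fst p * fst p)%C by ring.
      eapply Rle_trans; [apply Cmod_triangle|]. rewrite Cmod_opp, !Cmod_mult.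
      assert (I1 : Cmod i <= Rabs y).
      { assert (I2 := Cmod_sub_axis y 0). fold i in I2. rewrite Cmod_0 in I2.
        replace (i - 0)%C with i in I2 by ring. lra. }
      rewrite <- (pow2_abs y). assert (0 <= Cmod i) by apply Cmod_ge_0. nra. }
    set (m := Cmod (fst p)) in *.
    assert (Hr : 0 < t / m <= 1) by (split; [apply Rdiv_lt_0_compat|apply ratio_le_1]; lra).
    apply Rle_trans with (t ^ 2 / m ^ 2 * (y ^ 2 + m ^ 2)).
    - apply Rmult_le_compat_l; [|exact Q]. apply Rmult_le_pos; [nra|].
      left. apply Rinv_0_lt_compat. nra.
    - replace (t ^ 2 / m ^ 2 * (y ^ 2 + m ^ 2)) with ((t / m) * (t / m) * y ^ 2 + t ^ 2)
        by (field; lra).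
      assert ((t / m) * (t / m) <= 1) by nra. assert (0 <= y ^ 2) by nra. nra. }
  assert (Pg : 0 <= g) by (apply Rprod_ge0; intros; apply Cmod_ge_0).
  assert (Pa : 0 <= a) by (apply Rprod_ge0; intros; apply Cmod_ge_0).
  apply Rle_trans with (a * / b).
  - apply div_le_of_le_mul; [nra|].
    replace (a * / b * (b * c)) with (a * c) by (field; lra). apply Rmult_le_compat_l; auto.
  - eapply Rle_trans; [|apply (HA y)].
    rewrite Rprod_map, Rprod_inv. fold b.
    apply Rmult_le_compat_r; [left; now apply Rinv_0_lt_compat|].
    apply Rprod_le. intros z _. split; [apply Cmod_ge_0|apply Cmod_sub_axis].
Qed.

(** [posexp_energy_bound] is about real coefficients, while the residues are complex, so their real
    and imaginary parts must be bounded separately. With [P] even and [Q] odd in y, adding the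
    squared moduli at i y and -i y cancels the cross terms and leaves twice the sum of the four
    squares. *)
Lemma energy_bounds (KA : R) (e : R) : 0 <= KA -> e = 1 \/ e = -1 ->
  (forall y, Rprod (fun a => Rabs y + Cmod a) A0
     * Rprod (fun t => / (y ^ 2 + t ^ 2)) (map (node tau) extra) <= KA / (1 + y ^ 2)) ->
  forall x,
    posexp_energy (map (fun s => (Re (weight (RtoC (e * s))), s)) nodes) x <= KA ^ 2 / 2 /\
    posexp_energy (map (fun s => (Im (weight (RtoC (e * s))), s)) nodes) x <= KA ^ 2 / 2.
Proof.
  intros HKA He HA x.
  (* All poles multiplied by e, so that those of the half under study get positive exponents;
     [posexp_energy] ignores the rest, but the bound on the axis needs them. *)
  set (L := fun f : C -> R => map (fun s => (f (weight (RtoC (e * s))), s)) nodes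
                ++ map (fun s => (f (weight (RtoC (- e * s))), - s)) nodes).
  assert (EL : forall f, posexp_energy (L f) x
     = posexp_energy (map (fun s => (f (weight (RtoC (e * s))), s)) nodes) x).
  { intros f. apply posexp_energy_app. intros p Hp. apply in_map_iff in Hp.
    destruct Hp as [s [<- Hs]]. simpl. apply nodes_pos in Hs. lra. }
  rewrite <- (EL Re), <- (EL Im).
  assert (Hnz : forall f p, In p (L f) -> snd p <> 0).
  { intros f p Hp. unfold L in Hp. apply in_app_or in Hp.
    destruct Hp as [Hp|Hp]; apply in_map_iff in Hp; destruct Hp as [s [<- Hs]];
      apply nodes_pos in Hs; simpl; lra. }
  assert (He2 : e * e = 1) by (destruct He as [-> | ->]; ring).
  assert (Er : forall f y, rpart (L f) y
     = e * Rsum (fun s => f (weight (RtoC s)) * (s / (s ^ 2 + y ^ 2)))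
        (map (Rmult 1) nodes ++ map (Rmult (-1)) nodes)).
  { intros f y. unfold rpart, L. rewrite !Rsum_app, !Rsum_map, <- !Rsum_plus, <- Rsum_scal.
    apply Rsum_ext. intros s Hs. simpl. apply nodes_pos in Hs.
    destruct He as [-> | ->].
    - replace (- (1) * s) with (-1 * s) by ring. field. nra.
    - replace (- -1 * s) with (1 * s) by ring. field. nra. }
  assert (Ei : forall f y, ipart (L f) y
     = Rsum (fun s => f (weight (RtoC s)) * (y / (s ^ 2 + y ^ 2)))
        (map (Rmult 1) nodes ++ map (Rmult (-1)) nodes)).
  { intros f y. unfold ipart, L. rewrite !Rsum_app, !Rsum_map, <- !Rsum_plus.
    apply Rsum_ext. intros s Hs. simpl. apply nodes_pos in Hs.
    destruct He as [-> | ->].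
    - replace (- (1) * s) with (-1 * s) by ring. field. nra.
    - replace (- -1 * s) with (1 * s) by ring. field. nra. }
  assert (Ax : forall y, axis_value y = Csum (fun s => weight (RtoC s) / (RtoC y * Ci - RtoC s))%C
        (map (Rmult 1) nodes ++ map (Rmult (-1)) nodes)).
  { intros y. unfold axis_value, both, half. rewrite !Csum_app, !Csum_map. reflexivity. }
  set (sl := map (Rmult 1) nodes ++ map (Rmult (-1)) nodes) in *.
  assert (Hsl : forall s, In s sl -> s <> 0).
  { intros s Hs. unfold sl in Hs. apply in_app_or in Hs.
    destruct Hs as [Hs|Hs]; apply in_map_iff in Hs; destruct Hs as [t [<- Ht]];
      apply nodes_pos in Ht; lra. }
  set (P := fun (f : C -> R) y => Rsum (fun s => f (weight (RtoC s)) * (s / (s ^ 2 + y ^ 2))) sl).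
  set (Q := fun (f : C -> R) y => Rsum (fun s => f (weight (RtoC s)) * (y / (s ^ 2 + y ^ 2))) sl).
  assert (Dv : forall (u : C) (s y : R), s <> 0 ->
      Re (u / (RtoC y * Ci - RtoC s))%C = - (Re u * (s / (s ^ 2 + y ^ 2))) + Im u * (y / (s ^ 2 + y ^ 2))
      /\ Im (u / (RtoC y * Ci - RtoC s))%C = - (Im u * (s / (s ^ 2 + y ^ 2))) - Re u * (y / (s ^ 2 + y ^ 2))).
  { intros u s y Hs. assert (Hp := sq_plus_pos s y Hs).
    assert (E : (u / (RtoC y * Ci - RtoC s))%C
       = Cmult u (- (s / (s ^ 2 + y ^ 2)), - (y / (s ^ 2 + y ^ 2)))).
    { unfold Cdiv. f_equal. unfold Cinv, Cminus, Cplus, Copp, Cmult, RtoC, Ci; simpl.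
      f_equal; field; repeat split; nra. }
    rewrite E. unfold Re, Im; simpl. split; ring. }
  assert (ReA : forall y, Re (axis_value y) = - P Re y + Q Im y).
  { intros y. rewrite Ax, Re_Csum. unfold P, Q.
    replace (- Rsum (fun s => Re (weight (RtoC s)) * (s / (s ^ 2 + y ^ 2))) sl) with
      (-1 * Rsum (fun s => Re (weight (RtoC s)) * (s / (s ^ 2 + y ^ 2))) sl) by ring.
    rewrite <- Rsum_scal, <- Rsum_plus. apply Rsum_ext. intros s Hs.
    rewrite (proj1 (Dv _ s y (Hsl s Hs))). ring. }
  assert (ImA : forall y, Im (axis_value y) = - P Im y - Q Re y).
  { intros y. rewrite Ax, Im_Csum. unfold P, Q.
    replace (- Rsum (fun s => Im (weight (RtoC s)) * (s / (s ^ 2 + y ^ 2))) sl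
       - Rsum (fun s => Re (weight (RtoC s)) * (y / (s ^ 2 + y ^ 2))) sl) with
      (-1 * Rsum (fun s => Im (weight (RtoC s)) * (s / (s ^ 2 + y ^ 2))) sl
       + -1 * Rsum (fun s => Re (weight (RtoC s)) * (y / (s ^ 2 + y ^ 2))) sl) by ring.
    rewrite <- !Rsum_scal, <- Rsum_plus. apply Rsum_ext. intros s Hs.
    rewrite (proj2 (Dv _ s y (Hsl s Hs))). ring. }
  assert (Pev : forall f y, P f (- y) = P f y).
  { intros f y. unfold P. apply Rsum_ext. intros s _.
    replace ((- y) ^ 2) with (y ^ 2) by ring. reflexivity. }
  assert (Qodd : forall f y, Q f (- y) = - Q f y).
  { intros f y. unfold Q.
    transitivity (-1 * Rsum (fun s => f (weight (RtoC s)) * (y / (s ^ 2 + y ^ 2))) sl); [|ring].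
    rewrite <- Rsum_scal. apply Rsum_ext. intros s _.
    replace ((- y) ^ 2) with (y ^ 2) by ring. unfold Rdiv. ring. }
  assert (Cm : forall y, Re (axis_value y) ^ 2 + Im (axis_value y) ^ 2 <= KA ^ 2 / (1 + y ^ 2)).
  { intros y. assert (B := axis_bound KA y HKA HA).
    assert (E : Cmod (axis_value y) ^ 2 = Re (axis_value y) ^ 2 + Im (axis_value y) ^ 2).
    { unfold Cmod. rewrite pow2_sqrt; [reflexivity|nra]. }
    rewrite <- E.
    apply Rle_trans with ((KA / (1 + y ^ 2)) ^ 2).
    - apply pow_incr. split; [apply Cmod_ge_0|exact B].
    - replace ((KA / (1 + y ^ 2)) ^ 2) with (KA ^ 2 / (1 + y ^ 2) * / (1 + y ^ 2)) by (field; nra).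
      rewrite <- (Rmult_1_r (KA ^ 2 / (1 + y ^ 2))) at 2.
      apply Rmult_le_compat_l.
      + apply Rmult_le_pos; [nra|]. left. apply Rinv_0_lt_compat. nra.
      + rewrite <- Rinv_1. apply Rinv_le_contravar; nra. }
  assert (Tot : forall y, P Re y ^ 2 + Q Re y ^ 2 + (P Im y ^ 2 + Q Im y ^ 2) <= KA ^ 2 / (1 + y ^ 2)).
  { intros y. assert (C1 := Cm y). assert (C2 := Cm (- y)).
    replace ((- y) ^ 2) with (y ^ 2) in C2 by ring.
    rewrite ReA, ImA in C1, C2. rewrite !Pev, !Qodd in C2. nra. }
  split; apply posexp_energy_bound; try apply Hnz; intros y; rewrite Er, Ei;
    specialize (Tot y); fold (P Re y) (P Im y) (Q Re y) (Q Im y).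
  - replace ((e * P Re y) ^ 2) with ((e * e) * P Re y ^ 2) by ring. rewrite He2.
    assert (0 <= P Im y ^ 2) by nra. assert (0 <= Q Im y ^ 2) by nra. lra.
  - replace ((e * P Im y) ^ 2) with ((e * e) * P Im y ^ 2) by ring. rewrite He2.
    assert (0 <= P Re y ^ 2) by nra. assert (0 <= Q Re y ^ 2) by nra. lra.
Qed.

(** The constant is the same for all pairings. On the vertical sides exp (h s / 2) meets exp (- h
    s), and since the nodes are distinct the remaining sum is dominated by a geometric series. *)
Lemma weight_bound (KA KB : R) : 0 <= KA -> 0 <= KB ->
  (forall s, 0 <= s -> Rprod (fun a => s + Cmod a) A0 <= KB * exp (h / 4 * s)) ->
  (forall y, Rprod (fun a => Rabs y + Cmod a) A0
     * Rprod (fun t => / (y ^ 2 + t ^ 2)) (map (node tau) extra) <= KA / (1 + y ^ 2)) ->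
  forall (Phi : C -> C -> C) (f : C -> C) (S : R),
  (forall s : C, line_primitive (Phi s) (fun z => Cexp (- s * z) * f z)%C) ->
  (forall z, Rabs (Re z) <= h -> Rabs (Im z) <= height -> Cmod (f z) <= S) ->
  Cmod (functional height weight Phi (both nodes))
    <= S * (2 * (2 * (h + KA ^ 2 / 2) + 2 * height
         * (KB * K * (/ tau ^ 2) ^ length extra * / (1 - exp (- (h / 2 * tau)))))).
Proof.
  intros HKA HKB HB HA Phi f S HPhi Hf.
  set (M := KB * K * (/ tau ^ 2) ^ length extra * / (1 - exp (- (h / 2 * tau)))).
  assert (HT : 0 < height).
  { unfold height. apply Rdiv_lt_0_compat; [apply PI_RGT_0|lra]. }
  assert (Hc : 0 <= KB * K * (/ tau ^ 2) ^ length extra).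
  { apply Rmult_le_pos; [apply Rmult_le_pos; lra|]. apply pow_le. left. apply Rinv_0_lt_compat. nra. }
  assert (HM : forall e, e = 1 \/ e = -1 ->
     Rsum (fun s => Cmod (weight (RtoC (e * s))) * exp (- s * h)) nodes <= M).
  { intros e He. unfold nodes at 1. rewrite Rsum_map.
    apply Rle_trans with (Rsum (fun n => KB * K * (/ tau ^ 2) ^ length extra
         * exp (- (h / 2 * tau)) ^ n) node_list).
    - apply Rsum_le. intros n _.
      assert (D := weight_decay KB e n HKB HB He).
      apply Rle_trans with (KB * K * (/ tau ^ 2) ^ length extra * exp (h / 2 * node tau n)
          * exp (- node tau n * h)).
      + apply Rmult_le_compat_r; [left; apply exp_pos|exact D].
      + rewrite Rmult_assoc, <- exp_plus. apply Rmult_le_compat_l; [exact Hc|].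
        rewrite <- Rpower_pow by apply exp_pos. unfold Rpower. rewrite ln_exp.
        apply exp_le_compat. unfold node. assert (Pn := pos_INR n).
        assert (0 < h * tau) by nra. nra.
    - rewrite Rsum_scal. unfold M. apply Rmult_le_compat_l; [exact Hc|].
      apply Rsum_pow_NoDup; [|apply node_list_NoDup].
      split; [apply exp_pos|]. rewrite <- exp_0. apply exp_increasing. nra. }
  assert (Hhalf : forall e, e = 1 \/ e = -1 ->
     Cmod (functional height weight Phi (half e nodes))
       <= S * (2 * (h + KA ^ 2 / 2) + 2 * height * M)).
  { intros e He. unfold half.
    assert (En := energy_bounds KA e HKA He HA).
    apply (half_functional_bound e height h S weight Phi f nodes); auto.
    - destruct He as [-> | ->]; ring.
    - apply nodes_pos.
    - intros s Hs. unfold nodes in Hs. apply in_map_iff in Hs. destruct Hs as [n [<- _]].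
      now apply cos_node_node.
    - intros x. apply En.
    - intros x. apply En. }
  unfold both. unfold functional. rewrite Csum_app.
  eapply Rle_trans; [apply Cmod_triangle|].
  assert (B1 := Hhalf 1 ltac:(auto)). assert (B2 := Hhalf (-1) ltac:(auto)).
  unfold functional in B1, B2. lra.
Qed.

End Weights.

(** * Incompleteness *)

(** A first-order expansion with quadratic remainder, from which complex differentiability is read
    off directly. *)
Lemma shifted_power_taylor (p w : C) (n : nat) : exists (l : C) (M : R), 0 <= M /\
  forall y, Cmod (y - w) <= 1 ->
    Cmod ((y - p) ^ n - (w - p) ^ n - (y - w) * l) <= M * (Cmod (y - w) * Cmod (y - w)).
Proof.
  induction n as [|n [l [M [HM H]]]].
  - exists (RtoC 0), 0. split; [lra|]. intros y _. simpl.
    replace (1 - 1 - (y - w) * 0)%C with (RtoC 0) by ring. rewrite Cmod_0. lra.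
  - set (b := (w - p)%C) in *. set (a := (b ^ n)%C) in *.
    exists (a + b * l)%C, (Cmod l + (Cmod b + 1) * M).
    assert (Hb := Cmod_ge_0 b). assert (Hl := Cmod_ge_0 l).
    split; [apply Rplus_le_le_0_compat; [|apply Rmult_le_pos]; lra|].
    intros y Hy. specialize (H y Hy). set (d := (y - w)%C) in *.
    assert (Hd := Cmod_ge_0 d).
    set (r := ((y - p) ^ n - a - d * l)%C) in *.
    replace ((y - p) ^ S n - b ^ S n - d * (a + b * l))%C with (d * d * l + (b + d) * r)%C.
    + eapply Rle_trans; [apply Cmod_triangle|]. rewrite !Cmod_mult.
      assert (Hbd : Cmod (b + d) <= Cmod b + 1).
      { eapply Rle_trans; [apply Cmod_triangle|]. lra. }
      assert (0 <= Cmod r) by apply Cmod_ge_0.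
      assert (Cmod (b + d) * Cmod r <= (Cmod b + 1) * (M * (Cmod d * Cmod d)))
        by (apply Rmult_le_compat; auto using Cmod_ge_0).
      lra.
    + simpl. fold a. unfold r.
      replace (y - p)%C with (b + d)%C by (unfold b, d; ring). ring.
Qed.

Lemma ex_derive_shifted_power (p w : C) (n : nat) :
  ex_derive (K := C_AbsRing) (V := C_NormedModule) (fun w => Cpow (w - p) n)%C w.
Proof.
  destruct (shifted_power_taylor p w n) as [l [M [HM H]]].
  exists l. split.
  - apply is_linear_scal_l.
  - intros x Hx e.
    assert (E : w = x) by exact (is_filter_lim_locally_unique (K := C_AbsRing) (V := AbsRing_NormedModule C_AbsRing) _ _ Hx).
    subst x.
    set (r := Rmin 1 (e / (M + 1))).
    assert (Hr : 0 < r).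
    { apply Rmin_pos; [lra|]. apply Rdiv_lt_0_compat; [apply cond_pos|lra]. }
    exists (mkposreal r Hr). intros y Hy.
    assert (Hd : Cmod (y - w) < r) by exact Hy.
    assert (R1 := Rmin_l 1 (e / (M + 1))). assert (R2 := Rmin_r 1 (e / (M + 1))). fold r in R1, R2.
    specialize (H y ltac:(lra)).
    assert (H0 := Cmod_ge_0 (y - w)).
    change (Cmod ((y - p) ^ n - (w - p) ^ n - (y - w) * l) <= e * Cmod (y - w)).
    eapply Rle_trans; [exact H|]. rewrite <- Rmult_assoc.
    apply Rmult_le_compat_r; [exact H0|].
    apply Rle_trans with (M * (e / (M + 1))); [apply Rmult_le_compat_l; lra|].
    assert (He := cond_pos e).
    replace (M * (e / (M + 1))) with (e * (M / (M + 1))) by (field; lra).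
    assert (M / (M + 1) <= 1) by (apply Rle_div_l; lra). nra.
Qed.

(** Each point of the rectangle gets a radius whose square neighbourhood lies in one member of the
    cover, and [compactness_list] selects finitely many points. Outside the rectangle the radius is
    the dummy 1. *)
Lemma compact_rectangle (a b c d : R) :
  compact_set (T := C_UniformSpace) (fun w : C => a <= Re w <= b /\ c <= Im w <= d).
Proof.
  intros U HU Hcov.
  assert (Ch : forall x : C, exists (e : posreal), forall (Hx : a <= Re x <= b /\ c <= Im x <= d),
     exists V, U V /\ forall y : C, Rabs (Re y - Re x) < e -> Rabs (Im y - Im x) < e -> V y).
  { intros x. destruct (classic (a <= Re x <= b /\ c <= Im x <= d)) as [Hx|Hx].
    - destruct (Hcov x Hx) as [V [HV Vx]]. destruct (HU V HV x Vx) as [e He].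
      exists e. intros _. exists V. split; [exact HV|]. intros y H1 H2. apply He. split; assumption.
    - exists (mkposreal 1 Rlt_0_1). intros; contradiction. }
  set (delta := fun t : Compactness.Tn 2 R =>
     proj1_sig (constructive_indefinite_description _ (Ch (fst t, fst (snd t))))).
  assert (Hl := compactness_list 2 (a, (c, tt)) (b, (d, tt)) delta).
  apply NNPP in Hl. destruct Hl as [l Hl].
  assert (G : exists l' : list (C -> Prop), List.Forall U l' /\
     forall x : C, a <= Re x <= b /\ c <= Im x <= d ->
     (exists t : Compactness.Tn 2 R, In t l /\ bounded_n 2 (a, (c, tt)) (b, (d, tt)) t
        /\ close_n 2 (delta t) (Re x, (Im x, tt)) t) -> exists V, In V l' /\ V x).
  { clear Hl. induction l as [|t l IH].
    - exists []. split; [constructor|]. intros x _ [t [[] _]].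
    - destruct IH as [l' [F Hl']].
      destruct (classic (bounded_n 2 (a, (c, tt)) (b, (d, tt)) t)) as [B|B].
      + assert (D := proj2_sig (constructive_indefinite_description _ (Ch (fst t, fst (snd t))))).
        fold (delta t) in D. destruct t as [t1 [t2 []]]. simpl in B.
        destruct D as [V [HV HVy]]; [simpl; tauto|].
        exists (V :: l'). split; [now constructor|].
        intros x Hx [t [[E|Ht] [B' Cl]]].
        * subst t. exists V. split; [now left|]. simpl in Cl. apply HVy; simpl; tauto.
        * destruct (Hl' x Hx) as [V' [H1 H2]]; [eauto|]. exists V'. split; [now right|exact H2].
      + exists l'. split; [exact F|]. intros x Hx [t' [[E|Ht] [B' Cl]]].
        * subst t'. contradiction.
        * apply Hl'; eauto. }
  destruct G as [l' [F G]]. exists l'. split; [exact F|].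
  intros x Hx. apply G; [exact Hx|]. apply (Hl (Re x, (Im x, tt))). simpl. tauto.
Qed.

(** * Finite parts of the sequence *)

Definition points (z : nat -> option C) (a n : nat) : list C :=
  flat_map (fun k => match z k with Some w => [w] | None => [] end) (seq a n).

Lemma points_app (z : nat -> option C) (a n m : nat) :
  points z a (n + m) = points z a n ++ points z (a + n) m.
Proof. unfold points. now rewrite seq_app, flat_map_app. Qed.

Lemma points_In (z : nat -> option C) (a n : nat) (w : C) : In w (points z a n) ->
  exists k, (a <= k < a + n)%nat /\ z k = Some w.
Proof.
  unfold points. intros H. apply in_flat_map in H. destruct H as [k [Hk H]].
  apply in_seq in Hk. exists k. split; [lia|].
  destruct (z k) as [v|]; [|easy]. destruct H as [->|[]]. reflexivity.
Qed.

Lemma sum_n_Rsum (f : nat -> R) (N : nat) : sum_n f N = Rsum f (seq 0 (S N)).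
Proof.
  induction N as [|N IH].
  - rewrite sum_O. simpl. lra.
  - rewrite sum_Sn, IH, (seq_S (S N)), Rsum_app. simpl Rsum. unfold plus; simpl. ring.
Qed.

Lemma points_count (z : nat -> option C) (p : C -> bool) (P : C -> Prop) (a n : nat) :
  (forall w, p w = true <-> P w) ->
  INR (length (filter p (points z a n))) = Rsum (indicator z P) (seq a n).
Proof.
  intros Hp. revert a. induction n as [|n IH]; intros a; [reflexivity|].
  change (points z a (S n)) with
    ((match z a with Some w => [w] | None => [] end) ++ points z (S a) n).
  rewrite filter_app, length_app, plus_INR, IH. change (seq a (S n)) with (a :: seq (S a) n).
  change (Rsum (indicator z P) (a :: seq (S a) n)) with
    (indicator z P a + Rsum (indicator z P) (seq (S a) n)).
  f_equal. unfold indicator. destruct (z a) as [w|]; [|reflexivity]. simpl.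
  destruct (excluded_middle_informative (P w)) as [H|H].
  - apply Hp in H. rewrite H. reflexivity.
  - destruct (p w) eqn:E; [|reflexivity]. apply Hp in E. contradiction.
Qed.

Lemma indicator_ge0 (z : nat -> option C) (P : C -> Prop) (k : nat) : 0 <= indicator z P k.
Proof.
  unfold indicator. destruct (z k); [|lra]. destruct (excluded_middle_informative _); lra.
Qed.

Lemma indicator_sum_le (z : nat -> option C) (P : C -> Prop) (a n : nat) :
  Rbar_le (Finite (Rsum (indicator z P) (seq a n))) (n_Z z P).
Proof.
  unfold n_Z. apply (Sup_seq_minor_le _ _ (a + n)). simpl. rewrite sum_n_Rsum.
  replace (S (a + n)) with (a + (n + 1))%nat by lia. rewrite !seq_app, !Rsum_app, !Nat.add_0_l.
  assert (H1 : 0 <= Rsum (indicator z P) (seq 0 a)) by (apply Rsum_ge0; intros; apply indicator_ge0).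
  assert (H2 : 0 <= Rsum (indicator z P) (seq (a + n) 1)) by (apply Rsum_ge0; intros; apply indicator_ge0).
  lra.
Qed.

Lemma density_bound (z : nat -> option C) : finite_upper_density z ->
  exists r0 K0, 1 <= r0 /\ 0 <= K0 /\ forall r, r0 <= r -> forall a n,
    Rsum (indicator z (fun w => Cmod w <= r)) (seq a n) <= K0 * r.
Proof.
  intros H. unfold finite_upper_density, LimSup_p_infty in H.
  set (f := fun r => Rbar_div (n_Z z (fun w => Cmod w <= r)) (Finite r)) in *.
  set (E := fun s : Rbar => exists a : R, s = Rbar_lub (fun y => exists r : R, a < r /\ y = f r)) in *.
  assert (G := proj2_sig (Rbar_ex_glb E)). fold (Rbar_glb E) in G. destruct G as [_ G].
  assert (Hs : exists s, E s /\ s <> p_infty).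
  { apply NNPP. intros N. specialize (G p_infty).
    apply (Rbar_le_not_lt _ _ (G ltac:(intros s Hs; destruct (classic (s = p_infty)) as [->|Hs'];
       [apply Rbar_le_refl|exfalso; apply N; eauto])) H). }
  destruct Hs as [s [[a Es] Hs]].
  assert (L := proj2_sig (Rbar_ex_lub (fun y => exists r : R, a < r /\ y = f r))).
  fold (Rbar_lub (fun y => exists r : R, a < r /\ y = f r)) in L. rewrite <- Es in L.
  destruct L as [L _].
  assert (Hc : exists c : R, forall r, a < r -> Rbar_le (f r) c).
  { destruct s as [c| |]; [|congruence|].
    - exists c. intros r Hr. apply L. eauto.
    - exists 0. intros r Hr. eapply Rbar_le_trans; [apply L; eauto|exact I]. }
  destruct Hc as [c Hc].
  exists (Rmax 1 (a + 1)), (Rmax 0 c).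
  split; [apply Rmax_l|]. split; [apply Rmax_l|].
  intros r Hr b n.
  assert (R1 := Rmax_l 1 (a + 1)). assert (R2 := Rmax_r 1 (a + 1)). assert (R3 := Rmax_r 0 c).
  assert (Hr0 : 0 < r) by lra. assert (Hf := Hc r ltac:(lra)).
  assert (Hsum := indicator_sum_le z (fun w => Cmod w <= r) b n).
  set (S := Rsum _ _) in *. unfold f in Hf.
  destruct (n_Z z (fun w => Cmod w <= r)) as [v| |]; simpl in Hsum; [| |easy].
  - simpl in Hf. assert (v <= c * r) by (apply Rle_div_l; [lra|exact Hf]). nra.
  - exfalso. revert Hf. unfold Rbar_div, Rbar_inv, Rbar_mult, Rbar_mult'.
    assert (Hi : 0 < / r) by now apply Rinv_0_lt_compat.
    destruct (Rle_dec 0 (/ r)) as [H1|H1]; [|lra].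
    destruct (Rle_lt_or_eq_dec 0 (/ r) H1) as [H2|H2]; [|lra]. simpl. tauto.
Qed.

(** The multiplicity, finite or not, is a supremum over initial segments, so one such segment
    already exceeds m. *)
Lemma multiplicity_reached (z : nat -> option C) (w : C) (m : nat) :
  Rbar_le (Finite (INR m)) (Rbar_minus (n_Z z (fun v => v = w)) (Finite 1)) ->
  exists N, (S m <= count_occ Ceq_dec (points z 0 N) w)%nat.
Proof.
  intros H.
  assert (Hlt : Rbar_lt (Finite (INR m)) (n_Z z (fun v => v = w))).
  { destruct (n_Z z (fun v => v = w)) as [v| |]; simpl in *; try easy. lra. }
  unfold n_Z in Hlt. apply Sup_seq_minor_lt in Hlt. destruct Hlt as [N HN].
  simpl in HN. rewrite sum_n_Rsum in HN.
  exists (S N).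
  rewrite <- (points_count z (fun v => if Ceq_dec v w then true else false)) in HN.
  - apply INR_lt in HN.
    assert (E : forall l, count_occ Ceq_dec l w = length (filter (fun v => if Ceq_dec v w then true else false) l)).
    { induction l as [|v l IH]; simpl; [reflexivity|]. destruct (Ceq_dec v w); simpl; congruence. }
    rewrite E. lia.
  - intros v. destruct (Ceq_dec v w); split; congruence.
Qed.

Lemma eventually_no_indicator (z : nat -> option C) (P : C -> Prop) (B : R) :
  (forall a n, Rsum (indicator z P) (seq a n) <= B) ->
  exists K, forall k w, (K <= k)%nat -> z k = Some w -> ~ P w.
Proof.
  intros H. apply NNPP. intros N.
  assert (G : forall m : nat, exists n, INR m <= Rsum (indicator z P) (seq 0 n)).
  { induction m as [|m [n IH]]; [exists 0%nat; simpl; lra|].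
    assert (Hk : exists k w, (n <= k)%nat /\ z k = Some w /\ P w).
    { apply NNPP. intros N'. apply N. exists n. intros k w Hk Hz HP. apply N'. eauto. }
    destruct Hk as [k [w [Hk [Hz HP]]]].
    exists (S k). rewrite seq_S, Rsum_app, S_INR.
    replace k with (n + (k - n))%nat at 1 by lia. rewrite seq_app, Rsum_app.
    assert (H1 : 0 <= Rsum (indicator z P) (seq (0 + n) (k - n)))
      by (apply Rsum_ge0; intros; apply indicator_ge0).
    assert (H2 : Rsum (indicator z P) [(0 + k)%nat] = 1).
    { simpl. unfold indicator. rewrite Hz.
      destruct (excluded_middle_informative (P w)); [ring|contradiction]. }
    lra. }
  destruct (nfloor_ex (Rmax 0 B)) as [m [_ Hm]]; [apply Rmax_l|].
  destruct (G (S m)) as [n Hn]. rewrite S_INR in Hn.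
  specialize (H 0%nat n). assert (R := Rmax_r 0 B). lra.
Qed.

Lemma Rsum_sum_n_m (f : nat -> R) (a n : nat) :
  Rsum f (seq a (S n)) = sum_n_m f a (a + n).
Proof.
  induction n as [|n IH].
  - rewrite Nat.add_0_r, sum_n_n. simpl. lra.
  - rewrite seq_S, Rsum_app, IH. replace (a + S n)%nat with (S (a + n)) by lia.
    rewrite sum_n_Sm by lia. simpl. unfold plus; simpl.
    replace (a + S n)%nat with (S (a + n)) by lia. ring.
Qed.

(** Off the sector, |Im (1 / w)| = |Im w| / |w|^2 > delta / |w|, so a tail of the Blaschke series
    below delta eta suffices. *)
Lemma blaschke_tail (z : nat -> option C) (delta eta : R) : 0 < delta -> 0 < eta ->
  Blaschke_near_infty z ->
  exists K, forall a n, (K <= a)%nat -> (forall w, In w (points z a n) -> w <> RtoC 0) ->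
    Rsum (fun w => / Cmod w) (filter (fun w => negb (nearly_real delta w)) (points z a n)) <= eta.
Proof.
  intros Hd He HB.
  set (b := fun k => match z k with
    | Some w => if Ceq_dec w 0 then 0 else Rabs (Im (/ w)%C) | None => 0 end).
  assert (Hb : ex_series b) by exact HB.
  assert (Hb0 : forall k, 0 <= b k).
  { intros k. unfold b. destruct (z k) as [w|]; [|lra]. destruct (Ceq_dec w 0); [lra|apply Rabs_pos]. }
  apply (Cauchy_ex_series (K := R_AbsRing) (V := R_CompleteNormedModule)) in Hb.
  assert (Hde : 0 < delta * eta) by nra.
  destruct (Hb (mkposreal _ Hde)) as [K HK]. simpl in HK.
  exists K. intros a n Ha Hz.
  apply Rle_trans with (/ delta * Rsum b (seq a n)).
  - clear Ha HK. revert a Hz. induction n as [|n IH]; intros a Hz; [simpl; lra|].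
    change (points z a (S n)) with
      ((match z a with Some w => [w] | None => [] end) ++ points z (S a) n) in *.
    change (Rsum b (seq a (S n))) with (b a + Rsum b (seq (S a) n)).
    rewrite filter_app, Rsum_app, Rmult_plus_distr_l.
    apply Rplus_le_compat; [|apply IH; intros w Hw; apply Hz, in_or_app; now right].
    assert (Hid : 0 < / delta) by now apply Rinv_0_lt_compat.
    unfold b. destruct (z a) as [w|]; [|simpl; lra].
    assert (Hw : w <> RtoC 0) by (apply Hz, in_or_app; left; now left).
    destruct (Ceq_dec w 0) as [|_]; [congruence|]. simpl filter.
    unfold nearly_real. destruct (Rleb_spec (Rabs (Im w)) (delta * Cmod w)) as [Q|Q].
    + change (0 <= / delta * Rabs (Im (/ w)%C)). apply Rmult_le_pos; [lra|apply Rabs_pos].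
    + change (/ Cmod w + 0 <= / delta * Rabs (Im (/ w)%C)). rewrite Rplus_0_r.
      assert (Hm : 0 < Cmod w) by now apply Cmod_gt_0.
      assert (E : Rabs (Im (/ w)%C) = Rabs (Im w) / Cmod w ^ 2).
      { assert (Em : fst w ^ 2 + snd w ^ 2 = Cmod w ^ 2).
        { unfold Cmod. rewrite pow2_sqrt; [reflexivity|nra]. }
        unfold Im, Cinv. cbn [snd fst]. rewrite Em. unfold Rdiv. rewrite Rabs_mult, Rabs_Ropp.
        f_equal. apply Rabs_pos_eq. left. apply Rinv_0_lt_compat. nra. }
      rewrite E.
      apply Rle_trans with (/ delta * (delta * Cmod w / Cmod w ^ 2)).
      * right. field. lra.
      * apply Rmult_le_compat_l; [lra|]. apply Rmult_le_compat_r; [|lra].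
        left. apply Rinv_0_lt_compat. nra.
  - destruct n as [|n]; [simpl; lra|].
    rewrite Rsum_sum_n_m. specialize (HK a (a + n)%nat Ha ltac:(lia)).
    unfold norm in HK; simpl in HK. unfold abs in HK; simpl in HK.
    assert (R := Rle_abs (sum_n_m b a (a + n))).
    apply Rle_trans with (/ delta * (delta * eta)); [|right; field; lra].
    apply Rmult_le_compat_l; [left; now apply Rinv_0_lt_compat|left; exact (Rle_lt_trans _ _ _ R HK)].
Qed.

(** A linear combination involves finitely many exponents and powers, all present with sufficient
    multiplicity in some initial segment; that segment is the finite part on which the functional
    will be built. *)
Lemma span_primitive (z : nat -> option C) (p : C) (l : list (C * (C -> C))) :
  List.Forall (fun q => Exp_system z (snd q)) l ->
  exists (N : nat) (Phi : C -> C -> C),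
    (forall s, line_primitive (Phi s) (fun y => Cexp (- s * y)
        * fold_right (fun q t => fst q * snd q (y + p) + t) (RtoC 0) l)%C) /\
    forall T w sg,
      (forall v m, (S m <= count_occ Ceq_dec (points z 0 N) v)%nat ->
         functional T w (fun s => monomial_primitive v p s m) sg = RtoC 0) ->
      functional T w Phi sg = RtoC 0.
Proof.
  induction l as [|[c e] l IH]; intros F.
  - exists 0%nat, (fun _ _ => RtoC 0). split.
    + intros s. eapply line_primitive_ext; [| |apply (line_primitive_const 0)].
      * reflexivity.
      * intros y. simpl. ring.
    + intros T w sg _. unfold functional.
      transitivity (Csum (fun s => 0 * s)%C sg).
      * apply Csum_ext. intros s _. ring.
      * rewrite Csum_scal. ring.
  - inversion F as [|? ? He F']; subst. simpl in He.
    destruct (IH F') as [N [Phi [H1 H2]]].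
    destruct He as [k [v [m [Hk [Hm ->]]]]].
    destruct (multiplicity_reached z v m Hm) as [N' HN'].
    exists (N + N')%nat, (fun s y => c * monomial_primitive v p s m y + Phi s y)%C. split.
    + intros s. eapply line_primitive_ext;
        [| |apply (line_primitive_plus _ _ _ _
              (line_primitive_scal c _ _ (monomial_primitive_correct v p s m)) (H1 s))].
      * reflexivity.
      * intros y. simpl. unfold exp_monomial. ring.
    + intros T w sg H. rewrite functional_linear.
      assert (C1 : (count_occ Ceq_dec (points z 0 N') v <= count_occ Ceq_dec (points z 0 (N + N')) v)%nat).
      { rewrite (Nat.add_comm N N'), points_app, count_occ_app. lia. }
      change (c * functional T w (fun s => monomial_primitive v p s m) sg
              + functional T w Phi sg = RtoC 0)%C.
      rewrite (H v m) by lia. rewrite H2; [ring|].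
      intros v' m' Hv'. apply H. rewrite points_app, count_occ_app. lia.
Qed.

Theorem mainTheorem7
  (z : nat -> option C)
  (hdens : finite_upper_density z)
  (hBlaschke : Blaschke_near_infty z)
  (eps : R) (heps : (0 < eps)%R)
  (S : C -> Prop)
  (hS : vertical_strip eps S \/ vertical_half_strip eps S) :
  ~ complete_in_Hol S (Exp_system z).
Proof.
  intros Hcomp.
  (* A closed rectangle of half-width eps / 4 fits strictly inside the strip, whose half-width is
     eps / 2. *)
  set (h := eps / 4). assert (Hh : 0 < h) by (unfold h; lra).
  destruct (density_bound z hdens) as [r0 [K0 [Hr0 [HK0 Hd]]]].
  destruct (regular_pairs K0 (h / 4) HK0 ltac:(lra))
    as [delta [eta [tau [K [G [w [Hdelta [Heta [Htau [HK [HwG Hpairs]]]]]]]]]]].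
  destruct (blaschke_tail z delta eta Hdelta Heta hBlaschke) as [Kb Htail].
  destruct (eventually_no_indicator z (fun v => Cmod v <= r0) (K0 * r0)
     (fun a n => Hd r0 (Rle_refl r0) a n)) as [Kd Hfar].
  (* Indices below K1 carry all points of modulus at most r0, in particular all those at 0, and the
     head of the Blaschke series. They are fixed before any approximant is known. *)
  set (K1 := (Kb + Kd)%nat).
  set (A0 := points z 0 K1).
  set (mu := count_occ Ceq_dec A0 (RtoC 0)).
  destruct (count_occ_extract A0 (RtoC 0) mu ltac:(unfold mu; lia)) as [A1 [PA EA]].
  fold mu in EA.
  assert (HA1 : ~ In (RtoC 0) A1).
  { intros Hin. apply (count_occ_In Ceq_dec) in Hin. lia. }
  destruct (affine_prod_exp A0 (h / 4) ltac:(lra)) as [KB [HKB HB]].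
  set (ex := extra G w A0).
  destruct (imaginary_axis_decay A0 (map (node tau) ex)) as [KA [HKA HA]].
  { unfold ex, extra. now rewrite !length_map, length_seq. }
  { intros t Ht. apply in_map_iff in Ht. destruct Ht as [n [<- _]]. now apply node_gt0. }
  set (T := height tau).
  assert (HT : 0 < T).
  { unfold T, height. apply Rdiv_lt_0_compat; [apply PI_RGT_0|lra]. }
  set (Bd := 2 * (2 * (h + KA ^ 2 / 2) + 2 * T
         * (KB * K * (/ tau ^ 2) ^ length ex * / (1 - exp (- (h / 2 * tau)))))).
  set (val := (2 * INR (fact mu) * (Cprod (fun a => 0 - a) A1
       / Cprod (fun n => - RtoC (node tau n) ^ 2) ex))%C).
  assert (Hval : 0 < Cmod val).
  { apply Cmod_gt_0. unfold val. repeat apply Cmult_neq_0.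
    - intros E. apply RtoC_inj in E. lra.
    - intros E. apply RtoC_inj in E. assert (F := INR_fact_lt_0 mu). lra.
    - apply Cprod_neq0. intros a Ha. apply Cminus_neq0. congruence.
    - intros E.
      assert (N2 : Cprod (fun n => - RtoC (node tau n) ^ 2)%C ex <> RtoC 0).
      { apply Cprod_neq0. intros n _ E'.
        assert (N := node_gt0 tau Htau n).
        apply (f_equal Cmod) in E'. rewrite Cmod_opp, Cmod_0 in E'. simpl in E'.
        rewrite !Cmod_mult, Cmod_1, Cmod_R, Rabs_pos_eq in E' by lra. nra. }
      apply (f_equal Cmod) in E. rewrite Cmod_inv, Cmod_0 in E by exact N2.
      assert (0 < Cmod (Cprod (fun n => - RtoC (node tau n) ^ 2)%C ex)) by now apply Cmod_gt_0.
      assert (0 < / Cmod (Cprod (fun n => - RtoC (node tau n) ^ 2)%C ex)) by now apply Rinv_0_lt_compat.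
      lra. }
  assert (HBd : 0 <= Bd).
  { assert (Hexp : exp (- (h / 2 * tau)) < 1) by (rewrite <- exp_0; apply exp_increasing; nra).
    unfold Bd. apply Rmult_le_pos; [lra|]. apply Rplus_le_le_0_compat.
    - apply Rmult_le_pos; [lra|]. assert (0 <= KA ^ 2) by apply pow2_ge_0. lra.
    - apply Rmult_le_pos; [lra|].
      apply Rmult_le_pos; [|left; apply Rinv_0_lt_compat; lra].
      apply Rmult_le_pos; [apply Rmult_le_pos; lra|].
      apply pow_le. left. apply Rinv_0_lt_compat. nra. }
  (* In a half-strip the rectangle is pushed beyond the edge by T + 1; this is the only place where
     the shape of the domain enters. *)
  assert (Hp : exists p : C, forall v : C, Re p - h <= Re v <= Re p + h ->
     Im p - T <= Im v <= Im p + T -> S v).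
  { destruct hS as [[c H]|[c [d [H|H]]]].
    - exists (c + eps / 2, 0). intros v H1 H2. apply H. unfold h in *. simpl in *. lra.
    - exists (c + eps / 2, d + T + 1). intros v H1 H2. apply H. unfold h in *. simpl in *. lra.
    - exists (c + eps / 2, d - T - 1). intros v H1 H2. apply H. unfold h in *. simpl in *. lra. }
  destruct Hp as [p Hp].
  (* [Bd] and [val] are already fixed, so the accuracy can be chosen with e0 * Bd < |val| before
     completeness supplies an approximant and thereby the finite part. *)
  set (e0 := Cmod val / (2 * (Bd + 1))).
  assert (He0 : 0 < e0) by (unfold e0; apply Rdiv_lt_0_compat; lra).
  destruct (Hcomp (fun v => (v - p) ^ mu)%C
     ltac:(intros v _; apply ex_derive_shifted_power)
     (fun v => Re p - h <= Re v <= Re p + h /\ Im p - T <= Im v <= Im p + T)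
     (compact_rectangle _ _ _ _) ltac:(intros v [H1 H2]; now apply Hp) e0 He0)
    as [g [[l [Fl ->]] Hg]].
  destruct (span_primitive z p l Fl) as [N [Phi [HPhi Hkill]]].
  set (reg := points z K1 N).
  assert (Hregmod : forall v, In v reg -> r0 < Cmod v).
  { intros v Hv. apply points_In in Hv. destruct Hv as [k [Hk Hz]].
    apply Rnot_le_lt. apply (Hfar k v); auto. unfold K1 in Hk. lia. }
  destruct (Hpairs reg) as [pr [P1 [P2 [P3 [P4 P5]]]]].
  { intros v Hv. apply Hregmod in Hv. lra. }
  { intros r Hr. unfold count_le, reg.
    rewrite (points_count z _ (fun v => Cmod v <= r)).
    2:{ intros v. destruct (Rleb_spec (Cmod v) r); split; auto; easy. }
    destruct (Rle_dec r0 r) as [C|C]; [now apply Hd|].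
    rewrite (Rsum_ext _ (fun _ => 0)).
    - rewrite Rsum_const, Rmult_0_r. apply Rmult_le_pos; lra.
    - intros k Hk. apply in_seq in Hk. unfold indicator.
      destruct (z k) as [v|] eqn:Ez; [|reflexivity].
      destruct (excluded_middle_informative (Cmod v <= r)) as [Q|Q]; [|reflexivity].
      exfalso. apply (Hfar k v ltac:(unfold K1 in Hk; lia) Ez). lra. }
  { apply Htail; [unfold K1; lia|]. intros v Hv E. apply Hregmod in Hv.
    rewrite E, Cmod_0 in Hv. lra. }
  set (wt := weight tau G w A0 pr). set (sg := both (nodes tau G w A0 pr)).
  (* Primitive for the power minus its approximant: the functional has the value [val] on it,
     although its modulus stays below e0 on the rectangle. *)
  set (Psi := fun s y => (- (1) * Phi s y + monomial_primitive 0 0 s mu y)%C).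
  assert (V1 : functional T wt (fun s => monomial_primitive 0 0 s mu) sg = val).
  { unfold wt, sg, T, val, ex. now apply weight_value. }
  assert (V2 : functional T wt Phi sg = RtoC 0).
  { apply Hkill. intros v m Hv. unfold wt, sg, T. apply weight_kill; auto.
    unfold zeros. rewrite count_occ_app.
    assert (Q1 : (count_occ Ceq_dec (points z 0 N) v <= count_occ Ceq_dec A0 v + count_occ Ceq_dec reg v)%nat).
    { rewrite <- count_occ_app. unfold A0, reg.
      change (points z K1 N) with (points z (0 + K1) N).
      rewrite <- (points_app z 0 K1 N), (Nat.add_comm K1 N), points_app, count_occ_app. lia. }
    assert (Q2 := P1 v).
    assert (Q3 : (count_occ Ceq_dec (map fst pr) v
       <= count_occ Ceq_dec (flat_map (fun p0 : C * nat => [fst p0; (- fst p0)%C]) pr) v)%nat).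
    { clear. induction pr as [|q qs IH]; simpl; [lia|].
      destruct (Ceq_dec (fst q) v), (Ceq_dec (- fst q) v); lia. }
    lia. }
  assert (V3 : functional T wt Psi sg = val).
  { unfold Psi. rewrite functional_linear.
    change (- (1) * functional T wt Phi sg
            + functional T wt (fun s => monomial_primitive 0 0 s mu) sg = val)%C.
    rewrite V1, V2. ring. }
  assert (Bnd : Cmod (functional T wt Psi sg) <= e0 * Bd).
  { unfold wt, sg, Bd, T, ex.
    apply (weight_bound tau K h G w A0 Htau HK Hh HwG pr P2 P3 P4 P5 KA KB HKA HKB HB HA Psi
      (fun y => (y + p - p) ^ mu - fold_right (fun q t => fst q * snd q (y + p) + t) (RtoC 0) l)%C).
    - intros s. eapply line_primitive_ext;
        [| |apply (line_primitive_plus _ _ _ _ (line_primitive_scal (- (1)) _ _ (HPhi s))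
               (monomial_primitive_correct 0 0 s mu))].
      + reflexivity.
      + intros y. simpl. unfold exp_monomial.
        replace (0 * (y + 0))%C with (RtoC 0) by ring. rewrite Cexp_0.
        replace (y + 0)%C with (y + p - p)%C by ring. ring.
    - intros y Hy1 Hy2. left. apply Hg.
      apply Rabs_le_between in Hy1, Hy2. fold T in Hy2.
      unfold Re, Im in *. simpl. lra. }
  rewrite V3 in Bnd.
  assert (e0 * (Bd + 1) = Cmod val / 2) by (unfold e0; field; lra).
  nra.
Qed.
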